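(* Assume (F1)--(F4) and (H1)--(H3) as listed in the context. Let $(t\mapsto\tilde\rho_t)\in C_{\rm w}$, $f\in L^2_H$ and $\alpha,\beta>0$. For a.e. $t\in(0,1)$ set $w_t:=-K_t(K_t^*\tilde\rho_t-f_t)$, extended by $w_t(x):=0$ for all $x\in\mathbb R^d\smallsetminus\overline\Omega$. Then the functional $F:H^1\to\mathbb R$, $$F(\gamma):=\frac{-\int_0^1w_t(\gamma(t))\,dt}{\frac\beta2\int_0^1|\dot\gamma(t)|^2dt+\alpha},$$ where $H^1:=H^1([0,1];\mathbb R^d)$, is continuously Fréchet differentiable. If $\{\gamma^n\}$ in $H^1$ is a descent sequence for $F$, that is, $F(\gamma^0)<0$ and $\gamma^{n+1}=\gamma^n-\delta_nD_{\gamma^n}F$ for all $n\in\mathbb N\cup\{0\}$, where $D_{\gamma^n}F\in(H^1)^*$ is the Fréchet derivative of $F$ at $\gamma^n$ identified with its Riesz representative in $H^1$ and the stepsizes $\{\delta_n\}$ are chosen according to the Armijo--Goldstein or Backtracking-Armijo rules, then, up to subsequences, $\gamma^n\to\gamma^*$ strongly in $H^1$. Any such accumulation point $\gamma^*$ satisfies $F(\gamma^* )<0$ and is stationary for $F$, that is, $D_{\gamma^*}F=0$. Moreover $\gamma^*([0,1])\subset E$, where $E\Subset\Omega$ is the closed convex set in (F4).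
   Context: $\Omega\subset\mathbb R^d$ ($d\ge1$) is a bounded open domain. $\mathcal M(\overline\Omega)$ is the space of bounded Borel measures on $\overline\Omega$. $C_{\rm w}$ is the set of curves $t\in[0,1]\mapsto\rho_t\in\mathcal M(\overline\Omega)$ such that $t\mapsto\int_{\overline\Omega}\varphi\,d\rho_t$ is continuous for all $\varphi\in C(\overline\Omega)$. **(H).** For a.e. $t\in(0,1)$, $H_t$ is a real Hilbert space; $D$ is a real Banach space and for a.e. $t$ there is a linear continuous $i_t:D\to H_t$ with: (H1) $\|i_t\|\le C$ with $C$ independent of $t$; (H2) $i_t(D)$ is dense in $H_t$; (H3) $t\mapsto\langle i_t\varphi,i_t\psi\rangle_{H_t}$ is Lebesgue measurable for all $\varphi,\psi\in D$. With $H=\bigcup_tH_t$, a map $f:[0,1]\to H$ with $f_t\in H_t$ a.e. is strongly measurable if it is the a.e. limit (i.e. $\|f_t-s^k_t\|_{H_t}\to0$ for a.e. $t$) of step functions $s^k_t=\sum_j\chi_{A_j}(t)\,i_t\varphi_j$ (finite sums, $A_j$ measurable, $\varphi_j\in D$). $L^2_H$ is the Hilbert space of strongly measurable $f$ with $\int_0^1\|f_t\|_{H_t}^2dt<\infty$. **$C^{1,1}$.** For closed $S\subseteq\mathbb R^d$, $C^{1,1}(S)$ is the space of differentiable $\varphi:S\to\mathbb R$ with finite norm $\|\varphi\|_{C^{1,1}(S)}:=\|\varphi\|_\infty+\|\nabla\varphi\|_\infty+\mathrm{Lip}(\nabla\varphi)$. Measures act on $C^{1,1}(\overline\Omega)$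 by integration, giving $\mathcal M(\overline\Omega)\hookrightarrow C^{1,1}(\overline\Omega)^*$. **(F).** For a.e. $t\in(0,1)$, $K_t^*:C^{1,1}(\overline\Omega)^*\to H_t$ is linear continuous and: (F1) it is weak*-to-weak continuous, with pre-adjoint $K_t:H_t\to C^{1,1}(\overline\Omega)$; (F2) $\|K_t^*\|\le C$ with $C$ independent of $t$; (F3) $t\mapsto K_t^*\rho$ is strongly measurable for every fixed $\rho\in\mathcal M(\overline\Omega)$; (F4) there is a closed convex set $E\Subset\Omega$ with $\operatorname{supp}(K_tf),\operatorname{supp}(\nabla(K_tf))\subset E$ for all $f\in H_t$ and a.e. $t\in(0,1)$ ($\nabla$ is the spatial gradient). **Stepsize rules** (standard). Writing $D_n$ for the Riesz representative of $D_{\gamma^n}F$: Backtracking-Armijo: for fixed $\bar\delta>0$ and $\tau,\sigma\in(0,1)$, $\delta_n$ is the largest element of $\{\bar\delta\tau^k:k=0,1,2,\dots\}$ with $F(\gamma^n-\delta_nD_n)\le F(\gamma^n)-\sigma\delta_n\|D_n\|_{H^1}^2$. Armijo--Goldstein: for a fixed $\sigma\in(0,1/2)$, $\delta_n>0$ satisfies $F(\gamma^n)-(1-\sigma)\delta_n\|D_n\|_{H^1}^2\le F(\gamma^n-\delta_nD_n)\le F(\gamma^n)-\sigma\delta_n\|D_n\|_{H^1}^2$. *)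

(* Defs.v *)
From HB Require Import structures.
From mathcomp Require Import all_boot all_order all_algebra.
From mathcomp Require Import all_classical all_reals all_analysis measurable_realfun.
From mathcomp Require Import lra ring.

Set Implicit Arguments.
Unset Strict Implicit.
Unset Printing Implicit Defensive.

Import Order.TTheory GRing.Theory Num.Theory.
Import numFieldNormedType.Exports.

Local Open Scope classical_set_scope.
Local Open Scope ring_scope.

Section PsdForm.
Variables (R : realType) (V : lmodType R) (b : V -> V -> R).
Hypothesis bC : forall x y, b x y = b y x.
Hypothesis bDl : forall x y z, b (x + y) z = b x z + b y z.
Hypothesis bZl : forall a x z, b (a *: x) z = a * b x z.
Hypothesis b_ge0 : forall x, 0 <= b x x.

Lemma psd_CauchySchwarz x y : b x y ^+ 2 <= b x x * b y y.
Proof.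
have H s t : 0 <= s ^+ 2 * b x x + 2 * (s * t * b x y) + t ^+ 2 * b y y.
  have := b_ge0 (s *: x + t *: y).
  rewrite !bDl ![b _ (_ + _)]bC !bDl !bZl ![b _ (_ *: _)]bC !bZl (bC y x).
  by move=> h; apply: (le_trans h); rewrite le_eqVlt; apply/orP; left; apply/eqP; ring.
have [x0|x0] := eqVneq (b x x) 0.
  rewrite x0 mul0r.
  have H1 := H (- (b y y + 1)) (b x y).
  rewrite x0 in H1.
  have := b_ge0 y.
  set c := b x y in H1 *; set e := b y y in H1 *.
  by move=> e0; nra.
have xp : 0 < b x x by rewrite lt_neqAle eq_sym x0 b_ge0.
have H1 := H (- b x y) (b x x).
have : 0 <= b x x * (b x x * b y y - b x y ^+ 2) by move: H1; nra.
by rewrite pmulr_rge0// subr_ge0.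
Qed.

Definition psd_norm x := Num.sqrt (b x x).

Lemma psd_normD x y : psd_norm (x + y) <= psd_norm x + psd_norm y.
Proof.
rewrite /psd_norm -[leRHS]ger0_norm ?addr_ge0 ?sqrtr_ge0// -sqrtr_sqr.
apply: ler_wsqrtr; rewrite sqrrD !sqr_sqrtr ?b_ge0//.
rewrite !bDl ![b _ (_ + _)]bC !bDl (bC y x).
have : b x y <= Num.sqrt (b x x) * Num.sqrt (b y y).
  rewrite -sqrtrM// (le_trans (ler_norm _))// -sqrtr_sqr.
  exact/ler_wsqrtr/psd_CauchySchwarz.
by rewrite mulr2n; lra.
Qed.

Lemma psd_normZ a x : psd_norm (a *: x) = `|a| * psd_norm x.
Proof.
by rewrite /psd_norm bZl bC bZl mulrA -expr2 sqrtrM ?sqr_ge0// sqrtr_sqr.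
Qed.

End PsdForm.

Section Euclid.
Variables (R : realType) (d : nat).
Implicit Types x y z : 'rV[R]_d.

Definition dotv x y : R := \sum_(i < d) x 0 i * y 0 i.

(* The library norm on row vectors is the sup norm. *)
Definition enorm x : R := Num.sqrt (dotv x x).

Lemma dotvC x y : dotv x y = dotv y x.
Proof. by apply: eq_bigr => i _; rewrite mulrC. Qed.

Lemma dotvDl x y z : dotv (x + y) z = dotv x z + dotv y z.
Proof. by rewrite -big_split; apply: eq_bigr => i _; rewrite mxE mulrDl. Qed.

Lemma dotvZl a x z : dotv (a *: x) z = a * dotv x z.
Proof. by rewrite mulr_sumr; apply: eq_bigr => i _; rewrite mxE mulrA. Qed.

Lemma dotv_ge0 x : 0 <= dotv x x.
Proof. by apply: sumr_ge0 => i _; rewrite -expr2 sqr_ge0. Qed.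

Lemma enorm_ge0 x : 0 <= enorm x.
Proof. exact: sqrtr_ge0. Qed.

Lemma enormD x y : enorm (x + y) <= enorm x + enorm y.
Proof. exact: (psd_normD dotvC dotvDl dotvZl dotv_ge0). Qed.

Lemma enormZ a x : enorm (a *: x) = `|a| * enorm x.
Proof. exact: (psd_normZ dotvC dotvZl). Qed.

Lemma enorm_eq0 x : enorm x = 0 -> x = 0.
Proof.
move=> /eqP; rewrite sqrtr_eq0 => x0.
have /eqP : dotv x x = 0 by apply/eqP; rewrite eq_le x0 dotv_ge0.
rewrite psumr_eq0; last by move=> i _; rewrite -expr2 sqr_ge0.
move=> /allP h; apply/rowP => i; rewrite mxE.
by have := h i (mem_index_enum i); rewrite -expr2 sqrf_eq0 => /eqP.
Qed.

End Euclid.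

Section SupOn.
Variables (R : realType) (T : Type).
Implicit Types (A : set T) (f g : T -> R).

Definition supon A f : R := sup [set f x | x in A].

Lemma supon_le A f M : 0 <= M -> (forall x, A x -> f x <= M) -> supon A f <= M.
Proof.
move=> M0 fM; rewrite /supon; have [->|A0] := eqVneq A set0.
  by rewrite image_set0 sup0.
apply: ge_sup; first by move/set0P : A0 => [x Ax]; exists (f x), x.
by move=> _ [x Ax <-]; exact: fM.
Qed.

Lemma supon_ub A f x : has_ubound [set f x | x in A] -> A x -> f x <= supon A f.
Proof. by move=> ub Ax; apply: ub_le_sup => //; exists x. Qed.

Lemma supon_ge0 A f : has_ubound [set f x | x in A] ->
  (forall x, 0 <= f x) -> 0 <= supon A f.
Proof.
move=> ub f0; have [->|/set0P[x Ax]] := eqVneq A set0.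
  by rewrite /supon image_set0 sup0.
by rewrite (le_trans (f0 x))// supon_ub.
Qed.

Lemma suponD A f g h : (forall x, A x -> h x <= f x + g x) ->
  has_ubound [set f x | x in A] -> has_ubound [set g x | x in A] ->
  (forall x, 0 <= f x) -> (forall x, 0 <= g x) ->
  has_ubound [set h x | x in A] /\ supon A h <= supon A f + supon A g.
Proof.
move=> hfg fub gub f0 g0.
have hA x : A x -> h x <= supon A f + supon A g.
  by move=> Ax; rewrite (le_trans (hfg _ Ax))// lerD// supon_ub.
split; first by exists (supon A f + supon A g) => _ [x Ax <-]; exact: hA.
by apply: supon_le => //; rewrite addr_ge0// supon_ge0.
Qed.

Lemma suponZ A f h (c : R) : 0 <= c -> (forall x, A x -> h x = c * f x) ->
  has_ubound [set f x | x in A] -> (forall x, 0 <= f x) ->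
  has_ubound [set h x | x in A] /\ supon A h = c * supon A f.
Proof.
move=> c0 hE fub f0.
have hA x : A x -> h x <= c * supon A f.
  by move=> Ax; rewrite hE// ler_wpM2l// supon_ub.
have hub : has_ubound [set h x | x in A].
  by exists (c * supon A f) => _ [x Ax <-]; exact: hA.
split=> //; apply/eqP; rewrite eq_le; apply/andP; split.
  by apply: supon_le => //; rewrite mulr_ge0// supon_ge0.
have [->|cN0] := eqVneq c 0.
  rewrite mul0r; have [->|/set0P[x Ax]] := eqVneq A set0.
    by rewrite /supon image_set0 sup0.
  by rewrite (le_trans _ (supon_ub hub Ax))// hE// mulr_ge0.
have cp : 0 < c by rewrite lt_neqAle eq_sym cN0.
rewrite -ler_pdivlMl//; apply: supon_le.
  have [->|/set0P[x Ax]] := eqVneq A set0.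
    by rewrite /supon image_set0 sup0 mulr0.
  rewrite mulr_ge0 ?invr_ge0// (le_trans _ (supon_ub hub Ax))// hE//.
  exact: mulr_ge0.
by move=> x Ax; rewrite ler_pdivlMl// -hE//; exact: supon_ub.
Qed.

End SupOn.

Section C11.
Variables (R : realType) (d : nat).
Local Notation E := 'rV[R]_d.

Definition grad_at (S : set E) (phi : E -> R) (x g : E) : Prop :=
  forall e : R, 0 < e -> \forall y \near within S (nbhs x),
    `|phi y - phi x - dotv g (y - x)| <= e * enorm (y - x).

Definition lip_quot (g : E -> E) (p : E * E) : R :=
  enorm (g p.1 - g p.2) / enorm (p.1 - p.2).

(* An element is a function together with its gradient field, both set to 0
   off S so that Leibniz equality is equality on S. When S is the closure of an
   open set the gradient is determined by the function (C11_inj below), so this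
   is just a space of functions there. *)
Definition is_C11 (S : set E) : {pred (E -> R^o) * (E -> E)} := fun p =>
  `[< [/\ forall x, ~ S x -> p.1 x = 0 /\ p.2 x = 0,
          forall x, S x -> grad_at S p.1 x (p.2 x),
          has_ubound [set `|p.1 x| | x in S],
          has_ubound [set enorm (p.2 x) | x in S] &
          has_ubound [set lip_quot p.2 q | q in S `*` S]] >].

Record C11 (S : set E) := MkC11 {
  c11_pair : (E -> R^o) * (E -> E) ;
  c11_pairP : c11_pair \in is_C11 S }.

Definition c11_fun (S : set E) (u : C11 S) : E -> R := (c11_pair u).1.
Coercion c11_fun : C11 >-> Funclass.

Definition grad (S : set E) (u : C11 S) : E -> E := (c11_pair u).2.

HB.instance Definition _ (S : set E) := [isSub for @c11_pair S].
HB.instance Definition _ (S : set E) := [Choice of C11 S by <:].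

Lemma lip_quot_ge0 g p : 0 <= lip_quot g p.
Proof. by rewrite divr_ge0 ?enorm_ge0. Qed.

Lemma enorm0 : enorm (0 : E) = 0.
Proof. by rewrite -(scale0r (0 : E)) enormZ normr0 mul0r. Qed.

Lemma dotv0l (x : E) : dotv 0 x = 0.
Proof. by rewrite -(scale0r (0 : E)) dotvZl mul0r. Qed.

Lemma lip_quotD g h p : lip_quot (g + h) p <= lip_quot g p + lip_quot h p.
Proof.
rewrite /lip_quot -mulrDl ler_wpM2r ?invr_ge0 ?enorm_ge0//.
by rewrite !fctE opprD addrACA enormD.
Qed.

Lemma lip_quotZ a g p : lip_quot (a *: g) p = `|a| * lip_quot g p.
Proof. by rewrite /lip_quot mulrA -enormZ scalerBr. Qed.

Lemma is_C11_submod S : submod_closed (is_C11 S).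
Proof.
split.
  rewrite inE; split => //.
  - move=> x _ e e0; near=> y.
    rewrite -[leLHS]/`|0 - 0 - dotv (0 : E) (y - x)| dotv0l !subrr normr0.
    by rewrite mulr_ge0 ?enorm_ge0// ltW.
  - by exists 0 => _ [x _ <-]; rewrite normr0.
  - by exists 0 => _ [x _ <-]; rewrite /= enorm0.
  - by exists 0 => _ [x _ <-]; rewrite /lip_quot/= subrr enorm0 mul0r.
move=> a u v; rewrite !inE => -[u0 ug ub uG uL] [v0 vg vb vG vL]; split.
- move=> x Sx; have [u1 u2] := u0 x Sx; have [v1 v2] := v0 x Sx.
  split.
    rewrite -[LHS]/(a *: u.1 x + v.1 x); by rewrite u1 v1 scaler0 addr0.
  rewrite -[LHS]/(a *: u.2 x + v.2 x); by rewrite u2 v2 scaler0 addr0.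
- move=> x Sx e e0.
  have a0 : 0 < `|a| + 1 by rewrite ltr_wpDl.
  have e1 : 0 < e / 2 / (`|a| + 1) by rewrite !divr_gt0.
  have e2 : 0 < e / 2 by rewrite divr_gt0.
  have := vg x Sx _ e2; have := ug x Sx _ e1; apply: filterS2 => y hu hv.
  rewrite -[(_ + v).1 y]/(a * u.1 y + v.1 y) -[(_ + v).1 x]/(a * u.1 x + v.1 x).
  rewrite -[(_ + v).2 x]/(a *: u.2 x + v.2 x) dotvDl dotvZl.
  rewrite (_ : _ - _ = a * (u.1 y - u.1 x - dotv (u.2 x) (y - x)) +
    (v.1 y - v.1 x - dotv (v.2 x) (y - x))); last by ring.
  rewrite (le_trans (ler_normD _ _))// normrM (splitr e) mulrDl lerD//.
  apply: (@le_trans _ _ (`|a| * (e / 2 / (`|a| + 1) * enorm (y - x)))).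
    by rewrite ler_wpM2l.
  rewrite mulrA ler_wpM2r ?enorm_ge0// mulrCA ger_pMr//.
  by rewrite ler_pdivrMr// mul1r lerDl.
- have [] := @suponZ _ _ S (fun x => `|u.1 x|) (fun x => `|(a *: u).1 x|) `|a|.
  + by [].
  + by move=> x _; rewrite /= !fctE normrZ.
  + by [].
  + by move=> x; exact: normr_ge0.
  move=> aub _.
  by have [] := @suponD _ _ S (fun x => `|(a *: u).1 x|) (fun x => `|v.1 x|)
    (fun x => `|(a *: u + v).1 x|) (fun x _ => ler_normD _ _) aub vb
    (fun=> normr_ge0 _) (fun=> normr_ge0 _).
- have [] := @suponZ _ _ S (fun x => enorm (u.2 x))
    (fun x => enorm ((a *: u).2 x)) `|a|.
  + by [].
  + by move=> x _; rewrite /= !fctE enormZ.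
  + by [].
  + by move=> x; exact: enorm_ge0.
  move=> aub _.
  by have [] := @suponD _ _ S (fun x => enorm ((a *: u).2 x))
    (fun x => enorm (v.2 x)) (fun x => enorm ((a *: u + v).2 x))
    (fun x _ => enormD _ _) aub vG (fun=> enorm_ge0 _) (fun=> enorm_ge0 _).
- have [] := @suponZ _ _ (S `*` S) (lip_quot u.2) (lip_quot (a *: u).2) `|a|.
  + by [].
  + by move=> x _; rewrite lip_quotZ.
  + by [].
  + by move=> x; exact: lip_quot_ge0.
  move=> aub _.
  by have [] := @suponD _ _ (S `*` S) (lip_quot (a *: u).2) (lip_quot v.2)
    (lip_quot (a *: u + v).2) (fun x _ => lip_quotD _ _ _) aub vL
    (fun=> lip_quot_ge0 _ _) (fun=> lip_quot_ge0 _ _).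
Unshelve. all: by end_near. Qed.

HB.instance Definition _ (S : set E) :=
  GRing.isSubmodClosed.Build _ _ (is_C11 S) (is_C11_submod S).
HB.instance Definition _ (S : set E) :=
  [SubChoice_isSubLmodule of C11 S by <:].

Definition C11_norm (S : set E) (u : C11 S) : R :=
  supon S (fun x => `|c11_fun u x|) + supon S (fun x => enorm (grad u x)) +
  supon (S `*` S) (lip_quot (grad u)).

Section norm.
Variable S : set E.
Implicit Types u v : C11 S.

Lemma C11P u : [/\ forall x, ~ S x -> c11_fun u x = 0 /\ grad u x = 0,
  forall x, S x -> grad_at S (c11_fun u) x (grad u x),
  has_ubound [set `|c11_fun u x| | x in S],
  has_ubound [set enorm (grad u x) | x in S] &
  has_ubound [set lip_quot (grad u) q | q in S `*` S]].
Proof. by have := c11_pairP u; rewrite inE. Qed.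

Lemma C11_normD u v : C11_norm (u + v) <= C11_norm u + C11_norm v.
Proof.
have [_ _ u1 u2 u3] := C11P u; have [_ _ v1 v2 v3] := C11P v.
have [_ h1] := @suponD _ _ S _ _ (fun x => `|c11_fun (u + v) x|)
  (fun x _ => ler_normD (c11_fun u x) (c11_fun v x)) u1 v1
  (fun=> normr_ge0 _) (fun=> normr_ge0 _).
have [_ h2] := @suponD _ _ S _ _ (fun x => enorm (grad (u + v) x))
  (fun x _ => enormD (grad u x) (grad v x)) u2 v2
  (fun=> enorm_ge0 _) (fun=> enorm_ge0 _).
have [_ h3] := @suponD _ _ (S `*` S) _ _ (lip_quot (grad (u + v)))
  (fun x _ => lip_quotD (grad u) (grad v) x) u3 v3
  (fun=> lip_quot_ge0 _ _) (fun=> lip_quot_ge0 _ _).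
by rewrite /C11_norm addrACA lerD// addrACA lerD.
Qed.

Lemma C11_normZ a u : C11_norm (a *: u) = `|a| * C11_norm u.
Proof.
have [_ _ u1 u2 u3] := C11P u.
have [_ h1] := @suponZ _ _ S _ (fun x => `|c11_fun (a *: u) x|) _
  (normr_ge0 a) (fun x _ => normrM a (c11_fun u x)) u1 (fun=> normr_ge0 _).
have [_ h2] := @suponZ _ _ S _ (fun x => enorm (grad (a *: u) x)) _
  (normr_ge0 a) (fun x _ => enormZ a (grad u x)) u2 (fun=> enorm_ge0 _).
have [_ h3] := @suponZ _ _ (S `*` S) _ (lip_quot (grad (a *: u))) _
  (normr_ge0 a) (fun x _ => lip_quotZ a (grad u) x) u3 (fun=> lip_quot_ge0 _ _).
by rewrite /C11_norm h1 h2 h3 !mulrDr.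
Qed.

Lemma C11_norm_ge u x : `|c11_fun u x| <= C11_norm u.
Proof.
have [u0 _ u1 u2 u3] := C11P u.
have g2 := supon_ge0 u2 (fun=> enorm_ge0 _).
have g3 := supon_ge0 u3 (fun=> lip_quot_ge0 _ _).
have g1 := supon_ge0 u1 (fun=> normr_ge0 _).
have [Sx|Sx] := pselect (S x).
  by rewrite /C11_norm -addrA (le_trans (supon_ub u1 Sx))// lerDl addr_ge0.
by rewrite (u0 _ Sx).1 normr0 !addr_ge0.
Qed.

Lemma C11_norm_grad_ge u x : enorm (grad u x) <= C11_norm u.
Proof.
have [u0 _ u1 u2 u3] := C11P u.
have g2 := supon_ge0 u2 (fun=> enorm_ge0 _).
have g3 := supon_ge0 u3 (fun=> lip_quot_ge0 _ _).
have g1 := supon_ge0 u1 (fun=> normr_ge0 _).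
have [Sx|Sx] := pselect (S x).
  rewrite /C11_norm addrAC (le_trans (supon_ub u2 Sx))// lerDr.
  by rewrite addr_ge0.
by rewrite (u0 _ Sx).2 enorm0 !addr_ge0.
Qed.

Lemma C11_norm_eq0 u : C11_norm u = 0 -> u = 0.
Proof.
move=> u0; apply/val_inj; rewrite /= [LHS]surjective_pairing.
congr pair; apply/funext => x /=.
  apply/eqP; rewrite -normr_le0 -u0; exact: C11_norm_ge.
apply: enorm_eq0; apply/eqP; rewrite eq_le enorm_ge0 andbT -u0.
exact: C11_norm_grad_ge.
Qed.

HB.instance Definition _ := Lmodule_isNormed.Build R (C11 S)
  C11_normD C11_normZ C11_norm_eq0.

End norm.
End C11.

Section C11_uniq.
Variables (R : realType) (d : nat).
Local Notation E := 'rV[R]_d.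

Lemma enorm_le_norm (x : E) : enorm x <= d%:R * `|x|.
Proof.
have dx0 : 0 <= d%:R * `|x| by rewrite mulr_ge0.
rewrite -[leRHS]ger0_norm// -sqrtr_sqr; apply: ler_wsqrtr.
apply: (@le_trans _ _ (\sum_(i < d) `|x| ^+ 2)).
  apply: ler_sum => i _; rewrite -expr2 -[leLHS]real_normK ?num_real//.
  rewrite lerXn2r ?nnegrE//.
  rewrite [leRHS]/Num.norm/= mx_normrE.
  exact: (le_bigmax _ (fun ij : 'I_1 * 'I_d => `|x ij.1 ij.2|) (0, i)).
rewrite sumr_const card_ord exprMn -[leLHS]mulr_natl ler_wpM2r ?sqr_ge0//.
by rewrite expr2 -natrM ler_nat; case: (d) => // n; rewrite leq_pmull.
Qed.

Lemma grad_at_uniq (S : set E) (phi : E -> R) x g h :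
  nbhs x S -> grad_at S phi x g -> grad_at S phi x h -> g = h.
Proof.
move=> xS xg xh; apply/eqP; rewrite -subr_eq0; apply/eqP.
set w := g - h; apply: contrapT => w0.
have nw0 : 0 < enorm w.
  rewrite lt_neqAle enorm_ge0 andbT eq_sym; apply/eqP => e0; apply: w0.
  exact: enorm_eq0.
have e0 : 0 < enorm w / 3 by rewrite divr_gt0.
have : \forall y \near x, S y /\
    `|phi y - phi x - dotv g (y - x)| <= enorm w / 3 * enorm (y - x) /\
    `|phi y - phi x - dotv h (y - x)| <= enorm w / 3 * enorm (y - x).
  have := xg _ e0; have := xh _ e0; rewrite /within /=.
  move: xS; apply: filterS3 => y Sy + +.
  by move=> /(_ Sy) ? /(_ Sy).
have : (fun t : R => x + t *: w) t @[t --> 0^'+] --> x.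
  apply: cvg_at_right_filter.
  rewrite -[X in _ --> X]addr0 -(scale0r w).
  by apply: cvgD; [exact: cvg_cst|apply: cvgZr_tmp].
move=> /[apply] H.
near (0 : R)^'+ => t.
have t0 : 0 < t by [].
have [_ []] : (fun y => S y /\
    `|phi y - phi x - dotv g (y - x)| <= enorm w / 3 * enorm (y - x) /\
    `|phi y - phi x - dotv h (y - x)| <= enorm w / 3 * enorm (y - x))
    (x + t *: w) by near: t.
rewrite [x + _ - x]addrAC subrr add0r enormZ (gtr0_norm t0).
rewrite ![dotv _ (t *: w)]dotvC !dotvZl.
set a := phi _ - _ => h1 h2.
have : t * dotv w w <= (enorm w / 3 * (t * enorm w)) *+ 2.
  rewrite mulr2n (le_trans _ (lerD h2 h1))// (le_trans _ (ler_normB _ _))//.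
  rewrite (_ : _ - _ = t * dotv w w) ?ler_norm//.
  rewrite [dotv w w](_ : _ = dotv w g - dotv w h); first by ring.
  by rewrite {2}/w dotvC dotvDl -scaleN1r dotvZl ![dotv _ w]dotvC mulN1r.
rewrite (_ : dotv w w = enorm w ^+ 2); last by rewrite sqr_sqrtr// dotv_ge0.
have : 0 < t * enorm w ^+ 2 by rewrite mulr_gt0// exprn_gt0.
by rewrite mulr2n; nra.
Unshelve. all: by end_near. Qed.

Lemma C11_inj (Omega : set E) (u v : C11 (closure Omega)) :
  open Omega -> (u : E -> R) = v -> u = v.
Proof.
move=> oO uv; apply/val_inj => /=.
rewrite [LHS]surjective_pairing [RHS]surjective_pairing; congr pair => //.
rewrite -/(grad u) -/(grad v).
have [u0 ug _ _ [L uL]] := C11P u; have [v0 vg _ _ [M vM]] := C11P v.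
have in_ x : Omega x -> grad u x = grad v x.
  move=> Ox; apply: (@grad_at_uniq (closure Omega) u x).
  - by apply: filterS (open_nbhs_nbhs (conj oO Ox)); exact: subset_closure.
  - exact/ug/subset_closure.
  - by rewrite uv; apply/vg/subset_closure.
apply/funext => x; have [Sx|Sx] := pselect (closure Omega x); last first.
  by rewrite (u0 _ Sx).2 (v0 _ Sx).2.
have lipE (g : E -> E) K y : ubound [set lip_quot g q | q in closure Omega `*` closure Omega] K ->
    closure Omega y -> enorm (g x - g y) <= K * enorm (x - y).
  move=> gK Sy; have [xy|xy] := eqVneq (enorm (x - y)) 0.
    have /eqP : x - y = 0 by exact: enorm_eq0.
    by rewrite subr_eq0 => /eqP ->; rewrite !subrr !enorm0 mulr0.
  rewrite -ler_pdivrMr; last by rewrite lt_neqAle eq_sym xy enorm_ge0.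
  by apply: gK; exists (x, y).
apply/eqP; rewrite -subr_eq0; apply/eqP/enorm_eq0/eqP.
rewrite eq_le enorm_ge0 andbT; apply/ler_addgt0Pl => e e0; rewrite addr0.
have K0 : 0 < (`|L| + `|M| + 1) * (d%:R + 1).
  by rewrite mulr_gt0 ?ltr_wpDl ?addr_ge0.
have d0 : 0 < e / ((`|L| + `|M| + 1) * (d%:R + 1)) by rewrite divr_gt0.
have [y [Oy /=]] := Sx _ (nbhsx_ballx x _ d0).
rewrite -ball_normE/= => xy.
have Sy := subset_closure Oy.
rewrite (_ : _ - _ = (grad u x - grad u y) + (-1) *: (grad v x - grad v y)); last first.
  by rewrite (in_ _ Oy) scaleN1r opprB addrA subrK.
rewrite (le_trans (enormD _ _))// enormZ normrN1 mul1r.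
rewrite (le_trans (lerD (lipE _ _ _ uL Sy) (lipE _ _ _ vM Sy)))// -mulrDl.
apply: (@le_trans _ _ ((`|L| + `|M| + 1) * ((d%:R + 1) * `|x - y|))).
  apply: (@le_trans _ _ ((`|L| + `|M| + 1) * enorm (x - y))).
    rewrite ler_wpM2r ?enorm_ge0//.
    by have := ler_norm L; have := ler_norm M; lra.
  rewrite ler_wpM2l ?addr_ge0// (le_trans (enorm_le_norm _))// ler_wpM2r//.
  by rewrite lerDl.
by rewrite mulrA -ler_pdivlMl// mulrC ltW.
Qed.
End C11_uniq.

Section Dual.
Variables (R : realType) (V : normedModType R).

Definition is_dual : {pred V -> R^o} := fun l =>
  `[< linear l /\ continuous l >].

Record dual := MkDual { dual_fun :> V -> R^o ; dual_funP : dual_fun \in is_dual }.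

HB.instance Definition _ := [isSub for dual_fun].
HB.instance Definition _ := [Choice of dual by <:].

Lemma is_dual_submod : submod_closed is_dual.
Proof.
split.
  rewrite inE; split; last exact: cst_continuous.
  by move=> a x y; rewrite -[LHS]/(0 : R) -[RHS]/(a * 0 + 0 : R) mulr0 addr0.
move=> a l m; rewrite !inE => -[ll lc] [ml mc]; split.
  move=> b x y; rewrite -[LHS]/(a * l (b *: x + y) + m (b *: x + y)) ll ml.
  rewrite -[RHS]/(b * (a * l x + m x) + (a * l y + m y)) /GRing.scale/=; ring.
by move=> x; apply: cvgD; [apply: cvgZl_tmp; exact: lc|exact: mc].
Qed.

HB.instance Definition _ := GRing.isSubmodClosed.Build _ _ is_dual is_dual_submod.
HB.instance Definition _ := [SubChoice_isSubLmodule of dual by <:].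

Lemma dual_linear (l : dual) : linear l.
Proof. by have := dual_funP l; rewrite inE => -[]. Qed.

Lemma dual_continuous (l : dual) : continuous l.
Proof. by have := dual_funP l; rewrite inE => -[]. Qed.

HB.instance Definition _ (l : dual) :=
  GRing.isLinear.Build R V R^o *:%R l (@dual_linear l).

Definition dual_norm (l : dual) : R := supon [set x : V | `|x| <= 1] (fun x => `|l x|).

Lemma dual_ub (l : dual) : has_ubound [set `|l x| | x in [set x : V | `|x| <= 1]].
Proof.
have := continuous_linear_bounded 0 (@dual_continuous l 0).
move=> /linear_boundedP[y [yr h]].
exists (`|y| + 1) => _ [x /= x1 <-].
have yy : y < `|y| + 1 by rewrite (le_lt_trans (ler_norm y))// ltrDl.
by rewrite (le_trans (h _ yy x))// ler_piMr// addr_ge0.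
Qed.

Lemma dual_normP (l : dual) x : `|l x| <= dual_norm l * `|x|.
Proof.
have [->|x0] := eqVneq x 0; first by rewrite linear0 !normr0 mulr0.
have nx0 : 0 < `|x| by rewrite normr_gt0.
rewrite -ler_pdivrMr//.
have -> : `|l x| / `|x| = `|l (`|x|^-1 *: x)|.
  by rewrite linearZ normrZ normfV normr_id mulrC.
apply: (supon_ub (f := fun x => `|l x|) (@dual_ub l)).
by rewrite /= normrZ normfV normr_id mulVf// normr_eq0.
Qed.

Lemma dual_normD l m : dual_norm (l + m) <= dual_norm l + dual_norm m.
Proof.
by have [_] := @suponD _ _ [set x : V | `|x| <= 1] _ _ (fun x => `|(l + m : dual) x|)
  (fun x _ => ler_normD (l x) (m x)) (@dual_ub l) (@dual_ub m)
  (fun=> normr_ge0 _) (fun=> normr_ge0 _).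
Qed.

Lemma dual_normZ a l : dual_norm (a *: l) = `|a| * dual_norm l.
Proof.
by have [_] := @suponZ _ _ [set x : V | `|x| <= 1] _ (fun x => `|(a *: l : dual) x|) _
  (normr_ge0 a) (fun x _ => normrM a (l x)) (@dual_ub l) (fun=> normr_ge0 _).
Qed.

Lemma dual_norm_eq0 l : dual_norm l = 0 -> l = 0.
Proof.
move=> l0; apply/val_inj/funext => x /=; apply/eqP; rewrite -normr_le0.
by rewrite (le_trans (dual_normP l x))// l0 mul0r.
Qed.

HB.instance Definition _ := Lmodule_isNormed.Build R dual
  dual_normD dual_normZ dual_norm_eq0.

Definition weakstar : topologicalType :=
  initial_topology (fun l : dual => (l : V -> R^o) : {ptws V -> R^o}).

Definition weak : topologicalType :=
  initial_topology (fun x : V => (fun l : dual => l x) : {ptws dual -> R^o}).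

End Dual.

Record hilbert (R : realType) := Hilbert {
  hilbert_sort :> completeNormedModType R ;
  ip : hilbert_sort -> hilbert_sort -> R ;
  ipC : forall x y, ip x y = ip y x ;
  ipDl : forall x y z, ip (x + y) z = ip x z + ip y z ;
  ipZl : forall a x z, ip (a *: x) z = a * ip x z ;
  ipE : forall x, ip x x = `|x| ^+ 2 }.

Section Measures.
Variables (R : realType) (d : nat).
Local Notation E := 'rV[R]_d.

Definition borelRd := g_sigma_algebraType (@open E).

(* the Hahn decomposition is unique up to null sets, so the choice made here is
   immaterial *)
Definition charge_integral (nu : {charge set borelRd -> \bar R})
    (S : set E) (phi : E -> R) : R :=
  let hP := cid (Hahn_decomposition nu) in
  let nuPN := projT2 (cid (projT2 hP)) in
  \int[jordan_pos nuPN]_(x in S) phi x - \int[jordan_neg nuPN]_(x in S) phi x.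

(* A charge is a finite signed measure. *)
Record borel_measure (S : set E) := BorelMeasure {
  borel_charge :> {charge set borelRd -> \bar R} ;
  borel_concentrated : forall A : set borelRd,
    measurable A -> A `&` S = set0 -> borel_charge A = 0%E }.

Lemma measurable_closed (S : set E) : closed S -> measurable (S : set borelRd).
Proof.
move=> cS; rewrite -[S]setCK; apply: measurableC.
by apply: sub_sigma_algebra; exact: closed_openC.
Qed.

Lemma within_continuous_measurable (S : set E) (phi : E -> R) :
  closed S -> {within S, continuous phi} ->
  measurable_fun (S : set borelRd) phi.
Proof.
move=> cS /continuousP cf; apply: (measurability _ (RGenOpens.measurableE R)).
move=> _ [_ [a [b ->] <-]].
have /cf/open_subspaceP[V oV VS] : open (`]a, b[%classic : set R).
  exact: interval_open.
rewrite setIC -[X in measurable X]VS.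
by apply: measurableI; [exact: sub_sigma_algebra|exact: measurable_closed].
Qed.

Lemma grad_at_continuous (S : set E) (phi : E -> R) (g : E -> E) :
  (forall x, S x -> grad_at S phi x (g x)) -> {within S, continuous phi}.
Proof.
move=> h; apply/subspace_continuousP => x Sx; apply/cvgrPdist_le => e e0.
have hx := h x Sx 1 ltr01.
set K := (enorm (g x) + 1) * d%:R.
have K0 : 0 <= K by rewrite mulr_ge0 ?addr_ge0 ?enorm_ge0.
have e1 : 0 < e / (K + 1) by rewrite divr_gt0// ltr_wpDl.
have : \forall y \near within S (nbhs x), `|y - x| <= e / (K + 1).
  apply: cvg_within; near=> y; rewrite distrC; near: y.
  by move: (e / _) e1; exact/cvgrPdist_le/cvg_id.
move: hx; apply: filterS2 => y hy yx.
rewrite distrC -[phi y - phi x](subrK (dotv (g x) (y - x))).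
rewrite (le_trans (ler_normD _ _))//.
have CS : `|dotv (g x) (y - x)| <= enorm (g x) * enorm (y - x).
  rewrite -sqrtr_sqr -sqrtrM ?dotv_ge0//; apply: ler_wsqrtr.
  exact: (psd_CauchySchwarz (@dotvC _ _) (@dotvDl _ _) (@dotvZl _ _) (@dotv_ge0 _ _)).
rewrite (le_trans (lerD hy CS))// -mulrDl addrC.
apply: (@le_trans _ _ (K * `|y - x|)).
  by rewrite /K -mulrA ler_wpM2l ?addr_ge0 ?enorm_ge0// enorm_le_norm.
rewrite (le_trans (ler_wpM2l K0 yx))// mulrCA ger_pMr// ler_pdivrMr ?ltr_wpDl//.
by rewrite mul1r lerDl.
Unshelve. all: by end_near. Qed.

Section embedding.
Variables (S : set E) (cS : closed S) (nu : {charge set borelRd -> \bar R}).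

Lemma C11_integrable (mu : {finite_measure set borelRd -> \bar R}) (u : C11 S) :
  mu.-integrable S (EFin \o u).
Proof.
have [_ ug [M uM] _ _] := C11P u.
apply: measurable_bounded_integrable => //.
- exact: measurable_closed.
- by rewrite ltey_eq fin_num_measure//; exact: measurable_closed.
- by apply: within_continuous_measurable => //; exact: grad_at_continuous ug.
- exists M; split; first exact: num_real.
  by move=> K MK x Sx; apply: le_trans (ltW MK); apply: uM; exists x.
Qed.

Lemma C11_Rintegral_le (mu : {finite_measure set borelRd -> \bar R}) (u : C11 S) :
  `|\int[mu]_(x in S) u x| <= fine (mu S) * `|u|.
Proof.
have mS := measurable_closed cS.
rewrite (le_trans (le_normr_Rintegral mS (C11_integrable mu u)))// mulrC.
rewrite -Rintegral_cst//; apply: le_Rintegral => //.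
- exact/integrable_norm/C11_integrable.
- exact: finite_measure_integrable_cst.
- by move=> x _; exact: C11_norm_ge.
Qed.

Lemma charge_integral_is_dual :
  (fun u : C11 S => charge_integral nu S u) \in @is_dual R (C11 S).
Proof.
have mS := measurable_closed cS.
have ll : linear ((fun u : C11 S => charge_integral nu S u) : C11 S -> R^o).
  move=> a u v; rewrite /charge_integral.
  have H (mu : {finite_measure set borelRd -> \bar R}) :
      \int[mu]_(x in S) (a *: u + v : C11 S) x =
      a * \int[mu]_(x in S) u x + \int[mu]_(x in S) v x.
    rewrite -RintegralZl//; last exact: C11_integrable.
    rewrite -RintegralD//; last exact: C11_integrable.
    exact: (C11_integrable mu (a *: u)).
  by rewrite !H /GRing.scale/=; ring.
rewrite inE; split => //.
pose l : {linear C11 S -> R^o} := HB.pack (fun u : C11 S => charge_integral nu S u)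
  (GRing.isLinear.Build _ _ _ _ _ ll).
apply: (@bounded_linear_continuous _ _ _ l); apply/linear_boundedP.
rewrite /l/= /charge_integral.
set mu1 := jordan_pos _; set mu2 := jordan_neg _.
near=> r => u.
rewrite (le_trans (ler_normB _ _))//.
rewrite (le_trans (lerD (C11_Rintegral_le mu1 u) (C11_Rintegral_le mu2 u)))//.
by rewrite -mulrDl ler_wpM2r//; near: r; exact: nbhs_pinfty_ge.
Unshelve. all: by end_near. Qed.

End embedding.

Definition measure_dual (Omega : set E) (rho : borel_measure (closure Omega)) :
    dual (C11 (closure Omega)) :=
  MkDual (charge_integral_is_dual (@closed_closure _ Omega) rho).

End Measures.

Section L2.
Variable R : realType.
Local Notation mu := (@lebesgue_measure R).
Local Notation I01 := (`[0, 1]%classic : set R).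
Implicit Types f g h : R -> R.

Definition L2 f := measurable_fun I01 f /\
  mu.-integrable I01 (fun t => (f t ^+ 2)%:E).

Lemma L2M f g : L2 f -> L2 g -> mu.-integrable I01 (fun t => (f t * g t)%:E).
Proof.
move=> [mf sf] [mg sg].
apply: (@le_integrable _ _ _ mu _ _ _ (fun t => (f t ^+ 2 + g t ^+ 2)%:E)).
- exact: measurable_itv.
- exact/measurable_EFinP/measurable_funM.
- move=> t _; rewrite !abse_EFin lee_fin [leRHS]ger0_norm ?addr_ge0 ?sqr_ge0//.
  by rewrite ler_norml; apply/andP; split; nra.
- by apply: (integrableD _ sf sg); exact: measurable_itv.
Qed.

Lemma L2_linear a f g : L2 f -> L2 g -> L2 (fun t => a * f t + g t).
Proof.
move=> lf lg; split.
  by apply: measurable_funD; [apply: measurable_funM => //; exact: lf.1|exact: lg.1].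
have mI : measurable I01 by exact: measurable_itv.
rewrite [X in mu.-integrable _ X](_ : _ = (fun t => (a ^+ 2)%:E * (f t * f t)%:E +
    ((2 * a)%:E * (f t * g t)%:E + (g t * g t)%:E))%E).
  apply: integrableD => //; first by apply: integrableZl => //; exact: L2M.
  apply: integrableD => //; last exact: L2M.
  by apply: integrableZl => //; exact: L2M.
by apply/funext => t; rewrite -!EFinM -!EFinD; congr EFin; ring.
Qed.

Lemma L2_within_continuous f : {within `[0, 1], continuous f} -> L2 f.
Proof.
move=> cf; have mf : measurable_fun I01 f.
  by apply: subspace_continuous_measurable_fun => //; exact: measurable_itv.
split => //; apply: (@continuous_compact_integrable _ (fun t => f t ^+ 2)).
  exact: segment_compact.
by move=> t; apply: (cvgM (cf t) (cf t)).
Qed.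

Lemma L2_integrable f : L2 f -> mu.-integrable I01 (EFin \o f).
Proof.
move=> lf.
have l1 : L2 (fun=> 1) by apply: L2_within_continuous => x; exact: cst_continuous.
apply: eq_integrable (L2M lf l1); first exact: measurable_itv.
by move=> t _ /=; rewrite mulr1.
Qed.

Lemma L2_uniq f : L2 f -> (forall t, t \in `[0, 1] -> \int[mu]_(s in `[0, t]) f s = 0) ->
  {ae mu, forall t, `[0, 1]%classic t -> f t = 0}.
Proof.
move=> lf f0; have intf := L2_integrable lf.
have mI : measurable I01 by exact: measurable_itv.
have locf := integrable_locally mI intf.
have intF y : mu.-integrable [set` Interval (BLeft 0) (BRight y)]
    (EFin \o (f \_ `[0, 1])).
  have : mu.-integrable setT (EFin \o (f \_ `[0, 1])).
    rewrite (_ : _ \o _ = (EFin \o f) \_ `[0, 1]); last by rewrite restrict_EFin.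
    by have := (@integrable_mkcond _ _ _ mu _ (EFin \o f) mI).1 intf.
  by apply: integrableS => //; exact: measurable_itv.
have := FTC1 intF locf.
have n0 : mu.-negligible [set (0 : R); 1].
  apply/negligibleP; first by apply: measurableU; exact: measurable_set1.
  by apply: countable_lebesgue_measure0; exact/finite_set_countable/finite_set2.
have : {ae mu, forall t : R, t \notin [set 0; 1] }.
  apply: negligibleS n0 => t /= /negP; rewrite negbK inE//.
apply: (@filterS2 _ _ (ae_filter_ringOfSetsType mu)) => t t01 ft /=; rewrite in_itv/= => /andP[t0 t1].
have {}t0 : 0 < t.
  rewrite lt_neqAle t0 andbT eq_sym; apply/eqP => t00; move/negP: t01; apply.
  by rewrite inE; left.
have {}t1 : t < 1.
  rewrite lt_neqAle t1 andbT; apply/eqP => t00; move/negP: t01; apply.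
  by rewrite inE; right.
have [] := ft; first by rewrite lte_fin.
move=> _; rewrite patchE ifT; last by rewrite inE/= in_itv/= !ltW.
move=> <-; rewrite derive1E -[RHS](@derive_cst R R^o R^o (0 : R) (1 : R) (t : R)).
apply: near_eq_derive.
near=> s.
have s0 : 0 < s by near: s; exact: lt_nbhsr.
have s1 : s < 1 by near: s; exact: lt_nbhsl.
rewrite -[RHS](f0 s); last by rewrite in_itv/= !ltW.
apply: eq_Rintegral => r; rewrite inE/= in_itv/= => /andP[r0 rs].
by rewrite patchE ifT// inE/= in_itv/= r0 (le_trans rs)// ltW.
Unshelve. all: by end_near. Qed.

End L2.

Section H1.
Variables (R : realType) (d : nat).
Local Notation E := 'rV[R]_d.
Local Notation mu := (@lebesgue_measure R).
Local Notation I01 := (`[0, 1]%classic : set R).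

Definition is_velocity (gamma g : R -> E) : Prop := forall i,
  L2 (fun t => g t 0 i) /\
  forall t, t \in `[0, 1] ->
    gamma t 0 i = gamma 0 0 i + \int[mu]_(s in `[0, t]) g s 0 i.

(* H^1([0,1]; R^d) in its absolutely continuous representatives; curves are set
   to 0 off [0,1] so that Leibniz equality is equality on [0,1]. *)
Definition is_H1 : {pred R -> E} := fun gamma =>
  `[< (forall t, t \notin `[0, 1] -> gamma t = 0) /\
      exists g, is_velocity gamma g >].

Record H1 := MkH1 { H1_fun :> R -> E ; H1_funP : H1_fun \in is_H1 }.

(* the weak derivative, unique a.e. on [0,1] by is_velocity_uniq *)
Definition velocity (gamma : R -> E) : R -> E :=
  xget (fun=> 0) [set g | is_velocity gamma g].

Definition L2ip (f g : R -> E) : R := \int[mu]_(t in I01) dotv (f t) (g t).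

Definition H1ip (u v : H1) : R := L2ip u v + L2ip (velocity u) (velocity v).

HB.instance Definition _ := [isSub for H1_fun].
HB.instance Definition _ := [Choice of H1 by <:].

Let mI : measurable (I01 : set (measurableTypeR R)).
Proof. exact: measurable_itv. Qed.

Let L2_integrable_sub (f : R -> R) t : L2 f -> t \in `[0, 1] ->
  mu.-integrable `[0, t] (EFin \o f).
Proof.
move=> lf; rewrite in_itv/= => /andP[t0 t1].
apply: integrableS (L2_integrable lf) => //.
by move=> x /=; rewrite !in_itv/= => /andP[-> xt]; rewrite (le_trans xt).
Qed.

Lemma is_velocityD a u v gu gv : is_velocity u gu -> is_velocity v gv ->
  is_velocity (a *: u + v) (a *: gu + gv).
Proof.
move=> hu hv i; have [lu iu] := hu i; have [lv iv] := hv i.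
have E1 (f g : R -> E) t : (a *: f + g) t 0 i = a * f t 0 i + g t 0 i.
  by rewrite -[(a *: f + g) t]/(a *: f t + g t) !mxE.
split.
  rewrite [X in L2 X](_ : _ = fun t => a * gu t 0 i + gv t 0 i).
    exact: L2_linear.
  by apply/funext => t; rewrite E1.
move=> t t01; rewrite !E1 iu// iv//.
rewrite [in RHS](@eq_Rintegral _ _ _ mu _ (fun s => a * gu s 0 i + gv s 0 i)); last first.
  by move=> s _; rewrite E1.
rewrite [in RHS]RintegralD//=; last 2 first.
- rewrite (_ : _ \o _ = (fun x => a%:E * (gu x 0 i)%:E)%E)//.
  apply: integrableZl; first exact: measurable_itv.
  exact: L2_integrable_sub.
- exact: L2_integrable_sub.
rewrite [in RHS]RintegralZl//; [ring|exact: L2_integrable_sub].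
Qed.

Lemma is_velocity_uniq u g h : is_velocity u g -> is_velocity u h ->
  forall i, {ae mu, forall t, I01 t -> g t 0 i = h t 0 i}.
Proof.
move=> ug uh i; have [lg ig] := ug i; have [lh ih] := uh i.
have L : L2 (fun t => -1 * h t 0 i + g t 0 i) by exact: L2_linear.
have : forall t, t \in `[0, 1] ->
    \int[mu]_(s in `[0, t]) (-1 * h s 0 i + g s 0 i) = 0.
  move=> t t01; rewrite RintegralD//=; last 2 first.
  - rewrite (_ : _ \o _ = (fun x => (-1)%:E * (h x 0 i)%:E)%E)//.
    apply: integrableZl; first exact: measurable_itv.
    exact: L2_integrable_sub.
  - exact: L2_integrable_sub.
  rewrite RintegralZl//; [|exact: L2_integrable_sub].
  by have := ig t t01; rewrite (ih t t01) => /addrI ->; rewrite mulN1r addNr.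
move/(L2_uniq L).
apply: (@filterS _ _ (ae_filter_ringOfSetsType mu)) => t + It => /(_ It).
by rewrite mulN1r addrC => /eqP; rewrite subr_eq0 => /eqP.
Qed.

Lemma is_H1_submod : submod_closed is_H1.
Proof.
split.
  rewrite inE; split => //; exists 0 => i.
  have E0 t : (0 : R -> E) t 0 i = 0 by rewrite -[(0 : R -> E) t]/(0 : E) mxE.
  split.
    rewrite [X in L2 X](_ : _ = fun=> 0).
      by apply: L2_within_continuous => x; exact: cst_continuous.
    by apply/funext => t; rewrite E0.
  move=> t t01; rewrite !E0; rewrite (@eq_Rintegral _ _ _ mu _ (fun=> 0)); last by move=> s _; rewrite ?E0.
  by rewrite /Rintegral integral0 addr0.
move=> a u v; rewrite !inE => -[u0 [gu hu]] [v0 [gv hv]]; split.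
  move=> t t01.
  by rewrite -[LHS]/(a *: u t + v t) u0// v0// scaler0 addr0.
by exists (a *: gu + gv); exact: is_velocityD.
Qed.

HB.instance Definition _ := GRing.isSubmodClosed.Build _ _ is_H1 is_H1_submod.
HB.instance Definition _ := [SubChoice_isSubLmodule of H1 by <:].

Lemma velocityP (u : H1) : is_velocity u (velocity u).
Proof.
have := H1_funP u; rewrite inE => -[_ [g ug]].
exact: (xgetPex (fun=> 0) (ex_intro _ g ug)).
Qed.

Lemma H1_out (u : H1) t : t \notin `[0, 1] -> u t = 0.
Proof. by have := H1_funP u; rewrite inE => -[+ _]; apply. Qed.

Lemma H1_continuous (u : H1) i : {within I01, continuous (fun t => u t 0 i)}.
Proof.
have [lg ig] := velocityP u i.
have ci := @parameterized_integral_continuous R 0 1 _ ler01 (L2_integrable lg).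
have : {within I01, continuous
    (fun t => u 0 0 i + parameterized_integral mu 0 t (fun s => velocity u s 0 i))}.
  by move=> t; apply: (cvgD (@cvg_cst _ _ _ _ _) (ci t)).
apply: subspace_eq_continuous => t; rewrite inE => t01; apply/esym.
exact: ig.
Qed.

Let vL2 (f : R -> E) := forall i, L2 (fun t => f t 0 i).

Lemma H1_vL2 (u : H1) : vL2 u.
Proof. by move=> i; exact/L2_within_continuous/H1_continuous. Qed.

Lemma velocity_vL2 (u : H1) : vL2 (velocity u).
Proof. by move=> i; exact: (velocityP u i).1. Qed.

Lemma L2ip_integrable f g : vL2 f -> vL2 g ->
  mu.-integrable I01 (fun t => (dotv (f t) (g t))%:E).
Proof.
move=> lf lg; rewrite [X in mu.-integrable _ X](_ : _ =
    (fun t => \sum_(i < d) (f t 0 i * g t 0 i)%:E)%E).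
  by apply: integrable_sum => // i _; exact: L2M.
by apply/funext => t; rewrite sumEFin.
Qed.

Lemma L2ipC f g : L2ip f g = L2ip g f.
Proof. by apply: eq_Rintegral => t _; rewrite dotvC. Qed.

Lemma L2ip_linear a f g h : vL2 f -> vL2 g -> vL2 h ->
  L2ip (a *: f + g) h = a * L2ip f h + L2ip g h.
Proof.
move=> lf lg lh; rewrite /L2ip.
rewrite -RintegralZl//; last exact: L2ip_integrable.
rewrite -RintegralD//; last 2 first.
- rewrite (_ : _ \o _ = (fun x => a%:E * (dotv (f x) (h x))%:E)%E)//.
  by apply: integrableZl => //; exact: L2ip_integrable.
- exact: L2ip_integrable.
apply: eq_Rintegral => t _.
by rewrite -[(a *: f + g) t]/(a *: f t + g t) dotvDl dotvZl.
Qed.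

Let ae_forall_ord (P : R -> 'I_d -> Prop) :
  (forall i, {ae mu, forall t, P t i}) -> {ae mu, forall t, forall i, P t i}.
Proof.
move=> h; have : {ae mu, forall t, forall n : nat, forall i : 'I_d, i = n :> nat -> P t i}.
  apply: ae_foralln => n.
  case: (ltnP n d) => [nd|dn].
    apply: (@filterS _ _ (ae_filter_ringOfSetsType mu) _ _ _ (h (Ordinal nd))).
    by move=> t Pt i ni; rewrite (_ : i = Ordinal nd)//; exact/val_inj.
  by apply: aeW => t i ni; move: dn; rewrite -ni leqNgt ltn_ord.
by apply: (@filterS _ _ (ae_filter_ringOfSetsType mu)) => t Pt i; exact: Pt.
Qed.

Lemma L2ip_ae f g h : vL2 f -> vL2 g -> vL2 h ->
  (forall i, {ae mu, forall t, I01 t -> f t 0 i = g t 0 i}) ->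
  L2ip f h = L2ip g h.
Proof.
move=> lf lg lh fg; congr fine; apply: ae_eq_integral => //.
- by have /integrableP[] := L2ip_integrable lf lh.
- by have /integrableP[] := L2ip_integrable lg lh.
have : {ae mu, forall t, forall i, I01 t -> f t 0 i = g t 0 i}.
  exact/ae_forall_ord.
apply: (@filterS _ _ (ae_filter_ringOfSetsType mu)) => t fgt It.
by congr EFin; apply: eq_bigr => i _; rewrite fgt.
Qed.

Lemma H1ipC u v : H1ip u v = H1ip v u.
Proof. by rewrite /H1ip L2ipC [in X in _ + X]L2ipC. Qed.

Lemma H1ip_linear a u v w : H1ip (a *: u + v) w = a * H1ip u w + H1ip v w.
Proof.
rewrite /H1ip L2ip_linear; [|exact: H1_vL2..].
rewrite (@L2ip_ae (velocity (a *: u + v : H1)) (a *: velocity u + velocity v)).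
- rewrite L2ip_linear; [ring|exact: velocity_vL2..].
- exact: velocity_vL2.
- by move=> i; have [] := is_velocityD a (velocityP u) (velocityP v) i.
- exact: velocity_vL2.
apply: is_velocity_uniq (velocityP _) _.
exact: is_velocityD (velocityP u) (velocityP v).
Qed.

Lemma H1ipDl u v w : H1ip (u + v) w = H1ip u w + H1ip v w.
Proof. by rewrite -[u]scale1r H1ip_linear mul1r scale1r. Qed.

Lemma H1ipZl a u w : H1ip (a *: u) w = a * H1ip u w.
Proof.
have H0 : H1ip 0 w = 0.
  by apply: (addrI (H1ip 0 w)); rewrite -H1ipDl !addr0.
by rewrite -[a *: u]addr0 H1ip_linear H0 addr0.
Qed.

Lemma L2ip_ge0 f : 0 <= L2ip f f.
Proof. by apply: Rintegral_ge0 => t _; exact: dotv_ge0. Qed.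

Lemma H1ip_ge0 u : 0 <= H1ip u u.
Proof. by rewrite addr_ge0 ?L2ip_ge0. Qed.

Definition H1_norm (u : H1) : R := Num.sqrt (H1ip u u).

Lemma H1_normD u v : H1_norm (u + v) <= H1_norm u + H1_norm v.
Proof. exact: (psd_normD H1ipC H1ipDl H1ipZl H1ip_ge0). Qed.

Lemma H1_normZ a u : H1_norm (a *: u) = `|a| * H1_norm u.
Proof. exact: (psd_normZ H1ipC H1ipZl). Qed.

Lemma H1_norm_eq0 u : H1_norm u = 0 -> u = 0.
Proof.
move=> /eqP; rewrite sqrtr_eq0 => u0.
have := L2ip_ge0 u; have := L2ip_ge0 (velocity u); move: u0; rewrite /H1ip.
move=> + h1 h2; rewrite le_eqVlt ltNge addr_ge0// orbF paddr_eq0// => /andP[/eqP u0 /eqP v0].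
have v0ae i : {ae mu, forall t, I01 t -> velocity u t 0 i = 0}.
  have L := velocity_vL2 u i.
  have mL : measurable_fun I01 (EFin \o (fun t => velocity u t 0 i ^+ 2)).
    by have /integrableP[] := L.2.
  have iv := L2ip_integrable (velocity_vL2 u) (velocity_vL2 u).
  have : (\int[mu]_(t in I01) `|(EFin \o (fun t => velocity u t 0%R i ^+ 2)%R) t| = 0)%E.
    apply/eqP; rewrite eq_le; apply/andP; split; last exact: integral_ge0.
    have -> : 0%E = (\int[mu]_(t in I01) (dotv (velocity u t) (velocity u t))%:E)%E.
      have /fineK <- := integrable_fin_num mI iv.
      by rewrite -[fine _]/(L2ip (velocity u) (velocity u)) v0.
    apply: ge0_le_integral => //.
    - exact: measurableT_comp.
    - by have /integrableP[] := iv.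
    - move=> t _; rewrite /= lee_fin ger0_norm ?sqr_ge0// /dotv (bigD1 i)//= -expr2.
      by rewrite lerDl; apply: sumr_ge0 => j _; rewrite -expr2 sqr_ge0.
  move/(ae_eq_integral_abs mu mI mL).1.
  apply: (@filterS _ _ (ae_filter_ringOfSetsType mu)) => t + It => /(_ It) [] /eqP.
  by rewrite sqrf_eq0 => /eqP.
have uc i t : t \in `[0, 1] -> u t 0 i = u 0 0 i.
  move=> t01; have [L ->//] := velocityP u i.
  have iL := L2_integrable_sub L t01.
  have -> : \int[mu]_(s in `[0, t]) velocity u s 0 i = \int[mu]_(s in `[0, t]) 0.
    congr fine; apply: ae_eq_integral => //.
      by have /integrableP[] := iL.
    apply: (@filterS _ _ (ae_filter_ringOfSetsType mu) _ _ _ (v0ae i)) => s /= vs st.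
    rewrite vs//; move: st t01; rewrite !in_itv/= => /andP[-> st] /andP[_].
    exact: le_trans.
  by rewrite /Rintegral integral0 addr0.
have ut t : t \in `[0, 1] -> u t = u 0 by move=> t01; apply/rowP => i; exact: uc.
have u00 : u 0 = 0.
  apply: enorm_eq0; rewrite /enorm (_ : dotv _ _ = 0) ?sqrtr0//.
  apply: etrans u0; rewrite /L2ip (@eq_Rintegral _ _ _ mu _ (fun=> dotv (u 0) (u 0))); last first.
    by move=> t; rewrite inE => t01; rewrite ut.
  have m1 : mu I01 = 1%:E.
    by rewrite lebesgue_measure_itv/= lte_fin ltr01 oppr0 adde0.
  have := @Rintegral_cst _ _ _ mu I01 mI (dotv (u 0) (u 0)).
  by move=> /esym; rewrite [X in fine X]m1/= mulr1.
apply/val_inj/funext => t /=; rewrite -[RHS]/(0 : E).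
have [t01|t01] := boolP (t \in `[0, 1]); last exact: H1_out.
by rewrite ut.
Qed.

HB.instance Definition _ := Lmodule_isNormed.Build R H1
  H1_normD H1_normZ H1_norm_eq0.

End H1.

Section Hypotheses.
Variables (R : realType).

(* R with the Lebesgue sigma-algebra (lebesgue_measure lives on the Borel one):
   the fields below, and t |-> wfun t (gamma t), are only Lebesgue measurable. *)
Definition lebesgueR := caratheodory_type (wlength (@idfun R))^*%mu.

Local Notation leb := (@completed_lebesgue_measure R).

Variables (H : R -> hilbert R) (D : completeNormedModType R).
Variable i : forall t, D -> H t.
Implicit Types f s : forall t, H t.

Definition step_function s : Prop :=
  exists (n : nat) (A : 'I_n -> set R) (phi : 'I_n -> D),
    (forall j, measurable (A j : set lebesgueR)) /\
    forall t, s t = \sum_(j < n) \1_(A j) t *: i t (phi j).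

Definition strongly_measurable f : Prop :=
  exists s : nat -> forall t, H t, (forall k, step_function (s k)) /\
    {ae leb, forall t, t \in `]0, 1[ -> `|f t - s k t| @[k --> \oo] --> 0}.

Definition L2_H f : Prop := strongly_measurable f /\
  (\int[leb]_(t in `[0%R, 1%R]) (`|f t| ^+ 2)%:E < +oo)%E.

(* The fields H, i, Kstar, K are total in t, but nothing is assumed about them
   on a null set or outside (0,1). *)
Definition hypothesis_H : Prop := [/\
  {ae leb, forall t, t \in `]0, 1[ -> linear (i t) /\ continuous (i t)},
  exists C : R, {ae leb, forall t, t \in `]0, 1[ ->
    forall phi, `|i t phi| <= C * `|phi|},
  {ae leb, forall t, t \in `]0, 1[ -> dense (range (i t))} &
  forall phi psi,
    measurable_fun (`]0, 1[%classic : set lebesgueR)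
      (fun t => ip (i t phi) (i t psi))].

Variables (d : nat) (Omega : set 'rV[R]_d).
Local Notation S := (closure Omega).

Definition narrowly_continuous (rho : R -> borel_measure S) : Prop :=
  forall phi : 'rV[R]_d -> R, {within S, continuous phi} ->
    {within `[0, 1], continuous (fun t => charge_integral (rho t) S phi)}.

(* elements of C11 S vanish off S, so the closure may be taken in R^d *)
Definition supp (V : nmodType) (u : 'rV[R]_d -> V) : set 'rV[R]_d :=
  closure [set x | u x != 0].

Variable Kstar : forall t, dual (C11 S) -> H t.
Variable K : forall t, H t -> C11 S.

Definition hypothesis_F (E : set 'rV[R]_d) : Prop :=
  {ae leb, forall t, t \in `]0, 1[ ->
    linear (@Kstar t) /\ continuous (@Kstar t)} /\
  [/\ {ae leb, forall t, t \in `]0, 1[ ->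
        continuous (@Kstar t : weakstar (C11 S) -> weak (H t)) /\
        forall l h, ip (Kstar t l) h = l (K h)},
      exists C : R, {ae leb, forall t, t \in `]0, 1[ ->
        forall l, `|Kstar t l| <= C * `|l|},
      forall rho : borel_measure S,
        strongly_measurable (fun t => Kstar t (measure_dual rho)) &
      [/\ closed E, convex_set E, compact (closure E) /\ closure E `<=` Omega &
        {ae leb, forall t, t \in `]0, 1[ -> forall h : H t,
          supp (K h) `<=` E /\ supp (grad (K h)) `<=` E}]].

Definition wfun (rho : R -> borel_measure S) f (t : R) (x : 'rV[R]_d) : R :=
  if x \in S then (- K (Kstar t (measure_dual (rho t)) - f t)) x else 0.

Definition curve_functional (alpha beta : R) (rho : R -> borel_measure S) f
    (gamma : H1 R d) : R :=
  (- \int[leb]_(t in `[0, 1]) wfun rho f t (gamma t)) /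
  (beta / 2 * (\int[lebesgue_measure]_(t in `[0, 1])
                 enorm (velocity gamma t) ^+ 2) + alpha).

End Hypotheses.

Section Descent.
Variables (R : realType) (d : nat).
Local Notation H1 := (H1 R d).
Variable F : H1 -> R.
Implicit Types (gamma D : nat -> H1) (delta : nat -> R).

Definition riesz_representative (gamma g : H1) : Prop :=
  forall h, 'd F gamma h = H1ip g h.

Definition backtracking_armijo gamma D delta : Prop :=
  exists delta0 tau sigma : R,
    [/\ 0 < delta0, 0 < tau < 1, 0 < sigma < 1 & forall n,
      let admissible := [set r | (exists k : nat, r = delta0 * tau ^+ k) /\
        F (gamma n - r *: D n) <= F (gamma n) - sigma * r * `|D n| ^+ 2] in
      admissible (delta n) /\ forall r, admissible r -> r <= delta n].

Definition armijo_goldstein gamma D delta : Prop :=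
  exists sigma : R, 0 < sigma < 1 / 2 /\ forall n,
    [/\ 0 < delta n,
        F (gamma n) - (1 - sigma) * delta n * `|D n| ^+ 2 <=
          F (gamma n - delta n *: D n) &
        F (gamma n - delta n *: D n) <=
          F (gamma n) - sigma * delta n * `|D n| ^+ 2].

Definition descent_sequence gamma : Prop :=
  exists D delta, [/\ F (gamma 0%N) < 0,
    forall n, riesz_representative (gamma n) (D n),
    forall n, gamma n.+1 = gamma n - delta n *: D n &
    armijo_goldstein gamma D delta \/ backtracking_armijo gamma D delta].

Definition accumulation_point gamma (g : H1) : Prop :=
  exists phi : nat -> nat, {homo phi : m n / (m < n)%N} /\
    gamma (phi n) @[n --> \oo] --> g.

End Descent.

(* Main.v *)
Require Import Defs.
From HB Require Import structures.
From mathcomp Require Import all_boot all_order all_algebra.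
From mathcomp Require Import all_classical all_reals all_analysis.
From mathcomp Require Import measurable_realfun lra ring.

Set Implicit Arguments.
Unset Strict Implicit.
Unset Printing Implicit Defensive.

Import Order.TTheory GRing.Theory Num.Theory.
Import numFieldNormedType.Exports.

Local Open Scope classical_set_scope.
Local Open Scope ring_scope.

(* Off a null set of times, [w t] is a C^{1,1} function supported in the
   compact set E whose C^{1,1} norm is dominated by an integrable m(t): Kstar and
   K are uniformly bounded, and the measures rho_t are bounded in the dual of
   C^{1,1} by Banach-Steinhaus.  Measurability of t |-> w t x comes from testing
   against K_t^* of the Dirac mass at x.  Hence the numerator W of F satisfies a
   second-order Taylor bound in the sup norm of the variation, uniform in the
   base curve, and so does F in H^1; this makes F C^1 with a bounded, Lipschitz
   derivative, so both stepsize rules force the gradients D_n to 0.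

   On {F <= -c} with c > 0 the velocities are bounded in L^2 and every curve
   meets E, so a subsequence converges uniformly.  Solving the formula for the
   gradient for the Dirichlet form <gamma_n', h'> shows that the subsequence is
   Cauchy in H^1.

   Confinement: if F g < 0, the curve g meets E, and stationarity says that
   <g', h'> = 0 for every h vanishing where g is in E.  If g left E, its
   component in a separating direction would have a maximum above its values on
   E; testing with tents shows that it is constant, so g would never meet E. *)

(** The kinetic denominator of [F] grows quadratically in the velocity while its derivative grows
    linearly. So the derivative of the quotient is bounded on all of H^1, and a step below a fixed
    threshold is covered by the Taylor bound wherever the iterate lies.

    The data are C^{1,1} only on the closure of Omega, which need not be convex, whereas curves and
    Taylor segments may leave it. Since E keeps a positive distance from the complement of Omega,
    the extension by zero is C^{1,1} on R^d and the estimates can ignore the domain.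

    Hypothesis (F3) treats one fixed measure, but both the measure rho_t and the point gamma(t) move
    with t. *)

(** * Bounded functionals, and differentiability from a uniform Taylor bound *)

Section BoundedFunctional.
Variables (R : realType) (V : normedModType R).

Lemma dualZ (l : dual V) a x : l (a *: x) = a * l x :> R.
Proof. exact: linearZ. Qed.

Lemma dual_norm_le (l : dual V) (M : R) : 0 <= M ->
  (forall x, `|x| <= 1 -> `|l x| <= M) -> `|l| <= M.
Proof. by move=> M0 h; apply: supon_le. Qed.

(** Builds both the Frechet derivative of the quotient and the test functionals on C^{1,1} that
    bound the pre-adjoint. *)
Lemma dual_of_bounded (l : V -> R^o) (M : R) : 0 <= M -> linear l ->
  (forall x, `|l x| <= M * `|x|) ->
  exists m : dual V, (m : V -> R^o) = l /\ `|m| <= M.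
Proof.
move=> M0 ll lM.
pose l' : {linear V -> R^o} := HB.pack l (GRing.isLinear.Build _ _ _ _ _ ll).
have cl : continuous l.
  apply: (@bounded_linear_continuous _ _ _ l'); apply/linear_boundedP.
  exists M; split => [|r Mr x]; first exact: num_real.
  by rewrite (le_trans (lM x))// ler_wpM2r// ltW.
have ld : l \in @is_dual R V by rewrite inE.
exists (MkDual ld); split => //; apply: dual_norm_le => // x x1.
by rewrite (le_trans (lM x))// ler_piMr.
Qed.

End BoundedFunctional.

(* A second-order Taylor bound that is uniform in the base point makes the
   derivative Lipschitz: compare the expansions of [F (x + e + h)] at [x] and at
   [x + e], for increments [h] of the size of [e]. *)
Section UniformTaylor.
Variables (R : realType) (V : normedModType R).
Variables (F : V -> R^o) (DF : V -> dual V) (L : R).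
Hypothesis L0 : 0 <= L.
Hypothesis taylor : forall x h, `|h| <= 1 ->
  `|F (x + h) - F x - DF x h| <= L * `|h| ^+ 2.

Lemma uniform_taylor_is_diff x : is_diff x F (DF x).
Proof.
have FE : F \o shift x = cst (F x) + DF x +o_ 0 id.
  apply/eqaddoP => e e0; near=> h.
  rewrite -[X in `|X|]/(F (h + x) - (F x + DF x h)) opprD addrA.
  have h1 : `|h| <= 1.
    near: h; apply/nbhs_norm0P; exists 1 => //= y /=; rewrite ?sub0r ?normrN.
    exact: ltW.
  have he : (L + 1) * `|h| <= e.
    rewrite -ler_pdivlMl ?ltr_wpDl// mulrC.
    near: h; apply/nbhs_norm0P; exists (e / (L + 1)).
      by rewrite /= divr_gt0// ltr_wpDl.
    by move=> y /= ?; exact: ltW.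
  rewrite addrC -[h + x]addrC addrC.
  rewrite (le_trans (taylor x h1))// expr2 mulrA ler_wpM2r//.
  by rewrite (le_trans _ he)// ler_wpM2r// lerDl.
have dE : 'd F x = DF x :> (V -> R^o).
  by apply: diff_unique FE; exact: dual_continuous.
split; last exact: dE.
apply/diff_locallyP; rewrite dE; split => //.
exact: dual_continuous.
Unshelve. all: by end_near. Qed.

Lemma uniform_taylor_lipschitz x y : `|y - x| <= 2^-1 ->
  `|DF y - DF x| <= 6 * L * `|y - x|.
Proof.
move=> yx; have [->|yNx] := eqVneq y x.
  by rewrite !subrr !normr0 mulr0.
set e := y - x in yx *.
have ep : 0 < `|e| by rewrite normr_gt0 subr_eq0.
apply: dual_norm_le => [|k k1]; first by rewrite !mulr_ge0.
set h := `|e| *: k.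
have he : `|h| <= `|e| by rewrite normrZ normr_id ler_piMr.
have h1 : `|h| <= 1 by rewrite (le_trans he)// (le_trans yx)// invf_le1 ?ler1n.
have e1 : `|e| <= 1 by rewrite (le_trans yx)// invf_le1 ?ler1n.
(* The radius 1/2 in the hypothesis keeps [e + h] in the unit ball, where the Taylor bound is
   available. *)
have eh : `|e + h| <= 2 * `|e|.
  by rewrite (le_trans (ler_normD _ _))// mulrDl mul1r lerD.
have eh1 : `|e + h| <= 1.
  by rewrite (le_trans eh)// -ler_pdivlMl// mulr1.
have := taylor y h1; have := taylor x e1; have := taylor x eh1.
rewrite addrA [x + e]addrC subrK.
rewrite -[(DF y - DF x) k]/(DF y k - DF x k) linearD/=.
have -> : `|DF y k - DF x k| = `|DF y h - DF x h| / `|e|.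
  have -> : DF y h - DF x h = `|e| * (DF y k - DF x k).
    by rewrite /h !dualZ; ring.
  by rewrite normrM normr_id mulrAC mulfV ?mul1r// gt_eqF.
rewrite ler_pdivrMr// => H1 H2 H3.
(* The constant is 6 = 4 + 1 + 1, for the increments [e + h] and [e] at [x] and [h] at [y]. *)
have hh : `|h| ^+ 2 <= `|e| ^+ 2 by rewrite lerXn2r ?nnegrE.
have ehh : `|e + h| ^+ 2 <= 4 * `|e| ^+ 2.
  rewrite (_ : 4 * _ = (2 * `|e|) ^+ 2); last by ring.
  by rewrite lerXn2r ?nnegrE// mulr_ge0.
have LH1 := le_trans H1 (ler_wpM2l L0 ehh).
have LH3 := le_trans H3 (ler_wpM2l L0 hh).
move: LH1 H2 LH3; rewrite (_ : 6 * L * `|e| * `|e| = 6 * L * `|e| ^+ 2); last by ring.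
move: (F _) (F x) (F y) (DF x e) (DF x h) (DF y h) (`|e| ^+ 2) => a b c p q r s.
rewrite !ler_norml => /andP[? ?] /andP[? ?] /andP[? ?]; apply/andP; split; nra.
Qed.

Lemma uniform_taylor_continuous : continuous DF.
Proof.
move=> x; apply/cvgrPdist_le => e e0.
have nx : forall r : R, 0 < r -> \forall y \near x, `|x - y| <= r.
  exact/cvgrPdist_le/cvg_id.
near=> y.
have yx : `|y - x| <= 2^-1.
  by rewrite distrC; near: y; apply: nx; rewrite invr_gt0.
rewrite distrC (le_trans (uniform_taylor_lipschitz yx))//.
have : `|y - x| <= e / (6 * L + 1).
  rewrite distrC; near: y; apply: nx.
  by rewrite divr_gt0// ltr_wpDl// mulr_ge0.
rewrite ler_pdivlMr ?ltr_wpDl ?mulr_ge0// => h; rewrite (le_trans _ h)// mulrC.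
by rewrite ler_wpM2l// lerDl.
Unshelve. all: by end_near. Qed.

End UniformTaylor.

(** * Completeness of L^2 *)

Section RieszFischer.
Context d (T : measurableType d) (R : realType).
Variables (mu : {measure set T -> \bar R}) (D : set T) (mD : measurable D).
Variable f : nat -> T -> R.
Hypothesis mf : forall n, measurable_fun D (f n).
Hypothesis fast : forall n,
  (\int[mu]_(x in D) ((f n.+1 x - f n x) ^+ 2)%:E <= (4^-1 ^+ n * (1 / (2 ^ n.+1)%:R))%:E)%E.

(** Each weighted term is at most the sum c, so the increments are at most sqrt(c) / 2^n and the
    telescoping series converges absolutely. *)
Lemma cvg_of_weighted_square_sum (u : nat -> R) :
  (\sum_(n <oo) (4 ^+ n * (u n.+1 - u n) ^+ 2)%:E < +oo)%E -> cvgn u.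
Proof.
set S := (\sum_(n <oo) _)%E => Soo.
have pos n : (0 <= (4 ^+ n * (u n.+1 - u n) ^+ 2)%:E)%E.
  by rewrite lee_fin mulr_ge0 ?sqr_ge0// exprn_ge0.
have S0 : (0 <= S)%E by exact: nneseries_ge0.
have Sfin : S \is a fin_num by rewrite ge0_fin_numE.
set c := fine S.
have c0 : 0 <= c by exact: fine_ge0.
have le_c n : 4 ^+ n * (u n.+1 - u n) ^+ 2 <= c.
  rewrite -lee_fin fineK//.
  apply: le_trans (@nneseries_lim_ge _ _ xpredT 0%N n.+1 _).
    by rewrite big_nat_recr//= leeDr// sume_ge0.
  by move=> k _ _; exact: pos.
have dn n : `|u n.+1 - u n| <= Num.sqrt c * 2^-1 ^+ n.
  rewrite exprVn -(ler_pM2r (exprn_gt0 n (ltr0n R 2))) mulfVK ?expf_neq0//.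
  rewrite -[leLHS]ger0_norm ?mulr_ge0 ?exprn_ge0// -sqrtr_sqr.
  apply: ler_wsqrtr; rewrite exprMn real_normK ?num_real// -exprM mulnC exprM.
  by rewrite mulrC (_ : 2 ^+ 2 = 4); [exact: le_c|ring].
have : cvgn (series (fun n => u n.+1 - u n)).
  apply: normed_cvg.
  apply: (@series_le_cvg _ _ (geometric (Num.sqrt c) 2^-1)) => [n|n|n|].
  - exact: normr_ge0.
  - by rewrite /= mulr_ge0 ?sqrtr_ge0// exprn_ge0// invr_ge0.
  - exact: dn.
  apply: is_cvg_geometric_series.
  by rewrite ger0_norm ?invr_ge0// invf_lt1// ltr1n.
have -> : series (fun n => u n.+1 - u n) = (fun n => u n - u 0%N).
  apply/funext => n; rewrite /series/=; elim: n => [|n IH].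
    by rewrite big_nil subrr.
  by rewrite big_nat_recr//= IH; ring.
move=> cu; rewrite (_ : u = (fun n => (u n - u 0%N) + u 0%N)); last first.
  by apply/funext => n; rewrite subrK.
by apply: is_cvgD => //; exact: is_cvg_cst.
Qed.

(** The factor 4^-n in [fast] cancels the weight 4^n and leaves a summable 2^-(n+1). The weighted
    series thus has finite integral and is finite a.e., and the sequence converges there. Fatou's
    lemma bounds the distance to the limit by a lower limit. *)
Lemma L2_fast_limit : exists g : T -> R, measurable_fun D g /\ forall n,
  (\int[mu]_(x in D) ((f n x - g x) ^+ 2)%:E <=
   limn_einf (fun m => \int[mu]_(x in D) ((f n x - f m x) ^+ 2)%:E))%E.
Proof.
have md n m : measurable_fun D (fun x => ((f n x - f m x) ^+ 2)%:E).
  by apply/measurable_EFinP/measurable_funX; exact: measurable_funB.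
have d0 n m x : D x -> (0 <= ((f n x - f m x) ^+ 2)%:E)%E.
  by rewrite lee_fin sqr_ge0.
pose s n x := (4 ^+ n * (f n.+1 x - f n x) ^+ 2)%:E.
have ms n : measurable_fun D (s n).
  apply/measurable_EFinP; apply: measurable_funM => //.
  by apply: measurable_funX; apply: measurable_funB.
have s0 n x : D x -> (0 <= s n x)%E.
  by move=> _; rewrite lee_fin mulr_ge0 ?sqr_ge0// exprn_ge0.
pose S x := (\sum_(n <oo) s n x)%E.
have mS : measurable_fun D S.
  by apply: ge0_emeasurable_sum => // n x Dx _; exact: s0.
have intS : (\int[mu]_(x in D) S x < +oo)%E.
  rewrite integral_nneseries//.
  apply: (@le_lt_trans _ _ (\sum_(n <oo) (1 / (2 ^ (n + 1))%:R)%:E)%E).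
    apply: lee_nneseries => [n _ _|n _].
      by apply: integral_ge0 => x; exact: s0.
    rewrite /s; under eq_integral do rewrite EFinM.
    rewrite (ge0_integralZl mu mD (md n.+1 n) (d0 n.+1 n)); last first.
      by rewrite lee_fin exprn_ge0.
    apply: le_trans (lee_wpmul2l _ (fast n)) _.
      by rewrite lee_fin exprn_ge0.
    by rewrite -EFinM lee_fin exprVn mulVKf ?expf_neq0// addn1.
  have /cvg_lim := @cvg_geometric_eseries_half R 1 0.
  by rewrite /eseries/= => ->//; rewrite ltry.
have aeS : {ae mu, forall x, D x -> S x \is a fin_num}.
  apply: (@integrable_ae _ _ _ mu D mD); apply/integrableP; split => //.
  under eq_integral => x xD.
    rewrite gee0_abs; last by apply: nneseries_ge0 => n _ _; apply: s0; rewrite -inE.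
    over.
  exact: intS.
pose A := D `&` [set x | S x \is a fin_num].
have mA : measurable A by exact: emeasurable_fin_num.
(* Killing the sequence where [S] is infinite makes it converge everywhere on [D], so the limit is
   measurable; only a null set is affected. *)
pose h n x := f n x * \1_A x.
have ch x : D x -> h ^~ x @ \oo --> limn (h ^~ x).
  move=> Dx; have [Sx|Sx] := boolP (S x \is a fin_num).
    have -> : h ^~ x = f ^~ x.
      apply/funext => n; rewrite /h indicE mem_set ?mulr1//.
    apply: cvg_of_weighted_square_sum.
    by have := Sx; rewrite ge0_fin_numE//; apply: nneseries_ge0 => n _ _; exact: s0.
  have -> : h ^~ x = fun=> 0.
    by apply/funext => n; rewrite /h indicE memNset ?mulr0// => -[_] /=; exact/negP.
  exact: is_cvg_cst.
pose g x := limn (h ^~ x).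
have mg : measurable_fun D g.
  apply: (@measurable_fun_cvg _ _ _ D h) => // m.
  by apply: measurable_funM => //; exact: measurable_indic.
exists g; split => // n.
apply: le_trans (@fatou _ _ _ mu D mD _ (md n) (d0 n)).
rewrite le_eqVlt; apply/orP; left; apply/eqP; apply: ge0_ae_eq_integral => //.
- by apply/measurable_EFinP/measurable_funX; exact: measurable_funB.
- apply: (@emeasurable_fun_cvg _ _ _ D (fun k x => einfs (fun m =>
    ((f n x - f m x) ^+ 2)%:E) k)) => [k|x Dx].
    exact: (measurable_fun_einfs (md n)).
  by rewrite limn_einf_lim; exact: is_cvg_einfs.
- by move=> x _; rewrite lee_fin sqr_ge0.
- move=> x Dx; rewrite limn_einf_lim; apply: lime_ge => //.
    exact: is_cvg_einfs.
  by apply: nearW => m; apply: le_ereal_inf_tmp => _ [k /= mk <-]; exact: d0.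
move: aeS; apply: (@filterS _ _ (ae_filter_ringOfSetsType mu)) => x + Dx.
move=> /(_ Dx) Sx; apply/esym.
apply: (cvg_limn_einf_sup _).1.
apply: cvg_EFin; first exact: nearW.
have fg : f ^~ x @ \oo --> g x.
  have := ch x Dx; rewrite /g; have -> // : h ^~ x = f ^~ x.
  by apply/funext => m; rewrite /h indicE mem_set ?mulr1.
have fgn : f n x - f m x @[m --> \oo] --> f n x - g x.
  by apply: cvgB => //; exact: cvg_cst.
exact: (cvgM fgn fgn).
Qed.

End RieszFischer.

Section L2Space.
Variable R : realType.
Local Notation mu := (@lebesgue_measure R).
Local Notation I01 := (`[0, 1]%classic : set R).
Implicit Types f g : R -> R.

Let mI : measurable (I01 : set (measurableTypeR R)).
Proof. exact: measurable_itv. Qed.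

Definition sqnorm2 f : R := \int[mu]_(t in I01) (f t ^+ 2).

Lemma sqnorm2_ge0 f : 0 <= sqnorm2 f.
Proof. by apply: Rintegral_ge0 => t _; exact: sqr_ge0. Qed.

Lemma EFin_sqnorm2 f : L2 f ->
  (sqnorm2 f)%:E = (\int[mu]_(t in I01) (f t ^+ 2)%:E)%E.
Proof. by move=> [_ lf]; rewrite fineK//; exact: integrable_fin_num. Qed.

Lemma L2B f g : L2 f -> L2 g -> L2 (fun t => f t - g t).
Proof.
move=> lf lg; rewrite (_ : (fun _ => _) = fun t => -1 * g t + f t).
  exact: L2_linear.
by apply/funext => t; ring.
Qed.

Lemma sqnorm2B_le f g h : L2 f -> L2 g -> L2 h ->
  sqnorm2 (fun t => f t - h t) <=
  2 * sqnorm2 (fun t => f t - g t) + 2 * sqnorm2 (fun t => g t - h t).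
Proof.
move=> lf lg lh; have l1 := L2B lf lg; have l2 := L2B lg lh.
have := L2B lf lh => -[_ l3].
rewrite /sqnorm2 -!RintegralZl//; [|exact: l2.2|exact: l1.2].
have i1 : mu.-integrable I01 (EFin \o (fun t => 2 * (f t - g t) ^+ 2)).
  rewrite (_ : _ \o _ = (fun t => 2%:E * ((f t - g t) ^+ 2)%:E)%E)//.
  by apply: integrableZl => //; exact: l1.2.
have i2 : mu.-integrable I01 (EFin \o (fun t => 2 * (g t - h t) ^+ 2)).
  rewrite (_ : _ \o _ = (fun t => 2%:E * ((g t - h t) ^+ 2)%:E)%E)//.
  by apply: integrableZl => //; exact: l2.2.
rewrite -RintegralD//; apply: le_Rintegral => //.
  rewrite (_ : _ \o _ = ((EFin \o (fun t => 2 * (f t - g t) ^+ 2)%R) \+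
    (EFin \o (fun t => 2 * (g t - h t) ^+ 2)%R))%E)//.
  exact: integrableD.
by move=> t _; have := sqr_ge0 ((f t - g t) - (g t - h t)); nra.
Qed.

Lemma L2_of_sqnorm f : measurable_fun I01 f ->
  (\int[mu]_(t in I01) (f t ^+ 2)%:E < +oo)%E -> L2 f.
Proof.
move=> mf ff; split => //; apply/integrableP; split.
  by apply/measurable_EFinP; exact: measurable_funX.
under eq_integral do rewrite gee0_abs ?lee_fin ?sqr_ge0//.
exact: ff.
Qed.

(** A fast subsequence has a limit, and the lower limit in [L2_fast_limit] carries the Cauchy bounds
    over to it. The full sequence is then compared with the subsequence. *)
Lemma L2_complete (f : nat -> R -> R) : (forall n, L2 (f n)) ->
  (forall e, 0 < e -> exists N, forall m n, (N <= m)%N -> (N <= n)%N ->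
     sqnorm2 (fun t => f m t - f n t) <= e) ->
  exists g, L2 g /\ forall e, 0 < e -> exists N, forall n, (N <= n)%N ->
     sqnorm2 (fun t => f n t - g t) <= e.
Proof.
move=> lf cf.
pose eps k : R := 4^-1 ^+ k * (1 / (2 ^ k.+1)%:R).
have eps0 k : 0 < eps k.
  by rewrite mulr_gt0 ?exprn_gt0 ?invr_gt0// divr_gt0// ltr0n expn_gt0.
have [N NP] := choice (fun k => cf (eps k) (eps0 k)).
(* The maximum puts [phi k] beyond every threshold [N j] with j <= k; the summand k makes it
   unbounded. *)
pose phi k := (\max_(i < k.+1) N i + k)%N.
have phiN j k : (j <= k)%N -> (N j <= phi k)%N.
  move=> jk; rewrite (leq_trans _ (leq_addr _ _))//.
  by rewrite -ltnS in jk; exact: (leq_bigmax (F := fun i : 'I_k.+1 => N i) (Ordinal jk)).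
have phi_ge k : (k <= phi k)%N by rewrite leq_addl.
have mf n : measurable_fun I01 (f (phi n)) by exact: (lf _).1.
have [|g [mg gle]] := @L2_fast_limit _ _ _ mu I01 mI (fun n => f (phi n)) mf.
  move=> n; rewrite -EFin_sqnorm2; last exact: L2B.
  by rewrite lee_fin; apply: NP; exact: phiN.
have gleN e M n : (forall m, (M <= m)%N -> sqnorm2 (fun t => f (phi n) t - f (phi m) t) <= e) ->
    (\int[mu]_(t in I01) ((f (phi n) t - g t) ^+ 2)%:E <= e%:E)%E.
  move=> H; apply: le_trans (gle n) _; rewrite limn_einf_lim.
  apply: lime_le; first exact: is_cvg_einfs.
  apply: nearW => k; apply: le_trans (ereal_inf_lbound _) _.
    by exists (maxn k M) => //=; rewrite leq_maxl.
  by rewrite -EFin_sqnorm2 ?lee_fin ?H ?leq_maxr//; exact: L2B.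
have [M HM] := cf 1 ltr01.
have lg : L2 g.
  have lh : L2 (fun t => f (phi M) t - g t).
    apply: L2_of_sqnorm; first exact: measurable_funB.
    apply: le_lt_trans (gleN 1 M M _) (ltry _) => m Mm.
    by apply: HM => //; rewrite (leq_trans Mm).
  rewrite (_ : g = fun t => f (phi M) t - (f (phi M) t - g t)).
    exact: L2B.
  by apply/funext => t; ring.
exists g; split => // e e0.
have e4 : 0 < e / 4 by rewrite divr_gt0.
have [K HK] := cf _ e4; exists K => n Kn.
rewrite (le_trans (@sqnorm2B_le _ (f (phi K)) _ _ _ _))//.
have h1 : sqnorm2 (fun t => f n t - f (phi K) t) <= e / 4 by exact: HK.
have h2 : sqnorm2 (fun t => f (phi K) t - g t) <= e / 4.
  rewrite -lee_fin EFin_sqnorm2; last exact: L2B.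
  by apply: (gleN _ K) => m Km; apply: HK => //; rewrite (leq_trans Km).
by move: h1 h2; lra.
Qed.

(** Cauchy-Schwarz against constants: integrating (f - a)^2 >= 0 over ]s, t] gives [key] for every
    a, and a = I / (t - s) is the optimal choice. *)
Lemma L2_increment f s t : L2 f -> 0 <= s -> s <= t -> t <= 1 ->
  (\int[mu]_(r in `]s, t]) f r) ^+ 2 <= (t - s) * sqnorm2 f.
Proof.
move=> lf s0 st t1.
have sub : `]s, t]%classic `<=` I01.
  move=> r /=; rewrite !in_itv/= => /andP[/ltW sr rt].
  by rewrite (le_trans s0)//= (le_trans rt).
have mst : measurable (`]s, t]%classic : set (measurableTypeR R)).
  exact: measurable_itv.
have i1 : mu.-integrable `]s, t] (EFin \o f).
  exact: integrableS (L2_integrable lf).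
have i2 : mu.-integrable `]s, t] (EFin \o (fun r => f r ^+ 2)).
  by apply: integrableS lf.2.
have mu_st : fine (mu `]s, t]) = t - s.
  rewrite lebesgue_measure_itv/= lte_fin; case: ltP => //= ts.
  by apply/esym/eqP; rewrite subr_eq0 eq_le ts st.
have mufin : (mu `]s, t] < +oo)%E.
  by rewrite lebesgue_measure_itv/= lte_fin; case: ifP => _; exact: ltry.
set I := \int[mu]_(r in _) f r.
have key a : 2 * a * I - a ^+ 2 * (t - s) <= sqnorm2 f.
  have ic : mu.-integrable `]s, t] (EFin \o (fun=> a ^+ 2)).
    apply: measurable_bounded_integrable => //.
    exists (a ^+ 2); split => [|M aM r _]; first exact: num_real.
    by rewrite /= ger0_norm ?sqr_ge0// ltW.
  have iZ : mu.-integrable `]s, t] (EFin \o (fun r => 2 * a * f r)).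
    rewrite (_ : _ \o _ = (fun r => (2 * a)%:E * (f r)%:E)%E)//.
    exact: integrableZl.
  apply: (@le_trans _ _ (\int[mu]_(r in `]s, t]) (f r ^+ 2))).
    rewrite -mu_st -Rintegral_cst// -RintegralZl// -RintegralB//.
    apply: le_Rintegral => //.
      rewrite (_ : _ \o _ = ((EFin \o (fun r => 2 * a * f r)%R) \-
        (EFin \o (fun=> a ^+ 2)%R))%E)//.
      exact: integrableB.
    by move=> r _; have := sqr_ge0 (f r - a); nra.
  rewrite -lee_fin EFin_sqnorm2// fineK; last exact: integrable_fin_num.
  apply: ge0_subset_integral => //.
    by have /integrableP[] := lf.2.
  by move=> r _; rewrite lee_fin sqr_ge0.
have [ts|ts] := eqVneq t s.
  by rewrite /I ts set_itvoc0 Rintegral_set0 expr0n/= subrr mul0r.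
have ts0 : 0 < t - s by rewrite subr_gt0 lt_neqAle eq_sym ts.
have := key (I / (t - s)).
rewrite (_ : _ - _ = I ^+ 2 / (t - s)); last by field; rewrite gt_eqF.
by rewrite ler_pdivrMr// mulrC.
Qed.

End L2Space.

(** * The Hilbert space H^1 of curves *)

Section SobolevCurves.
Variables (R : realType) (d : nat).
Local Notation mu := (@lebesgue_measure R).
Local Notation I01 := (`[0, 1]%classic : set R).
Local Notation H1 := (H1 R d).
Local Notation E := 'rV[R]_d.
Implicit Types u v w : H1.

Let mI : measurable (I01 : set (measurableTypeR R)).
Proof. exact: measurable_itv. Qed.

Let vL2 (f : R -> E) := forall i, L2 (fun t => f t 0 i).

Lemma dotv_le (x y : E) : `|dotv x y| <= enorm x * enorm y.
Proof.
rewrite -sqrtr_sqr -sqrtrM ?dotv_ge0//; apply: ler_wsqrtr.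
exact: (psd_CauchySchwarz (@dotvC _ _) (@dotvDl _ _) (@dotvZl _ _) (@dotv_ge0 _ _)).
Qed.

Lemma dotvBl (x y z : E) : dotv (x - y) z = dotv x z - dotv y z.
Proof. by rewrite dotvDl -scaleN1r dotvZl mulN1r. Qed.

Lemma enorm_sqr (x : E) : enorm x ^+ 2 = dotv x x.
Proof. by rewrite sqr_sqrtr// dotv_ge0. Qed.

Lemma enormB (x y : E) : enorm (x - y) = enorm (y - x).
Proof. by rewrite -opprB -scaleN1r enormZ normrN1 mul1r. Qed.

Lemma coord_le_enorm (x : E) i : `|x 0 i| <= enorm x.
Proof.
rewrite -sqrtr_sqr; apply: ler_wsqrtr; rewrite /dotv (bigD1 i)//= -expr2 lerDl.
by apply: sumr_ge0 => j _; rewrite -expr2 sqr_ge0.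
Qed.

Lemma norm_le_enorm (x : E) : `|x| <= enorm x.
Proof.
rewrite [leLHS]/Num.norm/= mx_normrE; apply: bigmax_le; first exact: enorm_ge0.
by move=> [i j] _ /=; rewrite ord1; exact: coord_le_enorm.
Qed.

Lemma L2ip_sum (f g : R -> E) : vL2 f -> vL2 g ->
  L2ip f g = \sum_(i < d) \int[mu]_(t in I01) (f t 0 i * g t 0 i).
Proof.
move=> lf lg; have I (i : 'I_d) := L2M (lf i) (lg i).
rewrite /L2ip /Rintegral; under eq_integral do rewrite /dotv -sumEFin.
rewrite integral_sum// -[LHS]/(fine _).
under eq_bigr => i _ do rewrite -(@fineK _ (\int[mu]_(x in I01) _)%E) ?integrable_fin_num//.
by rewrite sumEFin.
Qed.

Lemma L2ip_sqr (f : R -> E) : vL2 f ->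
  L2ip f f = \sum_(i < d) sqnorm2 (fun t => f t 0 i).
Proof.
by move=> lf; rewrite L2ip_sum//; apply: eq_bigr => i _; apply: eq_Rintegral.
Qed.

Definition dirichlet u v : R := L2ip (velocity u) (velocity v).

Lemma dirichletC u v : dirichlet u v = dirichlet v u.
Proof. exact: L2ipC. Qed.

Lemma dirichletE u v : dirichlet u v = H1ip u v - L2ip u v.
Proof. by rewrite /H1ip addrC addKr. Qed.

Lemma dirichletDl u v w : dirichlet (u + v) w = dirichlet u w + dirichlet v w.
Proof.
rewrite !dirichletE H1ipDl (_ : L2ip (u + v) w = L2ip u w + L2ip v w); first ring.
rewrite -[u]scale1r -[LHS]/(L2ip (1 *: (u : R -> E) + v) w).
rewrite L2ip_linear ?mul1r ?scale1r//; exact: H1_vL2.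
Qed.

Lemma dirichletZl a u w : dirichlet (a *: u) w = a * dirichlet u w.
Proof.
rewrite !dirichletE H1ipZl.
suff -> : L2ip (a *: u) w = a * L2ip u w by ring.
rewrite -[a *: u]addr0 -[LHS]/(L2ip (a *: (u : R -> E) + (0 : H1)) w).
rewrite L2ip_linear; [|exact: H1_vL2..].
rewrite [X in _ + X](_ : _ = 0) ?addr0//.
rewrite /L2ip (@eq_Rintegral _ _ _ mu _ (fun=> 0)) /Rintegral ?integral0//.
by move=> t _; rewrite -[(0 : H1) t]/(0 : E) dotv0l.
Qed.

Lemma dirichlet_ge0 u : 0 <= dirichlet u u.
Proof. exact: L2ip_ge0. Qed.

Lemma dirichletDr u v w : dirichlet w (u + v) = dirichlet w u + dirichlet w v.
Proof. by rewrite dirichletC dirichletDl ![dirichlet _ w]dirichletC. Qed.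

Lemma dirichletZr a u w : dirichlet w (a *: u) = a * dirichlet w u.
Proof. by rewrite dirichletC dirichletZl [dirichlet _ w]dirichletC. Qed.

Lemma H1_normE u : `|u| ^+ 2 = L2ip u u + dirichlet u u.
Proof. by rewrite sqr_sqrtr// H1ip_ge0. Qed.

Lemma H1ip_le u v : `|H1ip u v| <= `|u| * `|v|.
Proof.
rewrite -sqrtr_sqr -sqrtrM ?H1ip_ge0//; apply: ler_wsqrtr.
exact: (psd_CauchySchwarz (@H1ipC _ _) (@H1ipDl _ _) (@H1ipZl _ _) (@H1ip_ge0 _ _)).
Qed.

Lemma dirichlet_le_norm u : dirichlet u u <= `|u| ^+ 2.
Proof. by rewrite H1_normE lerDr L2ip_ge0. Qed.

Lemma dirichlet_sqrt_le u : Num.sqrt (dirichlet u u) <= `|u|.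
Proof.
rewrite -[leRHS]ger0_norm// -sqrtr_sqr; apply: ler_wsqrtr.
exact: dirichlet_le_norm.
Qed.

Lemma dirichlet_le u v :
  `|dirichlet u v| <= Num.sqrt (dirichlet u u) * Num.sqrt (dirichlet v v).
Proof.
rewrite -sqrtr_sqr -sqrtrM ?dirichlet_ge0//; apply: ler_wsqrtr.
exact: (psd_CauchySchwarz dirichletC dirichletDl dirichletZl dirichlet_ge0).
Qed.

Lemma velocity_increment (f g : R -> E) s t : is_velocity f g ->
  0 <= s -> s <= t -> t <= 1 -> forall i,
  f t 0 i - f s 0 i = \int[mu]_(r in `]s, t]) g r 0 i.
Proof.
move=> fg s0 st t1 i; have [lg fE] := fg i.
have s01 : s \in `[0, 1] by rewrite in_itv/= s0 (le_trans st).
have t01 : t \in `[0, 1] by rewrite in_itv/= t1 (le_trans s0).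
rewrite (fE t t01) (fE s s01) opprD addrACA subrr add0r.
rewrite (@Rintegral_itvB _ _ (BLeft 0) (BRight t) s)//.
apply: integrableS (L2_integrable lg) => //.
by move=> r /=; rewrite !in_itv/= => /andP[-> rt]; rewrite (le_trans rt).
Qed.

(** The Dirichlet energy controls a modulus of continuity of exponent 1/2, coordinate by coordinate
    through [L2_increment]. *)
Lemma holder_curve u s t : 0 <= s -> s <= t -> t <= 1 ->
  enorm (u t - u s) ^+ 2 <= (t - s) * dirichlet u u.
Proof.
move=> s0 st t1; rewrite enorm_sqr /dotv [dirichlet _ _]L2ip_sqr; last first.
  by move=> i; exact: velocity_vL2.
rewrite mulr_sumr; apply: ler_sum => i _.
rewrite !mxE (velocity_increment (velocityP u) s0 st t1) -expr2.
by apply: L2_increment => //; exact: velocity_vL2.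
Qed.

Lemma holder_curve_abs u s t : t \in `[0, 1] -> s \in `[0, 1] ->
  enorm (u t - u s) ^+ 2 <= `|t - s| * dirichlet u u.
Proof.
rewrite !in_itv/= => /andP[t0 t1] /andP[s0 s1].
have [st|/ltW ts] := leP s t.
  by rewrite ger0_norm ?subr_ge0// holder_curve.
by rewrite enormB distrC ger0_norm ?subr_ge0// holder_curve.
Qed.

Lemma fine_mu01 : fine (mu I01) = 1.
Proof. by rewrite lebesgue_measure_itv/= lte_fin ltr01/= subr0. Qed.

(** The embedding of H^1 into bounded curves: [u t] is compared with [u s] by the Hoelder bound, and
    the squares are averaged over s. The factor 2 returns as 2M and, squared, as 4KM in the H^1
    bounds for the potential. *)
Lemma enorm_curve_le u t : enorm (u t) <= 2 * `|u|.
Proof.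
have [t01|t01] := boolP (t \in `[0, 1]); last first.
  by rewrite H1_out// enorm0 mulr_ge0.
rewrite -[leRHS]ger0_norm ?mulr_ge0// -sqrtr_sqr; apply: ler_wsqrtr.
rewrite -enorm_sqr.
apply: (@le_trans _ _ (2 * `|u| ^+ 2)); last by have := sqr_ge0 `|u|; nra.
have ptw s : s \in `[0, 1] ->
    enorm (u t) ^+ 2 <= 2 * dotv (u s) (u s) + 2 * dirichlet u u.
  move=> s01; have hh := holder_curve_abs u t01 s01.
  have ts : `|t - s| <= 1.
    move: t01 s01; rewrite !in_itv/= => /andP[? ?] /andP[? ?].
    by rewrite ler_norml; apply/andP; split; lra.
  have {}hh := le_trans hh (ler_wpM2r (dirichlet_ge0 u) ts).
  rewrite -enorm_sqr.
  have tri : enorm (u t) <= enorm (u t - u s) + enorm (u s).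
    by rewrite -[X in enorm X <= _](subrK (u s)) enormD.
  have tri2 : enorm (u t) ^+ 2 <= (enorm (u t - u s) + enorm (u s)) ^+ 2.
    by rewrite lerXn2r ?nnegrE ?addr_ge0 ?enorm_ge0.
  have := sqr_ge0 (enorm (u t - u s) - enorm (u s)).
  by move: tri2 hh; rewrite !mul1r sqrrD sqrrB !mulr2n; lra.
have icst (c : R) : mu.-integrable I01 (EFin \o (fun=> c)).
  by apply: L2_integrable; apply: L2_within_continuous => x; exact: cst_continuous.
have iip := L2ip_integrable (@H1_vL2 _ _ u) (@H1_vL2 _ _ u).
have i2 : mu.-integrable I01 (EFin \o (fun s => 2 * dotv (u s) (u s))).
  rewrite (_ : _ \o _ = (fun s => 2%:E * (dotv (u s) (u s))%:E)%E)//.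
  exact: integrableZl.
have cstE (c : R) : \int[mu]_(_ in I01) c = c.
  by rewrite Rintegral_cst// fine_mu01 mulr1.
rewrite -(cstE (enorm (u t) ^+ 2)) H1_normE mulrDr -(cstE (2 * dirichlet u u)).
rewrite -RintegralZl// -RintegralD//; apply: le_Rintegral => //.
rewrite (_ : _ \o _ = ((EFin \o (fun s => 2 * dotv (u s) (u s))%R) \+
    (EFin \o (fun=> 2 * dirichlet u u)%R))%E)//.
exact: integrableD.
Qed.

End SobolevCurves.

Section SobolevComplete.
Variables (R : realType) (d : nat).
Local Notation mu := (@lebesgue_measure R).
Local Notation I01 := (`[0, 1]%classic : set R).
Local Notation H1 := (H1 R d).
Local Notation E := 'rV[R]_d.
Implicit Types u v w : H1.

Let mI : measurable (I01 : set (measurableTypeR R)).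
Proof. exact: measurable_itv. Qed.

Let vL2 (f : R -> E) := forall i, L2 (fun t => f t 0 i).

Lemma H1_of_velocity (a : E) (g : R -> E) : vL2 g ->
  exists u, u 0 = a /\ is_velocity u g.
Proof.
move=> lg.
pose f t : E := if t \in `[0, 1] then
  \row_i (a 0 i + \int[mu]_(s in `[0, t]) g s 0 i) else 0.
have f0 : f 0 = a.
  rewrite /f in_itv/= lexx ler01; apply/rowP => i.
  by rewrite mxE set_itv1 Rintegral_set1 addr0.
have fg : is_velocity f g.
  by move=> i; split => // t t01; rewrite f0 /f t01 mxE.
have fH : f \in @is_H1 R d.
  by rewrite inE; split => [t /negbTE t01|]; [rewrite /f t01|exists g].
by exists (MkH1 fH).
Qed.

Lemma dirichlet_velocity u v g h : is_velocity u g -> is_velocity v h ->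
  dirichlet u v = L2ip g h.
Proof.
move=> ug vh; have lg i := (ug i).1; have lh i := (vh i).1.
rewrite /dirichlet (@L2ip_ae _ _ _ g)//; last 3 first.
- by move=> i; exact: velocity_vL2.
- by move=> i; exact: velocity_vL2.
- exact: is_velocity_uniq (velocityP u) ug.
rewrite L2ipC (@L2ip_ae _ _ _ h) 1?L2ipC//.
- by move=> i; exact: velocity_vL2.
- exact: is_velocity_uniq (velocityP v) vh.
Qed.

Lemma dirichletB_velocity u v g h : is_velocity u g -> is_velocity v h ->
  dirichlet (u - v) (u - v) = \sum_i sqnorm2 (fun t => g t 0 i - h t 0 i).
Proof.
move=> ug vh; have uv : is_velocity (u - v) (-1 *: h + g).
  rewrite addrC -scaleN1r; exact: is_velocityD.
rewrite (dirichlet_velocity uv uv) L2ip_sqr; last by move=> i; exact: (uv i).1.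
apply: eq_bigr => i _; apply: eq_Rintegral => t _.
by rewrite -[(_ + g) t]/(-1 *: h t + g t) !mxE mulN1r addrC.
Qed.

Lemma Rintegral01_cst (c : R) : \int[mu]_(_ in I01) c = c.
Proof. by rewrite Rintegral_cst// fine_mu01 mulr1. Qed.

Lemma Rintegral01_le (f : R -> R) (c : R) : 0 <= c ->
  mu.-integrable I01 (EFin \o f) ->
  (forall t, t \in `[0, 1] -> f t <= c) -> \int[mu]_(t in I01) f t <= c.
Proof.
move=> c0 fi fc; rewrite -(Rintegral01_cst c).
apply: le_Rintegral => //.
by apply: L2_integrable; apply: L2_within_continuous => x; exact: cst_continuous.
Qed.

Lemma H1_norm_le_sup u c :
  (forall t, t \in `[0, 1] -> enorm (u t) <= c) ->
  `|u| ^+ 2 <= c ^+ 2 + dirichlet u u.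
Proof.
move=> uc; rewrite H1_normE lerD2r; apply: Rintegral01_le => [||t t01].
- exact: sqr_ge0.
- exact: (L2ip_integrable (@H1_vL2 _ _ u) (@H1_vL2 _ _ u)).
- by rewrite -enorm_sqr lerXn2r ?nnegrE ?enorm_ge0 ?uc// (le_trans _ (uc t t01)) ?enorm_ge0.
Qed.

(** Starting point and velocity control the norm, so convergence in H^1 reduces to convergence in
    R^d x L^2. *)
Lemma H1_norm_le_at0 u : `|u| ^+ 2 <= 2 * enorm (u 0) ^+ 2 + 3 * dirichlet u u.
Proof.
set c := enorm (u 0) + Num.sqrt (dirichlet u u).
apply: (@le_trans _ _ (c ^+ 2 + dirichlet u u)).
  apply: H1_norm_le_sup => t t01.
  rewrite -[u t](subrK (u 0)) addrC (le_trans (enormD _ _))// lerD2l.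
  rewrite -[leLHS]ger0_norm ?enorm_ge0// -sqrtr_sqr; apply: ler_wsqrtr.
  have := t01; rewrite in_itv/= => /andP[t0 t1].
  rewrite (le_trans (holder_curve u (lexx 0) t0 t1))// subr0.
  by rewrite ler_piMl ?dirichlet_ge0.
have := sqr_sqrtr (dirichlet_ge0 u).
have := sqr_ge0 (enorm (u 0) - Num.sqrt (dirichlet u u)).
by rewrite /c sqrrB sqrrD !mulr2n; lra.
Qed.

Lemma H1_complete (f : nat -> H1) :
  (forall e, 0 < e -> exists N, forall m n, (N <= m)%N -> (N <= n)%N ->
     `|f m - f n| <= e) ->
  exists g : H1, f n @[n --> \oo] --> g.
Proof.
move=> cf.
have cv i : exists g, L2 g /\ forall e, 0 < e -> exists N, forall n, (N <= n)%N ->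
    sqnorm2 (fun t => velocity (f n) t 0 i - g t) <= e.
  apply: (@L2_complete R (fun n t => velocity (f n) t 0 i)) => [n|e e0].
    exact: velocity_vL2.
  have [N NP] := cf (Num.sqrt e) (etrans (sqrtr_gt0 e) e0).
  exists N => m n Nm Nn.
  apply: (@le_trans _ _ (`|f m - f n| ^+ 2)).
    apply: le_trans (dirichlet_le_norm _).
    rewrite (dirichletB_velocity (velocityP (f m)) (velocityP (f n))).
    by rewrite (bigD1 i)//= lerDl; apply: sumr_ge0 => j _; exact: sqnorm2_ge0.
  rewrite -[leRHS](sqr_sqrtr (ltW e0)) lerXn2r ?nnegrE ?sqrtr_ge0//.
  exact: NP.
have [g gP] := choice cv.
have ca (i : 'I_d) : exists a : R, f n 0 0 i @[n --> \oo] --> a.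
  suff /cvg_ex[a fa] : cvgn (fun n => f n 0 0 i) by exists a.
  apply/cauchy_cvgP/cauchy_exP => e e0.
  have e4 : 0 < e / 4 by rewrite divr_gt0.
  have [N NP] := cf _ e4; exists (f N 0 0 i); exists N => // n /= Nn.
  rewrite -ball_normE/=.
  have -> : f N 0 0 i - f n 0 0 i = (f N - f n) 0 0 i.
    by rewrite -[(f N - f n) 0]/(f N 0 - f n 0) !mxE.
  rewrite (le_lt_trans (coord_le_enorm _ _))//.
  rewrite (le_lt_trans (enorm_curve_le _ _))//.
  by rewrite (le_lt_trans (ler_wpM2l _ (NP _ _ (leqnn N) Nn)))//; lra.
have [a aP] := choice ca.
have vg : vL2 (fun t => \row_i g i t).
  by move=> i; have := (gP i).1; congr L2; apply/funext => t; rewrite mxE.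
have [u [u0 ug]] := H1_of_velocity (\row_i a i) vg.
exists u; apply/cvgrPdist_le => e e0.
(* 5 = 2 + 3 is the sum of the constants of [H1_norm_le_at0]; each of the d coordinates of starting
   point and velocity contributes at most c. *)
pose c := e ^+ 2 / (5 * (d%:R + 1)).
have c0 : 0 < c by rewrite divr_gt0 ?exprn_gt0// mulr_gt0 ?ltr_wpDl.
have near1 : \forall n \near \oo, forall i, sqnorm2 (fun t => velocity (f n) t 0 i - g i t) <= c.
  apply: filter_forall => i; have [N NP] := (gP i).2 c c0.
  by exists N => // n /= Nn; exact: NP.
have near2 : \forall n \near \oo, forall i, `|a i - f n 0 0 i| <= Num.sqrt c.
  apply: filter_forall => i; have /cvgrPdist_le := aP i; apply.
  by rewrite sqrtr_gt0.
near=> n.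
have n1 : forall i, sqnorm2 (fun t => velocity (f n) t 0 i - g i t) <= c by near: n.
have n2 : forall i, `|a i - f n 0 0 i| <= Num.sqrt c by near: n.
rewrite distrC -(ler_pXn2r (ltn0Sn 1)) ?nnegrE ?(ltW e0)//.
apply: (le_trans (H1_norm_le_at0 _)).
have V : dirichlet (f n - u) (f n - u) <= d%:R * c.
  rewrite (dirichletB_velocity (velocityP (f n)) ug).
  rewrite mulr_natl -[X in _ *+ X]card_ord -sumr_const; apply: ler_sum => i _.
  by under [X in sqnorm2 X]eq_fun do rewrite mxE; exact: n1.
have P0 : enorm ((f n - u) 0) ^+ 2 <= d%:R * c.
  rewrite enorm_sqr mulr_natl -[X in _ *+ X]card_ord -sumr_const; apply: ler_sum => i _.
  rewrite -[(f n - u) 0]/(f n 0 - u 0) u0 !mxE -expr2.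
  rewrite -[leLHS]real_normK ?num_real// distrC -[leRHS](sqr_sqrtr (ltW c0)).
  by rewrite lerXn2r ?nnegrE ?sqrtr_ge0// n2.
apply: (@le_trans _ _ (5 * (d%:R + 1) * c)).
  have d0 : 0 <= d%:R * c by rewrite mulr_ge0// ltW.
  by move: V P0 c0; lra.
by rewrite /c mulrC divfK// gt_eqF// mulr_gt0 ?ltr_wpDl.
Unshelve. all: by end_near. Qed.

End SobolevComplete.

(** * Uniform compactness of bounded sequences of curves *)

Section CurveCompactness.
Variables (R : realType) (d : nat).
Local Notation H1 := (H1 R d).
Local Notation E := 'rV[R]_d.

Lemma norm_le_coord (x : E) (c : R) : 0 <= c ->
  (forall i, `|x 0 i| <= c) -> `|x| <= c.
Proof.
move=> c0 xc; rewrite [leLHS]/Num.norm/= mx_normrE; apply: bigmax_le => //.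
by move=> [i j] _ /=; rewrite ord1.
Qed.

(* Tychonoff gives a pointwise cluster point; Hoelder equicontinuity makes
   closeness on a finite grid uniform. *)
Lemma H1_bounded_uniformly_cauchy (f : nat -> H1) (B : R) :
  (forall n, `|f n| <= B) ->
  exists phi : nat -> nat, {homo phi : m n / (m < n)%N} /\
    forall e, 0 < e -> exists N, forall m n, (N <= m)%N -> (N <= n)%N ->
      forall t, t \in `[0, 1] -> enorm (f (phi m) t - f (phi n) t) <= e.
Proof.
move=> fB; have B0 : 0 <= B by exact: le_trans (fB 0%N).
pose ev n : forall ti : R * 'I_d, (R : topologicalType) := fun ti => f n ti.1 0 ti.2.
have cK := @tychonoff (R * 'I_d)%type (fun=> R : topologicalType)
  (fun=> `[- (2 * B), 2 * B]%classic) (fun=> @segment_compact _ _ _).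
have evK : \forall n \near \oo, (forall ti, `[- (2 * B), 2 * B]%classic (ev n ti)).
  apply: nearW => n ti /=; rewrite in_itv/= -ler_norml.
  rewrite (le_trans (coord_le_enorm _ _))// (le_trans (enorm_curve_le _ _))//.
  by rewrite ler_wpM2l.
have [p [_ pcl]] := cK (ev @ \oo) _ evK.
(* The grids of mesh 1/(l+1) are tested for all l <= k together, so that the grid chosen for a given
   accuracy stays under control at every later index. *)
pose good k n := forall (l : 'I_k.+1) (j : 'I_k.+2) (i : 'I_d),
  `|p (j%:R / l.+1%:R, i) - f n (j%:R / l.+1%:R) 0 i| < k.+1%:R^-1.
have ex_good k N : exists n, (N <= n)%N /\ good k n.
  pose U := [set q : {ptws (R * 'I_d)%type -> R} |
    forall (l : 'I_k.+1) (j : 'I_k.+2) (i : 'I_d),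
    `|p (j%:R / l.+1%:R, i) - q (j%:R / l.+1%:R, i)| < k.+1%:R^-1].
  have Up : nbhs (p : {ptws (R * 'I_d)%type -> R}) U.
    have H (l : 'I_k.+1) (j : 'I_k.+2) (i : 'I_d) :
        \forall q \near (p : {ptws (R * 'I_d)%type -> R}),
        `|p (j%:R / l.+1%:R, i) - q (j%:R / l.+1%:R, i)| < k.+1%:R^-1.
      have pc : (q : _ -> R) (j%:R / l.+1%:R, i) @[q --> (p : {ptws (R * 'I_d)%type -> R})] -->
          (p (j%:R / l.+1%:R, i) : R).
        exact: (@proj_continuous _ (fun=> R : topologicalType) (j%:R / l.+1%:R, i) p).
      have k0 : 0 < k.+1%:R^-1 :> R by rewrite invr_gt0.
      have nb := nbhsx_ballx (p (j%:R / l.+1%:R, i) : R) _ k0.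
      by have := pc _ nb; rewrite /= -ball_normE.
    have FF : Filter (nbhs (p : {ptws (R * 'I_d)%type -> R})) by exact: nbhs_filter.
    exact: (filter_forall FF (fun l => filter_forall FF (fun j =>
      filter_forall FF (H l j)))).
  have FN : (ev @ \oo) [set ev n | n in [set n | (N <= n)%N]].
    by exists N => // n /= Nn; exists n.
  have [_ [[n /= Nn <-] Un]] := pcl _ _ FN Up.
  by exists n; split.
pose next k N := sval (cid (ex_good k N)).
have nextP k N : (N <= next k N)%N /\ good k (next k N) by rewrite /next; case: cid.
pose phi := fix phi k := if k is k'.+1 then next k (phi k').+1 else next 0%N 0%N.
have phi_good k : good k (phi k) by case: k => [|k]; apply: (nextP _ _).2.
exists phi; split.
  apply: homo_ltn => [? ? ?|k]; first exact: ltn_trans.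
  exact: (nextP k.+1 (phi k).+1).1.
move=> e e0.
(* On a mesh of width at most c^2 the Hoelder bound lets each curve vary by at most c B <= e/4 from
   the grid point; the remaining e/2 is for the grid values. *)
pose c := e / 4 / (B + 1).
have B1 : 0 < B + 1 by rewrite ltr_wpDl.
have c0 : 0 < c by rewrite !divr_gt0.
have c20 : 0 < c ^+ 2 by rewrite exprn_gt0.
have e'0 : 0 < e / 4 / (d%:R + 1) by rewrite !divr_gt0// ltr_wpDl.
have invN (r : R) : 0 < r -> exists N : nat, N.+1%:R^-1 <= r.
  move=> r0; have [N _ NP] := near_infty_natSinv_lt (PosNum r0).
  by exists N; apply: ltW; exact: (NP N (leqnn N)).
have [|N] := invN (Num.min (c ^+ 2) (e / 4 / (d%:R + 1))).
  by rewrite lt_min c20.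
rewrite le_min => /andP[Nc Ne]; exists N => m n Nm Nn t t01.
have /andP[t0 t1] : 0 <= t <= 1 by rewrite in_itv in t01.
have tN0 : 0 <= t * N.+1%:R by rewrite mulr_ge0.
pose j := Num.truncn (t * N.+1%:R).
have /andP[jt tj] := truncn_itv tN0.
have jN : (j <= N.+1)%N.
  by rewrite -(ler_nat R) (le_trans jt)// ler_piMl.
pose s : R := j%:R / N.+1%:R.
have s0 : 0 <= s by rewrite divr_ge0.
have st : s <= t by rewrite ler_pdivrMr.
have ts : t - s <= c ^+ 2.
  apply: le_trans Nc; rewrite -(@ler_pM2r _ N.+1%:R)// mulVf// mulrBl divfK//.
  by move: tj; rewrite -/j -natr1; lra.
have hol k : enorm (f k t - f k s) <= e / 4.
  apply: (@le_trans _ _ (c * B)); last first.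
    rewrite /c -mulrA ger_pMr ?divr_gt0// mulrC ler_pdivrMr// mul1r.
    by rewrite lerDl.
  have cB : 0 <= c * B by rewrite mulr_ge0// ltW.
  rewrite -(@ler_pXn2r _ 2)// ?nnegrE ?enorm_ge0// exprMn.
  rewrite (le_trans (holder_curve (f k) s0 st t1))//.
  rewrite ler_pM ?subr_ge0 ?dirichlet_ge0//.
  rewrite (le_trans (dirichlet_le_norm _))// lerXn2r ?nnegrE//.
have mid : enorm (f (phi m) s - f (phi n) s) <= e / 2.
  have gd k i : (N <= k)%N -> `|p (s, i) - f (phi k) s 0 i| <= e / 4 / (d%:R + 1).
    move=> Nk; have lk : (N < k.+1)%N by [].
    have jk : (j < k.+2)%N by rewrite ltnS (leq_trans jN).
    have /ltW := phi_good k (Ordinal lk) (Ordinal jk) i.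
    move=> /le_trans; apply; apply: le_trans Ne.
    by rewrite lef_pV2 ?posrE// ler_nat.
  rewrite (le_trans (enorm_le_norm _))//.
  apply: (@le_trans _ _ (d%:R * (e / 2 / (d%:R + 1)))).
    rewrite ler_wpM2l//; apply: norm_le_coord => [|i].
      by rewrite !divr_ge0 ?addr_ge0// ltW.
    rewrite !mxE -[f _ s 0 i](subrK (p (s, i))) -addrA.
    rewrite (le_trans (ler_normD _ _))// distrC.
    have := gd m i Nm; have := gd n i Nn.
    rewrite (_ : e / 2 / (d%:R + 1) = e / 4 / (d%:R + 1) + e / 4 / (d%:R + 1)); last first.
      by field; rewrite gt_eqF// ltr_wpDl.
    lra.
  rewrite mulrCA ger_pMr ?divr_gt0// ler_pdivrMr ?ltr_wpDl// mul1r.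
  by rewrite lerDl.
have -> : f (phi m) t - f (phi n) t = (f (phi m) t - f (phi m) s) +
    ((f (phi m) s - f (phi n) s) + (f (phi n) s - f (phi n) t)).
  by apply/rowP => i; rewrite !mxE; ring.
rewrite (le_trans (enormD _ _))// (le_trans (lerD (hol _) (enormD _ _)))//.
rewrite [enorm (f _ s - f _ t)]enormB.
by have := hol (phi n); move: mid; lra.
Qed.

End CurveCompactness.

(** * Compactly supported C^{1,1} functions, extended by zero *)

Section CompactlySupportedC11.
Variables (R : realType) (d : nat).
Local Notation V := 'rV[R]_d.
Variables (Omega E : set V).
Hypothesis oO : open Omega.
Hypothesis cE : compact E.
Hypothesis EO : E `<=` Omega.
Local Notation S := (closure Omega).

Lemma enorm_ball (x : V) (r : R) : 0 < r ->
  \forall y \near x, enorm (y - x) < r.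
Proof.
move=> r0; have d0 : 0 < d%:R + 1 :> R by rewrite ltr_wpDl.
have e0 : 0 < r / (d%:R + 1) by rewrite divr_gt0.
have := nbhsx_ballx x _ e0; apply: filterS => y; rewrite -ball_normE/= => xy.
rewrite (le_lt_trans (enorm_le_norm _))// distrC.
apply: (@le_lt_trans _ _ ((d%:R + 1) * `|x - y|)); first by rewrite ler_wpM2r// lerDl.
by rewrite mulrC -ltr_pdivlMr.
Qed.

Lemma compact_margin : exists r : R, 0 < r /\
  forall x y, E x -> enorm (y - x) < r -> Omega y.
Proof.
have /compact_near_coveringP cov := cE.
pose P (r : R) (x : V) := forall y, enorm (y - x) < r -> Omega y.
have nE : \forall r \near (0 : R)^'+, E `<=` P r.
  apply: cov => x Ex; have [e e0 eO] : exists2 e : R, 0 < e & ball x e `<=` Omega.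
    by apply/nbhs_ballP; apply: open_nbhs_nbhs; split => //; exact: EO.
  have e2 : 0 < e / 2 by rewrite divr_gt0.
  exists (ball x (e / 2), [set r | r < e / 2]) => /=.
    by split; [exact: nbhsx_ballx|exact: nbhs_right_lt].
  move=> [y r]/= [xy re] z zy; apply: eO; apply: (@ball_split _ _ y) => //.
  by rewrite -ball_normE/= distrC (le_lt_trans (norm_le_enorm _))// (lt_trans zy).
have [r [r0 rE]] : exists r : R, 0 < r /\ E `<=` P r.
  near (0 : R)^'+ => r; exists r; split; first by [].
  by near: r.
by exists r; split => // x y Ex; exact: rE.
Unshelve. all: by end_near. Qed.

Section single.
Variables (u : C11 S) (M : R).
Hypothesis uE : supp u `<=` E.
Hypothesis gE : supp (grad u) `<=` E.
Hypothesis gM : forall x, enorm (grad u x) <= M.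
Hypothesis gL : forall x y, S x -> S y ->
  enorm (grad u x - grad u y) <= M * enorm (x - y).

Lemma C11_eq0_out x : ~ E x -> u x = 0 /\ grad u x = 0.
Proof.
move=> Ex; split; apply/eqP; apply: contra_notT Ex => ux.
- by apply: uE; exact: subset_closure.
- by apply: gE; exact: subset_closure.
Qed.

(** Differentiability in R^d rather than relative to [S]: points of [E] are interior to [S], and
    near any other point [u] vanishes because [E] is closed. *)
Lemma C11_grad_at x e : 0 < e -> \forall y \near x,
  `|u y - u x - dotv (grad u x) (y - x)| <= e * enorm (y - x).
Proof.
move=> e0.
have [Ex|Ex] := pselect (E x).
  have [_ ug _ _ _] := C11P u.
  have SO : nbhs x S.
    apply: filterS (@subset_closure _ Omega) _.
    by apply: open_nbhs_nbhs; split => //; exact: EO.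
  have := ug x (subset_closure (EO Ex)) e e0; rewrite /within/=.
  by move: SO; apply: filterS2 => y Sy; apply.
have [ux gx] := C11_eq0_out Ex.
have cE' : closed E by exact: compact_closed.
have : nbhs x (~` E) by apply: open_nbhs_nbhs; split => //; exact: closed_openC.
apply: filterS => y /C11_eq0_out[uy _].
by rewrite -[X in `|X - _|]/(u y - u x) ux uy gx dotv0l !subrr normr0 mulr_ge0 ?enorm_ge0// ltW.
Qed.

(** Two points at distance less than r either both lie in [S], one of them being in [E], or are both
    off [E], where the gradient is zero. For distant points 2M <= (2/r) M |x - y|. *)
Lemma C11_grad_lipschitz (r : R) : 0 < r ->
  (forall x y, E x -> enorm (y - x) < r -> Omega y) -> forall x y,
  enorm (grad u x - grad u y) <= (1 + 2 / r) * M * enorm (x - y).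
Proof.
move=> r0 rO x y; have M0 : 0 <= M by exact: le_trans (enorm_ge0 _) (gM x).
have k1 : M * enorm (x - y) <= (1 + 2 / r) * M * enorm (x - y).
  by rewrite ler_wpM2r ?enorm_ge0// ler_peMl// lerDl divr_ge0// ltW.
have [xy|xy] := ltP (enorm (x - y)) r; last first.
  apply: (@le_trans _ _ (2 * M)).
    rewrite -scaleN1r (le_trans (enormD _ _))// enormZ normrN1 mul1r.
    by have := gM x; have := gM y; lra.
  apply: (@le_trans _ _ (2 / r * M * r)).
    by rewrite mulrAC divfK ?gt_eqF.
  apply: ler_pM => //.
  - by rewrite mulr_ge0// divr_ge0// ltW.
  - exact: ltW.
  - by rewrite ler_wpM2r// lerDr.
have [Ex|Ex] := pselect (E x).
  rewrite (le_trans _ k1)// gL//; apply: subset_closure; first exact: EO.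
  by apply: (rO x) => //; rewrite enormB.
have [Ey|Ey] := pselect (E y).
  rewrite (le_trans _ k1)// gL//; apply: subset_closure; last exact: EO.
  exact: (rO y).
rewrite (C11_eq0_out Ex).2 (C11_eq0_out Ey).2 subrr enorm0 mulr_ge0 ?enorm_ge0//.
by rewrite mulr_ge0// addr_ge0// divr_ge0// ltW.
Qed.

Lemma C11_derive_along x h (s : R) :
  is_derive s (1 : R) (fun s => u (x + s *: h)) (dotv (grad u (x + s *: h)) h).
Proof.
set df := dotv _ _.
have H : (t^-1 *: (((fun s => u (x + s *: h)) \o shift s) (t *: (1 : R)) - u (x + s *: h)))
    @[t --> 0^'] --> df.
  apply/cvgrPdist_le => e e0.
  have n1 : 0 < enorm h + 1 by rewrite ltr_wpDl ?enorm_ge0.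
  have e1 : 0 < e / (enorm h + 1) by rewrite divr_gt0.
  have C : (x + (t + s) *: h) @[t --> (0 : R)^'] --> x + s *: h.
    apply: cvg_within_filter; rewrite -{2}[s]add0r.
    apply: cvgD; first exact: cvg_cst.
    by apply: cvgZr_tmp; apply: cvgD; [exact: cvg_id|exact: cvg_cst].
  have G := @C11_grad_at (x + s *: h) _ e1.
  have {}G := C _ G; near=> t.
  have t0 : t != 0 by near: t; exact: nbhs_dnbhs_neq.
  have : `|u (x + (t + s) *: h) - u (x + s *: h) -
      dotv (grad u (x + s *: h)) (x + (t + s) *: h - (x + s *: h))| <=
      e / (enorm h + 1) * enorm (x + (t + s) *: h - (x + s *: h)) by near: t.
  rewrite (_ : x + (t + s) *: h - (x + s *: h) = t *: h); last first.
    by apply/rowP => i; rewrite !mxE; ring.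
  rewrite dotvC dotvZl dotvC -/df enormZ => tb.
  rewrite -[X in `|X|]/(df - t^-1 * (u (x + (t * 1 + s) *: h) - u (x + s *: h))).
  rewrite mulr1 distrC.
  rewrite (_ : _ - df = t^-1 * (u (x + (t + s) *: h) - u (x + s *: h) - t * df)); last first.
    by field.
  rewrite normrM normfV ler_pdivrMl ?normr_gt0//.
  rewrite (le_trans tb)// mulrCA ler_wpM2l// mulrAC ler_pdivrMr//.
  by rewrite ler_pM2l// lerDl.
apply: DeriveDef; first by apply/cvg_ex; exists df.
exact/cvg_lim.
Unshelve. all: by end_near. Qed.

(** The mean value theorem along a segment that may leave Omega; this is what the extension of the
    Lipschitz bound to all of R^d is for. *)
Lemma C11_taylor K : (forall x y, enorm (grad u x - grad u y) <= K * enorm (x - y)) ->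
  forall x h, `|u (x + h) - u x - dotv (grad u x) h| <= K * enorm h ^+ 2.
Proof.
move=> gK x h.
have [|c] := @MVT R (fun s => u (x + s *: h)) (fun s => dotv (grad u (x + s *: h)) h)
  0 1 ltr01 (fun s _ => C11_derive_along x h s).
  apply: derivable_within_continuous => s _.
  exact: (@ex_derive _ _ _ _ _ _ _ (C11_derive_along x h s)).
rewrite in_itv/= => /andP[c0 c1]; rewrite scale1r scale0r addr0 subr0 mulr1 => ->.
have -> : dotv (grad u (x + c *: h)) h - dotv (grad u x) h =
    dotv (grad u (x + c *: h) - grad u x) h.
  by rewrite dotvBl.
rewrite (le_trans (dotv_le _ _))// expr2 mulrA ler_wpM2r ?enorm_ge0//.
rewrite (le_trans (gK _ _))// addrAC subrr add0r enormZ.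
have K0 : 0 <= K * enorm h.
  by have := gK (x + h) x; rewrite addrAC subrr add0r; exact: le_trans (enorm_ge0 _).
by rewrite mulrCA ler_piMl// gtr0_norm// ltW.
Qed.

End single.
End CompactlySupportedC11.

(** * Lebesgue measurability in time *)

Section LebesgueMeasurability.
Variable R : realType.
Local Notation leb := (@completed_lebesgue_measure R).
Implicit Types D : set (lebesgueR R).

Lemma borel_lebesgue_measurable (A : set R) :
  measurable (A : set (measurableTypeR R)) -> measurable (A : set (lebesgueR R)).
Proof. exact: sub_caratheodory. Qed.

Lemma itv_lebesgue_measurable (i : interval R) :
  measurable ([set` i] : set (lebesgueR R)).
Proof. by apply: borel_lebesgue_measurable; exact: measurable_itv. Qed.

Lemma leb01 : leb `[0, 1]%classic = 1%E.
Proof.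
by have := @lebesgue_measure_itv R `[0, 1]; rewrite /= lte_fin ltr01 oppr0 adde0.
Qed.

Lemma leb_set1 (x : R) : leb.-negligible [set x].
Proof.
exists [set x]; split => //; last exact: (lebesgue_measure_set1 x).
by rewrite -set_itv1; exact: itv_lebesgue_measurable.
Qed.

Lemma ae_measurable_fun_real D (f g : lebesgueR R -> R) :
  {ae leb, forall t, D t -> f t = g t} ->
  measurable_fun D f -> measurable_fun D g.
Proof.
move=> fg mf; apply/measurable_EFinP.
apply: (@ae_measurable_fun _ _ _ leb (@completed_lebesgue_measure_is_complete R) _
  (EFin \o f)); last exact/measurable_EFinP.
by apply: (@filterS _ _ (ae_filter_ringOfSetsType leb)) fg => t fgt Dt /=; rewrite fgt.
Qed.

(** The exceptional set is measurable by completeness of the measure, and multiplying by the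
    indicator of its complement turns a.e. convergence into convergence everywhere. *)
Lemma measurable_fun_cvg_ae D (f_ : nat -> lebesgueR R -> R) (f : lebesgueR R -> R) :
  (forall n, measurable_fun D (f_ n)) ->
  {ae leb, forall t, D t -> f_ n t @[n --> \oo] --> f t} -> measurable_fun D f.
Proof.
move=> mf aef.
set N := ~` [set t | D t -> f_ n t @[n --> \oo] --> f t].
have mN : measurable (N : set (lebesgueR R)).
  exact: completed_lebesgue_measure_is_complete.
apply: (@ae_measurable_fun_real _ (fun t => f t * \1_(~` N) t)).
  apply: (@filterS _ _ (ae_filter_ringOfSetsType leb)) aef => t ft Dt /=.
  by rewrite indicE mem_set ?mulr1// => Nt; apply: Nt.
apply: (@measurable_fun_cvg _ _ _ D (fun n t => f_ n t * \1_(~` N) t)) => [n|t Dt].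
  by apply: measurable_funM => //; apply: measurable_indic; exact: measurableC.
rewrite indicE; have [tN|tN] := pselect (N t).
  by rewrite memNset ?mulr0//; under eq_fun do rewrite mulr0; exact: cvg_cst.
rewrite mem_set// mulr1; under eq_fun do rewrite mulr1.
by move: tN => /contrapT; apply.
Qed.

(* Caratheodory functions are measurable along the diagonal: freeze the
   continuous variable on the mesh of width 1/(n+1). *)
Lemma measurable_fun_diag (Phi : R -> R -> R) :
  (forall s, s \in `[0, 1] ->
     measurable_fun (`]0, 1[%classic : set (lebesgueR R)) (Phi s)) ->
  {ae leb, forall t, t \in `]0, 1[ ->
     {within `[0, 1], continuous (fun s => Phi s t)}} ->
  measurable_fun (`]0, 1[%classic : set (lebesgueR R)) (fun t => Phi t t).
Proof.
move=> mPhi cPhi.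
pose mesh n (t : R) : R := (Num.truncn (t * n.+1%:R))%:R / n.+1%:R.
have mesh_le n t : 0 <= t -> 0 <= mesh n t <= t.
  move=> t0; rewrite /mesh divr_ge0//= ler_pdivrMr//.
  by have /andP[] := truncn_itv (mulr_ge0 t0 (ler0n R n.+1)).
have mesh_ge n t : 0 <= t -> t - mesh n t <= n.+1%:R^-1.
  move=> t0; have /andP[_ h] := truncn_itv (mulr_ge0 t0 (ler0n R n.+1)).
  rewrite -(@ler_pM2r _ n.+1%:R)// mulVf// mulrBl divfK//.
  by move: h; rewrite -natr1; lra.
apply: (@measurable_fun_cvg_ae _ (fun n t => Phi (mesh n t) t)) => [n|].
  pose B j : set (lebesgueR R) := `]0, 1[%classic `&` [set t | Num.truncn (t * n.+1%:R) = j].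
  have mB j : measurable (B j).
    rewrite /B (_ : _ `&` _ = `]0, 1[%classic `&`
        `[j%:R / n.+1%:R, j.+1%:R / n.+1%:R[%classic).
      by apply: measurableI; exact: itv_lebesgue_measurable.
    apply/seteqP; split=> t /= [t01] h; split=> //; move: t01 h;
      rewrite !in_itv/= => /andP[/ltW t0 _].
      move=> <-; have := truncn_itv (mulr_ge0 t0 (ler0n R n.+1)).
      by rewrite ler_pdivrMr// ltr_pdivlMr.
    rewrite ler_pdivrMr// ltr_pdivlMr// => h; apply/eqP.
    by rewrite truncn_eq// mulr_ge0.
  have -> : `]0, 1[%classic = \bigcup_j B j :> set (lebesgueR R).
    apply/seteqP; split => [t t01|t [j _ []]//].
    by exists (Num.truncn ((t : R) * n.+1%:R)).
  apply/(measurable_fun_bigcup _ mB) => j.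
  have [->|/set0P[t0 [t01 tj]]] := eqVneq (B j) set0; first exact: measurable_fun_set0.
  apply: (@eq_measurable_fun _ _ _ _ (B j) (Phi (mesh n t0))).
    by move=> t; rewrite inE => -[_ /= tj']; rewrite /mesh tj tj'.
  apply: measurable_funS (mPhi _ _).
  - exact: itv_lebesgue_measurable.
  - by move=> t [].
  move: t01; rewrite /= !in_itv/= => /andP[/ltW t00 /ltW t01].
  have /andP[-> h] := mesh_le n t0 t00.
  exact: le_trans t01.
apply: (@filterS _ _ (ae_filter_ringOfSetsType leb)) cPhi => t + t01.
move=> /(_ t01) /subspace_continuousP ct.
have /andP[t0 t1] : 0 < t < 1 by rewrite /= in_itv/= in t01.
have := ct t; rewrite /= in_itv/= !ltW// => /(_ isT) {}ct.
apply: (@cvg_comp _ _ _ (fun n => mesh n t) (Phi^~ t) _ _ _ _ ct).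
have mt : mesh n t @[n --> \oo] --> t.
  apply/cvgrPdist_le => e e0; near=> n.
  rewrite ger0_norm ?subr_ge0; last by have /andP[] := mesh_le n t (ltW t0).
  apply: le_trans (mesh_ge n t (ltW t0)) _; apply: ltW; near: n.
  exact: (near_infty_natSinv_lt (PosNum e0)).
move=> U; rewrite /within/= => tU.
have [N _ NU] : \forall n \near \oo, `[0, 1]%classic (mesh n t) -> U (mesh n t).
  exact: mt tU.
exists N => // n Nn; apply: (NU n Nn).
rewrite /= in_itv/=; have /andP[-> h] := mesh_le n t (ltW t0).
by rewrite (le_trans h)// ltW.
Unshelve. all: by end_near. Qed.

End LebesgueMeasurability.

Section CurveIntegrals.
Variables (R : realType) (d : nat).
Local Notation leb := (@completed_lebesgue_measure R).
Local Notation V := 'rV[R]_d.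
Local Notation H1 := (H1 R d).
Local Notation L01 := (`[0, 1]%classic : set (lebesgueR R)).

Lemma H1_continuous_vec (gamma : H1) : {within `[0, 1], continuous gamma}.
Proof.
apply/subspace_continuousP => s s01; apply/cvgrPdist_le => e e0.
set B := dirichlet gamma gamma.
have B1 : 0 < B + 1 by rewrite ltr_wpDl ?dirichlet_ge0.
have eB : 0 < e ^+ 2 / (B + 1) by rewrite divr_gt0 ?exprn_gt0.
have near_s : \forall t \near s, `|s - t| <= e ^+ 2 / (B + 1).
  apply/nbhs_ballP; exists (e ^+ 2 / (B + 1)) => //= t.
  by rewrite -ball_normE/=; exact: ltW.
apply: filterS near_s => t ts t01.
rewrite (le_trans (norm_le_enorm _))// -(@ler_pXn2r _ 2)// ?nnegrE ?enorm_ge0 ?(ltW e0)//.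
rewrite (le_trans (holder_curve_abs gamma s01 t01))//.
apply: (@le_trans _ _ (e ^+ 2 / (B + 1) * (B + 1))); last by rewrite divfK// gt_eqF.
by apply: ler_pM => //; [exact: dirichlet_ge0|rewrite lerDl].
Qed.

Lemma measurable_fun_lebesgue (D : set R) (f : R -> R) :
  measurable (D : set (measurableTypeR R)) ->
  measurable_fun (D : set (measurableTypeR R)) f ->
  measurable_fun (D : set (lebesgueR R)) f.
Proof. by move=> mD mf _ A mA; apply: borel_lebesgue_measurable; exact: mf. Qed.

Lemma measurable_fun_closed01 (f : lebesgueR R -> R) :
  measurable_fun (`]0, 1[%classic : set (lebesgueR R)) f -> measurable_fun L01 f.
Proof.
move=> mf.
have m1 (x : R) : measurable ([set x] : set (lebesgueR R)).
  by rewrite -set_itv1; exact: itv_lebesgue_measurable.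
have -> : L01 = `]0, 1[%classic `|` ([set 0] `|` [set 1]).
  apply/seteqP; split=> t /=; rewrite !in_itv/=.
    move=> /andP[]; rewrite !le_eqVlt => /predU1P[<-|t0]; first by right; left.
    by move=> /predU1P[->|t1]; [right; right|left; rewrite t0].
  by move=> [/andP[/ltW -> /ltW ->]//|[->|->]]; rewrite ?lexx ?ler01.
apply/measurable_funU => //; first exact: itv_lebesgue_measurable.
  exact: measurableU.
split => //; apply/measurable_funU => //.
by split; exact: measurable_fun_set1.
Qed.

Lemma measurable_fun_open01 (f : lebesgueR R -> R) :
  measurable_fun L01 f -> measurable_fun (`]0, 1[%classic : set (lebesgueR R)) f.
Proof.
apply: measurable_funS; first exact: itv_lebesgue_measurable.
by move=> t /=; rewrite !in_itv/= => /andP[/ltW -> /ltW ->].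
Qed.

Lemma H1_coord_measurable (gamma : H1) i : measurable_fun L01 (fun t => gamma t 0 i).
Proof.
apply: measurable_fun_lebesgue; first exact: measurable_itv.
exact: (@H1_vL2 _ _ gamma i).1.
Qed.

End CurveIntegrals.

(** * The potential energy along a curve *)

Section Potential.
Variables (R : realType) (d : nat) (Omega E : set 'rV[R]_d).
Local Notation V := 'rV[R]_d.
Local Notation S := (closure Omega).
Local Notation leb := (@completed_lebesgue_measure R).
Local Notation H1 := (H1 R d).
Local Notation L01 := (`[0, 1]%classic : set (lebesgueR R)).
Variables (w : R -> C11 S) (m : R -> R) (K : R).
Hypothesis oO : open Omega.
Hypothesis cE : compact E.
Hypothesis EO : E `<=` Omega.
Hypothesis wE : forall t, supp (w t) `<=` E.
Hypothesis gE : forall t, supp (grad (w t)) `<=` E.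
Hypothesis wm : forall t x, `|w t x| <= m t.
Hypothesis gm : forall t x, enorm (grad (w t) x) <= m t.
Hypothesis gK : forall t x y,
  enorm (grad (w t) x - grad (w t) y) <= K * m t * enorm (x - y).
Hypothesis mint : leb.-integrable L01 (EFin \o m).
Hypothesis wmeas : forall x, measurable_fun L01 (fun t => w t x).

Definition potential (gamma : H1) : R := \int[leb]_(t in L01) w t (gamma t).

(** The derivative of [potential] at [gamma] in the direction [h], as [potential_taylor] shows. *)
Definition force_work (gamma h : H1) : R :=
  \int[leb]_(t in L01) dotv (grad (w t) (gamma t)) (h t).

Definition total_mass : R := \int[leb]_(t in L01) m t.

Let mL01 : measurable L01.
Proof. exact: itv_lebesgue_measurable. Qed.

Let m_ge0 t : 0 <= m t.
Proof. exact: le_trans (normr_ge0 _) (wm t 0). Qed.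

Lemma total_mass_ge0 : 0 <= total_mass.
Proof. exact: Rintegral_ge0. Qed.

Let taylor t x h :
  `|w t (x + h) - w t x - dotv (grad (w t) x) h| <= K * m t * enorm h ^+ 2.
Proof. exact: (C11_taylor oO cE EO (@wE t) (@gE t) (gK t)). Qed.

Lemma dominated_integral (f : R -> R) c : measurable_fun L01 f -> 0 <= c ->
  (forall t, t \in `[0, 1] -> `|f t| <= c * m t) ->
  leb.-integrable L01 (EFin \o f) /\ `|\int[leb]_(t in L01) f t| <= c * total_mass.
Proof.
move=> mf c0 fc.
have icm : leb.-integrable L01 (EFin \o (fun t => c * m t)).
  rewrite (_ : _ \o _ = (fun t => c%:E * (m t)%:E)%E)//.
  exact: integrableZl.
have fi : leb.-integrable L01 (EFin \o f).
  apply: (@le_integrable _ _ _ leb L01 mL01 _ _ _ _ icm); first exact/measurable_EFinP.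
  move=> t t01; rewrite /= lee_fin (le_trans (fc t t01))// ler_norm//.
split => //; rewrite (le_trans (le_normr_Rintegral mL01 fi))//.
rewrite /total_mass -RintegralZl//; apply: le_Rintegral => //.
by rewrite (_ : _ \o _ = abse \o (EFin \o f))//; exact: integrable_abse.
Qed.

(** A pointwise limit of difference quotients of step 1/(n+1) along a basis vector; the Taylor bound
    gives the convergence. *)
Lemma grad_coord_measurable x i : measurable_fun L01 (fun t => grad (w t) x 0 i).
Proof.
pose e : V := delta_mx 0 i.
have de y : dotv y e = y 0 i.
  rewrite /dotv (bigD1 i)//= mxE !eqxx mulr1 big1 ?addr0// => j ji.
  by rewrite mxE (negbTE ji) andbF mulr0.
apply: (@measurable_fun_cvg _ _ _ L01
  (fun n t => n.+1%:R * (w t (x + n.+1%:R^-1 *: e) - w t x))) => [n|t _].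
  apply: measurable_funM; first exact: measurable_cst.
  by apply: measurable_funB; exact: wmeas.
apply/cvgrPdist_le => r r0; near=> n.
have nK : n.+1%:R^-1 <= r / (`|K * m t * enorm e ^+ 2| + 1).
  apply: ltW; near: n.
  have p0 : 0 < r / (`|K * m t * enorm e ^+ 2| + 1) by rewrite divr_gt0// ltr_wpDl.
  exact: (near_infty_natSinv_lt (PosNum p0)).
have := taylor t x (n.+1%:R^-1 *: e).
rewrite dotvC dotvZl dotvC de enormZ exprMn => tb.
have -> : grad (w t) x 0 i - n.+1%:R * (w t (x + n.+1%:R^-1 *: e) - w t x) =
    - (n.+1%:R * (w t (x + n.+1%:R^-1 *: e) - w t x - n.+1%:R^-1 * grad (w t) x 0 i)).
  by rewrite [in RHS]mulrBr mulVKf// opprB.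
rewrite normrN.
rewrite normrM ger0_norm//.
rewrite (le_trans (ler_wpM2l _ tb))// ger0_norm ?invr_ge0//.
have -> : n.+1%:R * (K * m t * (n.+1%:R^-1 ^+ 2 * enorm e ^+ 2)) =
    K * m t * enorm e ^+ 2 * n.+1%:R^-1.
  have : n.+1%:R != 0 :> R by [].
  by move: (n.+1%:R : R) => N N0; field.
rewrite (le_trans (ler_norm _))// normrM [X in _ * X]ger0_norm ?invr_ge0//.
rewrite (le_trans (ler_wpM2l _ nK))// mulrCA ger_pMr// ler_pdivrMr ?ltr_wpDl//.
by rewrite mul1r lerDl.
Unshelve. all: by end_near. Qed.

(** The diagonal of (s, t) |-> w t (gamma s), which is continuous in s because [w t] and [gamma]
    are. *)
Lemma potential_measurable (gamma : H1) : measurable_fun L01 (fun t => w t (gamma t)).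
Proof.
apply: measurable_fun_closed01.
apply: (@measurable_fun_diag R (fun s t => w t (gamma s))) => [s _|].
  by apply: measurable_fun_open01; exact: wmeas.
apply: (@aeW) => t _ s.
have cw : continuous (w t : V -> R).
  apply/continuous_subspace_setT; apply: (@grad_at_continuous R d _ _ (grad (w t))).
  move=> x _ e e0; have := C11_grad_at oO cE EO (@wE t) (@gE t) x e0.
  by apply: filterS => y.
by apply: continuous_comp; [exact: H1_continuous_vec|exact: cw].
Qed.

Lemma force_measurable (gamma : H1) i :
  measurable_fun L01 (fun t => grad (w t) (gamma t) 0 i).
Proof.
apply: measurable_fun_closed01.
apply: (@measurable_fun_diag R (fun s t => grad (w t) (gamma s) 0 i)) => [s _|].
  by apply: measurable_fun_open01; exact: grad_coord_measurable.
apply: (@aeW) => t _ s.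
have cg : continuous (fun x : V => grad (w t) x 0 i : R).
  move=> x; apply/(@cvgrPdist_le R R V (nbhs x) (nbhs_filter x)) => e e0.
  have k0 : 0 < `|K * m t| + 1 by rewrite ltr_wpDl.
  have nb := @enorm_ball R d x _ (divr_gt0 e0 k0).
  apply: filterS nb => y yx.
  have -> : grad (w t) x 0 i - grad (w t) y 0 i = (grad (w t) x - grad (w t) y) 0 i.
    by rewrite !mxE.
  rewrite (le_trans (coord_le_enorm _ _))// (le_trans (gK _ _ _))// enormB.
  apply: (@le_trans _ _ ((`|K * m t| + 1) * enorm (y - x))).
    by rewrite ler_wpM2r ?enorm_ge0// (le_trans (ler_norm _))// lerDl.
  by rewrite mulrC -ler_pdivlMr// ltW.
have cs := @H1_continuous_vec R d gamma s.
exact: (cvg_comp _ _ cs (cg (gamma s))).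
Qed.

Lemma force_work_measurable (gamma h : H1) :
  measurable_fun L01 (fun t => dotv (grad (w t) (gamma t)) (h t)).
Proof.
apply: measurable_sum => i; apply: measurable_funM; first exact: force_measurable.
exact: H1_coord_measurable.
Qed.

Let potential_bound (gamma : H1) : leb.-integrable L01 (EFin \o (fun t => w t (gamma t))) /\
  `|potential gamma| <= 1 * total_mass.
Proof.
apply: (dominated_integral (@potential_measurable gamma)) => // t _.
by rewrite mul1r.
Qed.

Lemma potential_le gamma : `|potential gamma| <= total_mass.
Proof. by have [_] := potential_bound gamma; rewrite mul1r. Qed.

Let potential_integrable (gamma : H1) :
  leb.-integrable L01 (EFin \o (fun t => w t (gamma t))).
Proof. by have [] := potential_bound gamma. Qed.

Let work_bound (gamma h : H1) c : (forall t, t \in `[0, 1] -> enorm (h t) <= c) ->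
  leb.-integrable L01 (EFin \o (fun t => dotv (grad (w t) (gamma t)) (h t))) /\
  `|force_work gamma h| <= c * total_mass.
Proof.
move=> hc; apply: dominated_integral; first exact: force_work_measurable.
  by apply: le_trans (enorm_ge0 _) (hc 0 _); rewrite in_itv/= lexx ler01.
move=> t t01; rewrite (le_trans (dotv_le _ _))// mulrC.
by rewrite ler_pM ?enorm_ge0// hc.
Qed.

Let work_integrable (gamma h : H1) :
  leb.-integrable L01 (EFin \o (fun t => dotv (grad (w t) (gamma t)) (h t))).
Proof. by have [] := @work_bound gamma h _ (fun t _ => enorm_curve_le h t). Qed.

Lemma force_work_le (gamma h : H1) c :
  (forall t, t \in `[0, 1] -> enorm (h t) <= c) ->
  `|force_work gamma h| <= c * total_mass.
Proof. by move=> hc; have [] := @work_bound gamma h c hc. Qed.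

Lemma potential_taylor (gamma h : H1) c : 0 <= K ->
  (forall t, t \in `[0, 1] -> enorm (h t) <= c) ->
  `|potential (gamma + h) - potential gamma - force_work gamma h| <=
  K * c ^+ 2 * total_mass.
Proof.
move=> K0 hc; rewrite /potential /force_work.
have c0 : 0 <= c.
  by apply: le_trans (enorm_ge0 _) (hc 0 _); rewrite in_itv/= lexx ler01.
have i1 : leb.-integrable L01
    (EFin \o (fun t => w t ((gamma + h) t) - w t (gamma t))).
  rewrite (_ : _ \o _ = ((EFin \o (fun t => w t ((gamma + h) t))%R) \-
    (EFin \o (fun t => w t (gamma t))%R))%E)//.
  exact: integrableB.
have -> : \int[leb]_(t in L01) w t ((gamma + h) t) - \int[leb]_(t in L01) w t (gamma t) =
    \int[leb]_(t in L01) (w t ((gamma + h) t) - w t (gamma t)).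
  by rewrite RintegralB.
rewrite -RintegralB//.
have [|||_] := @dominated_integral (fun t => w t ((gamma + h) t) - w t (gamma t) -
  dotv (grad (w t) (gamma t)) (h t)) (K * c ^+ 2); last by [].
- apply: measurable_funB; last exact: force_work_measurable.
  by apply: measurable_funB; exact: potential_measurable.
- by rewrite mulr_ge0// sqr_ge0.
- move=> t t01; rewrite -[(gamma + h) t]/(gamma t + h t) (le_trans (taylor _ _ _))//.
  rewrite mulrAC ler_wpM2r// ler_wpM2l// lerXn2r ?nnegrE ?enorm_ge0//.
  exact: hc.
Qed.

(** Only the uniform distance of the curves enters, so uniform convergence is enough to compare
    forces when the cluster point is constructed. *)
Lemma force_work_lipschitz (gamma eta h : H1) a c : 0 <= K ->
  (forall t, t \in `[0, 1] -> enorm (gamma t - eta t) <= a) ->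
  (forall t, t \in `[0, 1] -> enorm (h t) <= c) ->
  `|force_work gamma h - force_work eta h| <= K * a * c * total_mass.
Proof.
move=> K0 ga hc; rewrite /force_work -RintegralB//=.
have z01 : (0 : R) \in `[0, 1] by rewrite in_itv/= lexx ler01.
have c0 : 0 <= c by exact: le_trans (enorm_ge0 _) (hc 0 z01).
have a0 : 0 <= a by exact: le_trans (enorm_ge0 _) (ga 0 z01).
have [|||_] := @dominated_integral (fun t => dotv (grad (w t) (gamma t)) (h t) -
  dotv (grad (w t) (eta t)) (h t)) (K * a * c); last by [].
- by apply: measurable_funB; exact: force_work_measurable.
- by rewrite !mulr_ge0.
- move=> t t01.
  have -> : dotv (grad (w t) (gamma t)) (h t) - dotv (grad (w t) (eta t)) (h t) =
      dotv (grad (w t) (gamma t) - grad (w t) (eta t)) (h t).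
    by rewrite dotvBl.
  rewrite (le_trans (dotv_le _ _))// mulrAC ler_pM ?enorm_ge0 ?hc//.
  rewrite (le_trans (gK _ _ _))// mulrAC ler_wpM2r// ler_wpM2l//.
  exact: ga.
Qed.

Lemma force_work_linear gamma a g h :
  force_work gamma (a *: g + h) = a * force_work gamma g + force_work gamma h.
Proof.
rewrite /force_work -RintegralZl// -RintegralD//.
  apply: eq_Rintegral => t _.
  rewrite -[(a *: g + h) t]/(a *: g t + h t) dotvC dotvDl dotvZl.
  by rewrite ![dotv _ (grad _ _)]dotvC.
rewrite (_ : _ \o _ =
  (fun t => a%:E * (dotv (grad (w t) (gamma t)) (g t))%:E)%E)//.
by apply: integrableZl => //; exact: work_integrable.
Qed.

Lemma potential_out (gamma : H1) :
  (forall t, t \in `[0, 1] -> ~ E (gamma t)) -> potential gamma = 0.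
Proof.
move=> gO; rewrite /potential (@eq_Rintegral _ _ _ leb _ (fun=> 0)).
  by rewrite /Rintegral integral0.
by move=> t; rewrite inE => t01; exact: (C11_eq0_out (@wE t) (@gE t) (gO t t01)).1.
Qed.

Lemma force_work_out (gamma h : H1) :
  (forall t, t \in `[0, 1] -> h t = 0 \/ ~ E (gamma t)) -> force_work gamma h = 0.
Proof.
move=> gO; rewrite /force_work (@eq_Rintegral _ _ _ leb _ (fun=> 0)).
  by rewrite /Rintegral integral0.
move=> t; rewrite inE => t01; have [->|gt] := gO t t01.
  by rewrite dotvC dotv0l.
by rewrite (C11_eq0_out (@wE t) (@gE t) gt).2 dotv0l.
Qed.

End Potential.

(** * The uniform boundedness principle *)

(* Gliding hump (Sokal): continuous functions on a compact set are approached by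
   partial sums with steps [3^-n], so no Banach space of functions is needed. *)
Section UniformBoundedness.
Variables (R : realType) (X : topologicalType) (S : set X) (I : Type).
Variable T : I -> (X -> R) -> R.

Local Notation cont f := ({within S, continuous (f : X -> R)}).

Hypothesis T_linear : forall i a (f g : X -> R), cont f -> cont g ->
  T i (fun x => a * f x + g x) = a * T i f + T i g.
Hypothesis T_bounded : forall i, exists C, forall (f : X -> R) M, cont f -> 0 <= M ->
  (forall x, S x -> `|f x| <= M) -> `|T i f| <= C * M.
Hypothesis T_pointwise : forall f : X -> R, cont f -> exists M, forall i, `|T i f| <= M.

Let unit_ball : set (X -> R) := [set f | cont f /\ forall x, S x -> `|f x| <= 1].
Let N i := supon unit_ball (fun f => `|T i f|).

Let cont_linear a (f g : X -> R) : cont f -> cont g -> cont (fun x => a * f x + g x).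
Proof.
move=> cf cg x; apply: cvgD; last exact: cg.
by apply: cvgM; [exact: cvg_cst|exact: cf].
Qed.

Let cont0 : cont (fun=> 0).
Proof. by move=> x; exact: cst_continuous. Qed.

Let N_ub i : has_ubound [set `|T i f| | f in unit_ball].
Proof.
have [C HC] := T_bounded i; exists C => _ [f [cf f1] <-].
by have := HC f 1 cf ler01 f1; rewrite mulr1.
Qed.

Let T0 i : T i (fun=> 0) = 0.
Proof.
have := T_linear i 1 cont0 cont0.
rewrite (_ : (fun _ => _) = fun=> 0); last by apply/funext => x; rewrite mulr0 addr0.
by rewrite mul1r; lra.
Qed.

Let TZ i a (f : X -> R) : cont f -> T i (fun x => a * f x) = a * T i f.
Proof.
move=> cf; have := T_linear i a cf cont0; rewrite T0 addr0 => <-.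
by congr T; apply/funext => x; rewrite addr0.
Qed.

Let N_le i (f : X -> R) M : cont f -> 0 < M -> (forall x, S x -> `|f x| <= M) ->
  `|T i f| <= M * N i.
Proof.
move=> cf M0 fM.
have -> : f = fun x => M * (M^-1 * f x).
  by apply/funext => x; rewrite mulVKf// gt_eqF.
have cg : cont (fun x => M^-1 * f x).
  rewrite (_ : (fun _ => _) = fun x => M^-1 * f x + 0).
    exact: (@cont_linear M^-1 _ _ cf (@cont0)).
  by apply/funext => x; rewrite addr0.
rewrite TZ// normrM gtr0_norm// ler_wpM2l ?(ltW M0)//.
apply: (supon_ub (f := fun f => `|T i f|) (N_ub i)); split => // x Sx.
by rewrite normrM gtr0_norm ?invr_gt0// ler_pdivrMl// mulr1 fM.
Qed.

Lemma uniform_boundedness : exists B, forall i (f : X -> R), cont f ->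
  (forall x, S x -> `|f x| <= 1) -> `|T i f| <= B.
Proof.
apply: contrapT => nB.
have bigN B : 0 <= B -> exists ip : I * (X -> R),
    [/\ B < N ip.1, unit_ball ip.2 & 3 / 4 * N ip.1 <= `|T ip.1 ip.2|].
  move=> B0; have [i Ni] : exists i, B < N i.
    apply: contrapT => h; apply: nB; exists B => i f cf f1.
    rewrite leNgt; apply/negP => Bf; apply: h; exists i; apply: (lt_le_trans Bf).
    by apply: (supon_ub (f := fun f => `|T i f|) (N_ub i)); split.
  have Np : 0 < N i by exact: le_lt_trans Ni.
  have hs : has_sup [set `|T i f| | f in unit_ball].
    split; last exact: N_ub.
    exists `|T i (fun=> 0)|, (fun=> 0) => //; split => [|x _]; first exact: cont0.
    by rewrite normr0.
  have N4 : 0 < N i / 4 by rewrite divr_gt0.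
  have [_ [f uf <-] Nf] := sup_adherent N4 hs.
  exists (i, f); split => //=.
  by move: Nf; rewrite -/(supon unit_ball (fun f => `|T i f|)) -/(N i); lra.
(* The balance at stage n: on [phi n.+1] the functional has size at least (3/4) 3^-n N, while the
   tail, of size (3/2) 3^-(n+1) = 3^-n / 2, costs at most (1/2) 3^-n N. By this choice the quarter
   that is left is at least n. *)
pose B n : R := 4 * 3 ^+ n * n%:R.
have B0 n : 0 <= B n by rewrite !mulr_ge0// exprn_ge0.
have [c cP] := choice (fun n => bigN (B n) (B0 n)).
pose i n := (c n).1; pose psi n := (c n).2.
pose step n (f : X -> R) s : X -> R := fun x => s * 3^-1 ^+ n * psi n x + f x.
(* Since 2|a| <= |b + a| + |b - a|, one of the two signs keeps the new value at least as large as
   the contribution |a| of the step. *)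
pose sgn n f : R := if 3^-1 ^+ n * `|T (i n) (psi n)| <= `|T (i n) (step n f 1)| then 1 else -1.
pose phi := fix phi n : X -> R :=
  if n is k.+1 then step k (phi k) (sgn k (phi k)) else fun=> 0.
have cpsi n : cont (psi n) by have [_ [+ _] _] := cP n.
have cphi n : cont (phi n).
  elim: n => [|n IH]; first exact: cont0.
  exact: cont_linear.
have psi1 n x : S x -> `|psi n x| <= 1 by have [_ [_ +] _] := cP n; apply.
have sgn1 n f : `|sgn n f| = 1 by rewrite /sgn; case: ifP; rewrite ?normrN normr1.
have p3 n : 0 < 3^-1 ^+ n :> R by rewrite exprn_gt0// invr_gt0.
have Tphi n : 3^-1 ^+ n * `|T (i n) (psi n)| <= `|T (i n) (phi n.+1)|.
  rewrite /= /sgn; case: ifP => // /negbT; rewrite -ltNge.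
  rewrite !(T_linear _ _ (cpsi n) (cphi n)) mulN1r mul1r mulNr.
  set a := 3^-1 ^+ n * T _ _; set b := T _ _ => ab.
  have -> : 3^-1 ^+ n * `|T (i n) (psi n)| = `|a| by rewrite normrM gtr0_norm.
  have {}ab : `|a + b| < `|a| by rewrite normrM gtr0_norm.
  have := ler_normD (a + b) (a - b); rewrite (_ : a + b + (a - b) = 2 * a); last by ring.
  have -> : `|2 * a| = 2 * `|a| by rewrite normrM ger0_norm.
  have -> : - a + b = - (a - b) by ring.
  by rewrite normrN; move: ab; lra.
have tail m n x : S x -> (n <= m)%N -> `|phi m x - phi n x| <= 3 / 2 * (3^-1 ^+ n - 3^-1 ^+ m).
  move=> Sx; elim: m => [|m IH]; first by rewrite leqn0 => /eqP ->; rewrite !subrr normr0 mulr0.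
  rewrite leq_eqVlt => /predU1P[->|]; first by rewrite !subrr normr0 mulr0.
  rewrite ltnS => /IH {}IH; rewrite /= /step -addrA.
  rewrite (le_trans (ler_normD _ _))// !normrM sgn1 mul1r gtr0_norm//.
  have := ler_wpM2l (ltW (p3 m)) (psi1 m x Sx); rewrite mulr1 exprS.
  by move: IH; lra.
have tail0 m n x : S x -> (n <= m)%N -> `|phi m x - phi n x| <= 3 / 2 * 3^-1 ^+ n.
  move=> Sx nm; rewrite (le_trans (tail _ _ _ Sx nm))// ler_wpM2l//.
  by rewrite lerBlDr lerDl ltW.
have small (e : R) : 0 < e -> exists n, 3 / 2 * 3^-1 ^+ n <= e.
  move=> e0; have e1 : 0 < e * 2 / 3 by rewrite divr_gt0// mulr_gt0.
  have [n _ nP] := near_infty_natSinv_lt (PosNum e1).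
  exists n; have ne : n.+1%:R^-1 < e * 2 / 3 := nP n (leqnn n).
  have : 3^-1 ^+ n <= n.+1%:R^-1 :> R.
    by rewrite exprVn lef_pV2 ?posrE ?exprn_gt0// -natrX ler_nat ltn_expl.
  by move: (3^-1 ^+ n) (n.+1%:R^-1) ne => a b; lra.
have cvphi x : S x -> cvgn (phi ^~ x).
  move=> Sx; apply/cauchy_cvgP/cauchy_exP => e e0.
  have [n ne] := small (e / 2) (divr_gt0 e0 (ltr0n R 2)).
  exists (phi n x); exists n => // m /= nm; rewrite -ball_normE/= distrC.
  by rewrite (le_lt_trans (tail0 _ _ _ Sx nm))// (le_lt_trans ne)//; lra.
pose f x := limn (phi ^~ x).
have fphi n x : S x -> `|f x - phi n x| <= 3 / 2 * 3^-1 ^+ n.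
  move=> Sx; have cd : `|phi m x - phi n x| @[m --> \oo] --> `|f x - phi n x|.
    apply: cvg_norm; apply: cvgB; last exact: cvg_cst.
    exact: cvphi.
  rewrite -(cvg_lim (@Rhausdorff R) cd); apply: limr_le.
    by apply/cvg_ex; eexists; exact: cd.
  by exists n => // m /= nm; exact: tail0.
have cf : cont f.
  apply/subspace_continuousP => x Sx; apply/cvgrPdist_le => e e0.
  have e3 : 0 < e / 3 by rewrite divr_gt0.
  have [n ne] := small _ e3.
  have hn : \forall y \near x, S y -> `|phi n x - phi n y| <= e / 3.
    by have := cphi n; move/subspace_continuousP/(_ x Sx)/cvgrPdist_le/(_ _ e3).
  suff : \forall y \near x, S y -> `|f x - f y| <= e by [].
  apply: filterS hn => y hy Sy.
  have := hy Sy; have := fphi n x Sx; have := fphi n y Sy; move: ne.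
  move: (3 / 2 * _) (f x) (f y) (phi n x) (phi n y) => k a b u v.
  by rewrite !ler_norml => ? /andP[? ?] /andP[? ?] /andP[? ?]; apply/andP; split; lra.
have [M MP] := T_pointwise cf.
have key k : k%:R <= `|T (i k) f|.
  have [Nk _ NT] := cP k; rewrite -/(i k) -/(psi k) in Nk NT.
  have d3 : `|T (i k) (fun x => -1 * phi k.+1 x + f x)| <= 3 / 2 * 3^-1 ^+ k.+1 * N (i k).
    apply: N_le; first exact: cont_linear.
      by rewrite mulr_gt0.
    by move=> x Sx; rewrite mulN1r addrC fphi.
  rewrite (T_linear _ _ (cphi _) cf) mulN1r exprS in d3.
  have h1 := Tphi k; have h2 := ler_wpM2l (ltW (p3 k)) NT.
  have h3 : k%:R <= 3^-1 ^+ k * N (i k) / 4.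
    rewrite exprVn -mulrA ler_pdivlMl ?exprn_gt0//.
    by move: Nk; rewrite /B; move: (3 ^+ k) (k%:R) => a b; lra.
  have h4 := ler_normD (- T (i k) (phi k.+1) + T (i k) f) (- T (i k) f).
  rewrite addrK !normrN in h4.
  by move: (3^-1 ^+ k) h1 h2 h3 h4 d3 => q; lra.
have := key (Num.truncn `|M|).+1; have := MP (i (Num.truncn `|M|).+1).
have := truncnS_gt `|M|; have := ler_norm M.
by lra.
Qed.

End UniformBoundedness.

(** * Integration against signed measures *)

Section ChargeIntegral.
Variables (R : realType) (d : nat).
Local Notation V := 'rV[R]_d.
Implicit Types (S : set V) (phi : V -> R).

Lemma compact_within_bounded (T : topologicalType) (A : set T) (f : T -> R) :
  compact A -> {within A, continuous f} -> exists2 M, 0 <= M & forall x, A x -> `|f x| <= M.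
Proof.
move=> cA cf; have := compact_bounded (continuous_compact cf cA).
move=> [M [_ MP]]; exists (`|M| + 1); first by rewrite addr_ge0.
move=> x Ax; apply: (MP (`|M| + 1)); last by exists x.
by rewrite (le_lt_trans (ler_norm _))// ltrDl.
Qed.

Lemma within_continuous_integrable S phi (nu : {finite_measure set borelRd R d -> \bar R}) :
  compact S -> {within S, continuous phi} -> nu.-integrable (S : set (borelRd R d)) (EFin \o phi).
Proof.
move=> cS cphi; have clS : closed S by exact: compact_closed.
have [M M0 phiM] := compact_within_bounded cS cphi.
apply: measurable_bounded_integrable => //.
- exact: measurable_closed.
- by rewrite ltey_eq fin_num_measure//; exact: measurable_closed.
- exact: within_continuous_measurable.
- exists M; split; first exact: num_real.
  by move=> K MK x Sx; apply: le_trans (ltW MK); exact: phiM.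
Qed.

Lemma charge_integral_linear S (nu : {charge set borelRd R d -> \bar R}) a phi psi :
  compact S -> {within S, continuous phi} -> {within S, continuous psi} ->
  charge_integral nu S (fun x => a * phi x + psi x) =
  a * charge_integral nu S phi + charge_integral nu S psi.
Proof.
move=> cS cphi cpsi; have mS : measurable (S : set (borelRd R d)).
  by apply: measurable_closed; exact: compact_closed.
rewrite /charge_integral.
have H (mu : {finite_measure set borelRd R d -> \bar R}) :
    \int[mu]_(x in S) (a * phi x + psi x) =
    a * \int[mu]_(x in S) phi x + \int[mu]_(x in S) psi x.
  have i1 := within_continuous_integrable mu cS cphi.
  rewrite RintegralD//; last exact: within_continuous_integrable.
    by rewrite RintegralZl.
  rewrite (_ : _ \o _ = (fun x => a%:E * (phi x)%:E)%E)//.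
  exact: integrableZl.
by rewrite !H; ring.
Qed.

Lemma charge_integral_bounded S (nu : {charge set borelRd R d -> \bar R}) :
  compact S -> exists C, forall phi M, {within S, continuous phi} -> 0 <= M ->
  (forall x, S x -> `|phi x| <= M) -> `|charge_integral nu S phi| <= C * M.
Proof.
move=> cS; have mS : measurable (S : set (borelRd R d)).
  by apply: measurable_closed; exact: compact_closed.
have H (mu : {finite_measure set borelRd R d -> \bar R}) phi M :
    {within S, continuous phi} -> (forall x, S x -> `|phi x| <= M) ->
    `|\int[mu]_(x in S) phi x| <= fine (mu S) * M.
  move=> cphi phiM; have i1 := within_continuous_integrable mu cS cphi.
  rewrite (le_trans (le_normr_Rintegral mS i1))// mulrC.
  rewrite -Rintegral_cst//; apply: le_Rintegral => //.
  - exact: integrable_norm.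
  - exact: finite_measure_integrable_cst.
rewrite /charge_integral.
set mu1 := jordan_pos _; set mu2 := jordan_neg _.
exists (fine (mu1 S) + fine (mu2 S)) => phi M cphi M0 phiM.
rewrite (le_trans (ler_normB _ _))//.
by rewrite mulrDl; apply: lerD; exact: H.
Qed.

(** Every Hahn decomposition of the Dirac mass has x in its positive set, so whichever one
    [charge_integral] picks, the Jordan parts are the Dirac mass and zero. *)
Lemma dirac_borel_measure S (x : V) : closed S -> S x ->
  exists nu : borel_measure S, forall u : C11 S, charge_integral nu S u = u x.
Proof.
move=> clS Sx; have mS := measurable_closed clS.
pose delta : {finite_measure set borelRd R d -> \bar R} := dirac (x : borelRd R d).
pose nu : {charge set borelRd R d -> \bar R} := charge_of_finite_measure delta.
have nuS (A : set (borelRd R d)) : measurable A -> A `&` S = set0 -> nu A = 0%E.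
  move=> mA AS; rewrite -[LHS]/((\1_A x)%:E) indicE memNset// => Ax.
  by have : (A `&` S) x by []; rewrite AS.
exists (BorelMeasure nuS) => u.
have nuE (A : set (borelRd R d)) : BorelMeasure nuS A = (\1_A x)%:E by [].
move: (BorelMeasure nuS) nuE => nu' nuE.
suff H P N (nuPN : hahn_decomposition nu' P N) :
    \int[jordan_pos nuPN]_(y in S) u y - \int[jordan_neg nuPN]_(y in S) u y = u x.
  exact: H.
have [[mP _] [mN negN] PNT PN0] := nuPN.
have xN : ~ N x.
  move=> Nx; have := negN N mN (@subset_refl _ _).
  by rewrite nuE indicE mem_set// lee_fin ler10.
have xP : P x by have : [set: V] x by []; rewrite -PNT => -[].
have posE (A : set (borelRd R d)) : measurable A -> A `<=` S -> jordan_pos nuPN A = delta A.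
  move=> mA _; rewrite jordan_posE cjordan_posE /crestr0 mem_set//= /crestr nuE.
  by rewrite -[RHS]/((\1_A x)%:E) !indicE in_setI (mem_set xP) andbT.
have negE (A : set (borelRd R d)) : measurable A -> A `<=` S -> jordan_neg nuPN A = mzero A.
  move=> mA _; rewrite jordan_negE cjordan_negE /crestr0 mem_set//= /crestr nuE.
  by rewrite !indicE in_setI (memNset xN) andbF oppe0.
have negI : (\int[jordan_neg nuPN]_(y in S) (u y)%:E = 0)%E.
  by rewrite -(@integral_measure_zero _ (borelRd R d) R S (EFin \o u)); exact: eq_measure_integral.
have posI : (\int[jordan_pos nuPN]_(y in S) (u y)%:E = (u x)%:E)%E.
  transitivity (\int[delta]_(y in S) (u y)%:E)%E; first exact: eq_measure_integral.
  rewrite integral_dirac//; first by rewrite diracE mem_set// mul1e.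
  apply/measurable_EFinP; apply: within_continuous_measurable => //.
  by have [_ ug _ _ _] := C11P u; exact: grad_at_continuous ug.
transitivity (fine (u x)%:E - fine (0 : \bar R)); last by rewrite /= subr0.
congr (fine _ - fine _); first exact: posI.
exact: negI.
Qed.

Lemma closure_bounded_compact (Omega : set V) : bounded_set Omega -> compact (closure Omega).
Proof.
move=> bO; apply: bounded_closed_compact; last exact: closed_closure.
move: bO => [M [Mr MP]]; exists (M + 1); split; first exact: num_real.
move=> r Mr' x Ox /=; have r1 : M < r - 1 by rewrite ltrBrDr.
have [y [/= Oy]] := Ox _ (nbhsx_ballx x 1 ltr01).
rewrite -ball_normE/= => xy.
have := MP _ r1 y Oy => /= yr; rewrite -(subrK y x).
by rewrite (le_trans (ler_normD _ _))//; lra.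
Qed.

(** For each test function, narrow continuity on the compact interval gives a bound in t. The unit
    ball of C^{1,1} lies in that of the continuous functions, so the uniform bound passes to the
    dual norm. *)
Lemma measure_dual_bounded (Omega : set V) (rho : R -> borel_measure (closure Omega)) :
  compact (closure Omega) -> narrowly_continuous rho ->
  exists B, forall t, t \in `[0, 1] -> `|measure_dual (rho t)| <= B.
Proof.
move=> cS rho_c; set S := closure Omega in cS *.
pose T (i : {t : R | t \in `[0, 1]}) phi := charge_integral (rho (sval i)) S phi.
have [|i|f cf|B HB] := @uniform_boundedness R V S _ T.
- by move=> i a f g cf cg; exact: charge_integral_linear.
- exact: charge_integral_bounded.
- have [M _ MP] := compact_within_bounded (@segment_compact R 0 1) (rho_c f cf).
  by exists M => -[t t01]; exact: MP.
exists `|B| => t t01; apply: dual_norm_le => // u u1.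
apply: le_trans (ler_norm B).
apply: (HB (exist _ t t01)).
  by have [_ ug _ _ _] := C11P u; exact: grad_at_continuous ug.
by move=> x Sx; rewrite (le_trans (C11_norm_ge u x)).
Qed.

End ChargeIntegral.

(** * Measurable fields of Hilbert spaces *)

Section HilbertField.
Variables (R : realType) (H : R -> hilbert R) (D : completeNormedModType R).
Variable i : forall t, D -> H t.
Local Notation leb := (@completed_lebesgue_measure R).
Local Notation O01 := (`]0, 1[%classic : set (lebesgueR R)).

Lemma ip_le (X : hilbert R) (x y : X) : `|ip x y| <= `|x| * `|y|.
Proof.
rewrite -[leRHS]ger0_norm ?mulr_ge0// -!sqrtr_sqr.
apply: ler_wsqrtr; rewrite exprMn -!ipE.
apply: (psd_CauchySchwarz (@ipC R X) (@ipDl R X) (@ipZl R X)) => z.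
by rewrite ipE sqr_ge0.
Qed.

Lemma ipDr (X : hilbert R) (x y z : X) : ip z (x + y) = ip z x + ip z y.
Proof. by rewrite ipC ipDl ![ip _ z]ipC. Qed.

Lemma ipZr (X : hilbert R) a (x z : X) : ip z (a *: x) = a * ip z x.
Proof. by rewrite ipC ipZl [ip x z]ipC. Qed.

Lemma ipBr (X : hilbert R) (x y z : X) : ip z (x - y) = ip z x - ip z y.
Proof. by rewrite -scaleN1r ipDr ipZr mulN1r. Qed.

Lemma ip0l (X : hilbert R) (z : X) : ip 0 z = 0.
Proof. by rewrite -(scale0r z) ipZl mul0r. Qed.

Lemma ip_suml (X : hilbert R) n (F : 'I_n -> X) z :
  ip (\sum_j F j) z = \sum_j ip (F j) z.
Proof.
by elim/big_rec2 : _ => [|j x y _ <-]; rewrite ?ip0l ?ipDl.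
Qed.

Hypothesis ip_meas : forall phi psi, measurable_fun O01 (fun t => ip (i t phi) (i t psi)).

Lemma step_function_ip_measurable (s r : forall t, H t) :
  step_function i s -> step_function i r ->
  measurable_fun O01 (fun t => ip (s t) (r t)).
Proof.
move=> [n [A [phi [mA sE]]]] [k [B [psi [mB rE]]]].
rewrite (_ : (fun _ => _) = fun t => \sum_(j < n) \sum_(l < k)
    (\1_(A j) t * \1_(B l) t * ip (i t (phi j)) (i t (psi l)))).
  apply: measurable_sum => j; apply: measurable_sum => l.
  apply: measurable_funM; last exact: ip_meas.
  by apply: measurable_funM; exact: measurable_indic.
apply/funext => t; rewrite sE rE ip_suml; apply: eq_bigr => j _.
rewrite ipZl ipC ip_suml mulr_sumr; apply: eq_bigr => l _.
by rewrite ipZl ipC mulrA.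
Qed.

(** The spaces H_t vary with t, so measurability is expressed through scalars: (H3) settles step
    functions, and inner products pass to the a.e. limit. *)
Lemma strongly_measurable_ip (f g : forall t, H t) :
  strongly_measurable i f -> strongly_measurable i g ->
  measurable_fun O01 (fun t => ip (f t) (g t)).
Proof.
move=> [s [ss sf]] [r [rr rg]].
apply: (@measurable_fun_cvg_ae _ _ (fun n t => ip (s n t) (r n t))) => [n|].
  exact: step_function_ip_measurable.
apply: (@filterS2 _ _ (ae_filter_ringOfSetsType leb)) sf rg => t + + t01.
move=> /(_ t01) sf /(_ t01) rg.
(* Written this way, each of the three errors has a factor that tends to 0 and none that is only
   known through [s] or [r], so Cauchy-Schwarz suffices. *)
have E n : ip (s n t) (r n t) = ip (f t) (g t) -
    (ip (f t - s n t) (g t) + (ip (f t) (g t - r n t) - ip (f t - s n t) (g t - r n t))).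
  by rewrite !ipBr ![ip (f t - s n t) _]ipC !ipBr ![ip _ (s n t)]ipC ![ip _ (f t)]ipC; ring.
have d0 (u : nat -> R) (v : nat -> R) : (forall n, `|u n| <= v n) ->
    v n @[n --> \oo] --> 0 -> u n @[n --> \oo] --> 0.
  move=> uv v0; apply/norm_cvg0P.
  apply: (@squeeze_cvgr _ _ _ _ (fun=> 0) v) => //; last exact: cvg_cst.
  by apply: nearW => n; rewrite normr_ge0 uv.
have c1 : ip (f t - s n t) (g t) @[n --> \oo] --> (0 : R).
  apply: (d0 _ (fun n => `|f t - s n t| * `|g t|)) => [n|]; first exact: ip_le.
  by rewrite -(mul0r `|g t|); apply: cvgM => //; exact: cvg_cst.
have c2 : ip (f t) (g t - r n t) @[n --> \oo] --> (0 : R).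
  apply: (d0 _ (fun n => `|f t| * `|g t - r n t|)) => [n|]; first exact: ip_le.
  by rewrite -(mulr0 `|f t|); apply: cvgM => //; exact: cvg_cst.
have c3 : ip (f t - s n t) (g t - r n t) @[n --> \oo] --> (0 : R).
  apply: (d0 _ (fun n => `|f t - s n t| * `|g t - r n t|)) => [n|]; first exact: ip_le.
  by rewrite -(mulr0 (0 : R)); exact: cvgM.
have -> : ip (f t) (g t) = ip (f t) (g t) - (0 + (0 - 0)) by rewrite subr0 addr0 subr0.
rewrite (funext E); apply: cvgB; first exact: cvg_cst.
by apply: cvgD => //; exact: cvgB.
Qed.

End HilbertField.

(** * Bounds on the pre-adjoint *)

Section PreAdjoint.
Variables (R : realType) (d : nat) (S : set 'rV[R]_d).
Local Notation V := 'rV[R]_d.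

Lemma C11_lip_le (u : C11 S) x y : S x -> S y ->
  enorm (grad u x - grad u y) <= `|u| * enorm (x - y).
Proof.
move=> Sx Sy; have [_ _ u1 u2 u3] := C11P u.
have [xy|xy] := eqVneq (enorm (x - y)) 0.
  have /eqP : x - y = 0 by exact: enorm_eq0.
  by rewrite subr_eq0 => /eqP ->; rewrite !subrr enorm0 mulr0.
rewrite -ler_pdivrMr; last by rewrite lt_neqAle eq_sym xy enorm_ge0.
apply: le_trans (_ : supon (S `*` S) (lip_quot (grad u)) <= _).
  by apply: (supon_ub (x := (x, y)) u3).
rewrite -[leRHS]/(C11_norm u) /C11_norm lerDr addr_ge0//.
  by apply: (supon_ge0 u1) => z; exact: normr_ge0.
by apply: (supon_ge0 u2) => z; exact: enorm_ge0.
Qed.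

Variables (X : hilbert R) (Kstar : dual (C11 S) -> X) (K : X -> C11 S) (C : R).
Hypothesis C0 : 0 <= C.
Hypothesis adj : forall l h, ip (Kstar l) h = l (K h).
Hypothesis Kbd : forall l, `|Kstar l| <= C * `|l|.

Let dual_K_le (l : dual (C11 S)) h M : `|l| <= M -> `|l (K h)| <= M * (C * `|h|).
Proof.
move=> lM; rewrite -adj (le_trans (ip_le _ _))// mulrA [M * C]mulrC.
by rewrite ler_wpM2r// (le_trans (Kbd l))// ler_wpM2l.
Qed.

(** The size of [K h] is read off from the bound on [Kstar] through explicit functionals; here
    evaluation at x, of norm at most 1 on C^{1,1}. *)
Lemma preadjoint_fun_le h x : `|K h x| <= C * `|h|.
Proof.
have [|u|l [lE lM]] := @dual_of_bounded R (C11 S) (fun u => u x : R) 1 ler01.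
- by [].
- by rewrite mul1r; exact: C11_norm_ge.
by have := dual_K_le h lM; rewrite lE mul1r.
Qed.

(** The functional pairs gradients at x with the very vector v to be bounded. Its norm is at most
    |v|, and one factor |v| cancels. The Lipschitz bound follows the same pattern with a difference
    of gradients. *)
Lemma preadjoint_grad_le h x : enorm (grad (K h) x) <= C * `|h|.
Proof.
set v := grad (K h) x.
have [||u|l [lE lM]] := @dual_of_bounded R (C11 S) (fun u => dotv (grad u x) v : R) (enorm v).
- exact: enorm_ge0.
- move=> a u w; rewrite -[grad (a *: u + w) x]/(a *: grad u x + grad w x).
  by rewrite dotvDl dotvZl.
- rewrite (le_trans (dotv_le _ _))// mulrC ler_wpM2l ?enorm_ge0//.
  exact: C11_norm_grad_ge.
have := dual_K_le h lM; rewrite lE -enorm_sqr ger0_norm ?sqr_ge0// expr2.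
have [->|v0] := eqVneq (enorm v) 0; first by rewrite mulr_ge0.
by rewrite ler_pM2l// lt_neqAle eq_sym v0 enorm_ge0.
Qed.

Lemma preadjoint_lip_le h x y : S x -> S y ->
  enorm (grad (K h) x - grad (K h) y) <= C * `|h| * enorm (x - y).
Proof.
move=> Sx Sy; set v := grad (K h) x - grad (K h) y.
have [||u|l [lE lM]] := @dual_of_bounded R (C11 S)
  (fun u => dotv (grad u x - grad u y) v : R) (enorm v * enorm (x - y)).
- by rewrite mulr_ge0 ?enorm_ge0.
- move=> a u w; rewrite -[grad (a *: u + w) x]/(a *: grad u x + grad w x).
  rewrite -[grad (a *: u + w) y]/(a *: grad u y + grad w y).
  rewrite -[RHS]/(a * dotv (grad u x - grad u y) v + dotv (grad w x - grad w y) v).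
  by rewrite -dotvZl -dotvDl scalerBr opprD addrACA.
- rewrite (le_trans (dotv_le _ _))// mulrC -mulrA ler_wpM2l ?enorm_ge0// mulrC.
  exact: C11_lip_le.
have := dual_K_le h lM; rewrite lE -/v -enorm_sqr ger0_norm ?sqr_ge0// expr2.
have [->|v0] := eqVneq (enorm v) 0; first by rewrite !mulr_ge0 ?enorm_ge0.
rewrite -[enorm v * _ * _]mulrA ler_pM2l; first by rewrite mulrC.
by rewrite lt_neqAle eq_sym v0 enorm_ge0.
Qed.

End PreAdjoint.

(** * Reduction of the curve functional to a potential *)

Section CurveFunctionalPotential.
Variables (R : realType) (d : nat) (Omega E : set 'rV[R]_d).
Local Notation S := (closure Omega).
Local Notation leb := (@completed_lebesgue_measure R).
Local Notation L01 := (`[0, 1]%classic : set (lebesgueR R)).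
Local Notation O01 := (`]0, 1[%classic : set (lebesgueR R)).
Variables (H : R -> hilbert R) (D : completeNormedModType R) (i : forall t, D -> H t).
Variables (Kstar : forall t, dual (C11 S) -> H t) (K : forall t, H t -> C11 S).
Variables (rho : R -> borel_measure S) (f : forall t, H t).
Hypothesis bO : bounded_set Omega.
Hypothesis hypH : hypothesis_H i.
Hypothesis hypF : hypothesis_F i Kstar K E.
Hypothesis rho_c : narrowly_continuous rho.
Hypothesis f_L2 : L2_H i f.

Lemma ae_open01 : {ae leb, forall t, `[0, 1]%classic t -> t \in `]0, 1[}.
Proof.
have n01 := negligibleU (leb_set1 (0 : R)) (leb_set1 (1 : R)).
apply: negligibleS n01 => t /= h.
apply: contrapT => /not_orP[t0 t1]; apply: h; rewrite !in_itv/= => /andP[t0' t1'].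
rewrite !lt_neqAle t0' t1' !andbT; apply/andP; split; apply/eqP => tE.
- by apply: t0.
- by apply: t1.
Qed.

Let residual t := Kstar t (measure_dual (rho t)) - f t.

Lemma potential_data : exists (w : R -> C11 S) (m : R -> R),
  [/\ forall t, supp (w t) `<=` E /\ supp (grad (w t)) `<=` E,
      [/\ forall t x, `|w t x| <= m t,
          forall t x, enorm (grad (w t) x) <= m t &
          forall t x y, S x -> S y ->
            enorm (grad (w t) x - grad (w t) y) <= m t * enorm (x - y)],
      leb.-integrable L01 (EFin \o m),
      forall x, measurable_fun L01 (fun t => w t x) &
      {ae leb, forall t, t \in `]0, 1[ -> w t = - K (residual t)}].
Proof.
have [_ _ _ ip_meas] := hypH.
have [Klin [adj [C KC] Kmeas [_ _ _ Ksupp]]] := hypF.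
have [f_meas f_int] := f_L2.
have cS := closure_bounded_compact bO.
have [B rhoB] := measure_dual_bounded cS rho_c.
have clS : closed S by exact: closed_closure.
pose good t := [/\ t \in `]0, 1[, (forall l h, ip (Kstar t l) h = l (K h)),
  (forall l, `|Kstar t l| <= `|C| * `|l|) &
  (forall h : H t, supp (K h) `<=` E /\ supp (grad (K h)) `<=` E)].
have ae_good : {ae leb, forall t, t \in `]0, 1[ -> good t}.
  apply: (@filterS3 _ _ (ae_filter_ringOfSetsType leb)) adj KC Ksupp => t.
  move=> adj KC Ks t01; split => //; [by case: (adj t01)| |exact: Ks].
  by move=> l; rewrite (le_trans (KC t01 l))// ler_wpM2r// ler_norm.
(* Setting [w t] to 0 at the exceptional times makes the support and norm bounds hold for every t,
   and changes integrands on a null set only. *)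
pose w t : C11 S := if `[<good t>] then - K (residual t) else 0.
(* The residual is at most |C| |B| + |f t|, and |f t| <= 1 + |f t|^2 turns square integrability of f
   into integrability of m. *)
pose m t := `|C| * (`|C| * `|B| + 1) + `|C| * `|f t| ^+ 2.
have m0 t : 0 <= m t by rewrite addr_ge0 ?mulr_ge0 ?addr_ge0 ?mulr_ge0.
have res_m t : good t -> `|C| * `|residual t| <= m t.
  move=> [t01 _ KCt _]; rewrite /m -mulrDr ler_wpM2l//.
  rewrite (le_trans (ler_normB _ _))// -addrA lerD//.
    rewrite (le_trans (KCt _))// ler_wpM2l// (le_trans (rhoB t _)) ?ler_norm//.
    by move: t01; rewrite !in_itv/= => /andP[/ltW -> /ltW ->].
  by have := sqr_ge0 (`|f t| - 1); have := normr_ge0 (f t); nra.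
have wz x : (0 : C11 S) x = 0 by [].
have gz x : grad (0 : C11 S) x = 0 by [].
have wN h x : (- h : C11 S) x = - h x by [].
have gN (h : C11 S) x : grad (- h) x = - grad h x by [].
have enormN (x : 'rV[R]_d) : enorm (- x) = enorm x.
  by rewrite -scaleN1r enormZ normrN1 mul1r.
exists w, m; split.
- move=> t; rewrite /w; case: asboolP => [[_ _ _ Ks]|_].
    have [k1 k2] := Ks (residual t); split.
      apply: subset_trans k1; apply: closure_subset => x /=.
      by rewrite wN oppr_eq0.
    apply: subset_trans k2; apply: closure_subset => x /=.
    by rewrite gN oppr_eq0.
  have s0 (V : nmodType) (u : 'rV[R]_d -> V) : (forall x, u x = 0) -> supp u `<=` E.
    move=> u0; rewrite /supp (_ : [set x | u x != 0] = set0) ?closure0//.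
    by apply/seteqP; split => x //=; rewrite u0 eqxx.
  by split; apply: s0.
- split=> [t x|t x|t x y Sx Sy]; rewrite /w; case: asboolP => [gt|_].
  + rewrite wN normrN; have [_ adjt Kt _] := gt.
    by rewrite (le_trans (preadjoint_fun_le _ adjt Kt _ _)) ?res_m.
  + by rewrite wz normr0.
  + rewrite gN enormN; have [_ adjt Kt _] := gt.
    by rewrite (le_trans (preadjoint_grad_le _ adjt Kt _ _)) ?res_m.
  + by rewrite gz enorm0.
  + rewrite !gN -opprD enormN; have [_ adjt Kt _] := gt.
    rewrite (le_trans (preadjoint_lip_le _ adjt Kt _ Sx Sy))//.
    by rewrite ler_wpM2r ?enorm_ge0// res_m.
  + by rewrite !gz subrr enorm0 mulr_ge0 ?enorm_ge0.
- have mf2 : measurable_fun L01 (fun t => `|f t| ^+ 2).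
    apply: measurable_fun_closed01.
    have := strongly_measurable_ip ip_meas f_meas f_meas.
    by apply: eq_measurable_fun => t _; rewrite ipE.
  have if2 : leb.-integrable L01 (EFin \o (fun t => `|f t| ^+ 2)).
    apply/integrableP; split; first exact/measurable_EFinP.
    under eq_integral do rewrite /= ger0_norm ?sqr_ge0//.
    exact: f_int.
  have mL01 : measurable L01 by exact: itv_lebesgue_measurable.
  rewrite (_ : EFin \o m = (fun t => (`|C| * (`|C| * `|B| + 1))%:E +
    `|C|%:E * (`|f t| ^+ 2)%:E)%E)//.
  apply: integrableD => //.
    have l01 : (leb L01 < +oo)%E by have := leb01 R => ->; exact: ltry.
    apply: measurable_bounded_integrable => //.
    exists (`|C| * (`|C| * `|B| + 1)); split; first exact: num_real.
    move=> r rC x _; rewrite /= ger0_norm; first exact: ltW.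
    by rewrite mulr_ge0// addr_ge0// mulr_ge0.
  exact: integrableZl.
- move=> x; have [Sx|Sx] := pselect (S x); last first.
    rewrite (_ : (fun _ => _) = fun=> 0); first exact: measurable_cst.
    by apply/funext => t; have [+ _ _ _ _] := C11P (w t); move=> /(_ x Sx)[].
  have [nu nuE] := dirac_borel_measure clS Sx.
  (* With [nu] the Dirac mass at x, the adjoint relation expresses w t x as minus the inner product
     of K_t^* nu with the residual, which brings in the strongly measurable fields. *)
  apply: (@ae_measurable_fun_real _ _ (fun t =>
    - (ip (Kstar t (measure_dual nu)) (Kstar t (measure_dual (rho t))) -
       ip (Kstar t (measure_dual nu)) (f t)))).
    apply: (@filterS2 _ _ (ae_filter_ringOfSetsType leb)) ae_open01 ae_good => t o01 gt t01.
    have {}gt := gt (o01 t01); rewrite /w asboolT// wN -ipBr.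
    have [_ adjt _ _] := gt; rewrite adjt.
    by rewrite -[measure_dual nu _]/(charge_integral nu S _) nuE.
  apply: measurable_fun_closed01; apply: measurable_funN.
  apply: measurable_funB; last exact: strongly_measurable_ip.
  (* (F3) applies to rho_s with s frozen. In s the inner product is the integral of the fixed
     function K_t K_t^* nu against rho_s, hence continuous by narrow continuity. *)
  apply: (@measurable_fun_diag R (fun s t =>
    ip (Kstar t (measure_dual nu)) (Kstar t (measure_dual (rho s))))) => [s s01|].
    exact: strongly_measurable_ip.
  apply: (@filterS _ _ (ae_filter_ringOfSetsType leb)) ae_good => t gt t01.
  have [_ adjt _ _] := gt t01.
  rewrite (_ : (fun s => _) = fun s => charge_integral (rho s) S
    (K (Kstar t (measure_dual nu)))).
    apply: rho_c; have [_ ug _ _ _] := C11P (K (Kstar t (measure_dual nu))).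
    exact: grad_at_continuous ug.
  by apply/funext => s; rewrite ipC adjt.
- apply: (@filterS _ _ (ae_filter_ringOfSetsType leb)) ae_good => t gt t01.
  by rewrite /w asboolT//; exact: gt.
Qed.

Lemma curve_functionalE (w : R -> C11 S) alpha beta (gamma : H1 R d) :
  {ae leb, forall t, t \in `]0, 1[ -> w t = - K (residual t)} ->
  measurable_fun L01 (fun t => w t (gamma t)) ->
  curve_functional Kstar K alpha beta rho f gamma =
  - potential w gamma / (beta / 2 * dirichlet gamma gamma + alpha).
Proof.
move=> wE mw; rewrite /curve_functional.
have wfE : {ae leb, forall t, L01 t -> w t (gamma t) = wfun Kstar K rho f t (gamma t)}.
  apply: (@filterS2 _ _ (ae_filter_ringOfSetsType leb)) wE ae_open01 => t wt o01 t01.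
  rewrite /wfun -/(residual t) -wt ?o01//; case: ifPn => // gS.
  by have [+ _ _ _ _] := C11P (w t); move=> /(_ (gamma t))[//|]; move/negP : gS; rewrite inE.
congr (- _ / (_ * _ + _)).
  have mL01 : measurable L01 by exact: itv_lebesgue_measurable.
  apply/esym; congr fine; apply: (@ae_eq_integral _ _ _ leb L01 _ _ mL01).
  - exact/measurable_EFinP.
  - by apply/measurable_EFinP; exact: ae_measurable_fun_real wfE mw.
  - by apply: (@filterS _ _ (ae_filter_ringOfSetsType leb)) wfE => t wt /wt ->.
by apply: eq_Rintegral => t _; rewrite enorm_sqr.
Qed.

End CurveFunctionalPotential.

(** * The quotient functional and its derivative *)

Section QuotientFunctional.
Variables (R : realType) (d : nat).
Local Notation H1 := (H1 R d).
Variables (W : H1 -> R) (DW : H1 -> H1 -> R) (M K alpha beta : R).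
Hypothesis alpha0 : 0 < alpha.
Hypothesis beta0 : 0 < beta.
Hypothesis M0 : 0 <= M.
Hypothesis W_le : forall g, `|W g| <= M.
Hypothesis DW_le : forall g h, `|DW g h| <= 2 * M * `|h|.
Hypothesis DW_linear : forall g a h k, DW g (a *: h + k) = a * DW g h + DW g k.
Hypothesis W_taylor : forall g h, `|W (g + h) - W g - DW g h| <= K * `|h| ^+ 2.

Definition kinetic (g : H1) : R := beta / 2 * dirichlet g g + alpha.
Definition quotient (g : H1) : R := - W g / kinetic g.
Definition Dquotient (g h : H1) : R :=
  - DW g h / kinetic g + W g * (beta * dirichlet g h) / kinetic g ^+ 2.

Let kappa := 1 + beta / (2 * alpha).

Let kappa0 : 0 <= kappa.
Proof. by rewrite addr_ge0// divr_ge0 ?mulr_ge0 ?ltW. Qed.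

Lemma kinetic_ge g : alpha <= kinetic g.
Proof. by rewrite lerDr mulr_ge0 ?dirichlet_ge0// divr_ge0// ltW. Qed.

Lemma kinetic_gt0 g : 0 < kinetic g.
Proof. exact: lt_le_trans (kinetic_ge g). Qed.

Let invk_ge0 g : 0 <= (kinetic g)^-1.
Proof. by rewrite invr_ge0 ltW// kinetic_gt0. Qed.

Let invk_le g : (kinetic g)^-1 <= alpha^-1.
Proof. by rewrite lef_pV2 ?posrE ?kinetic_gt0// kinetic_ge. Qed.

(** The denominator is quadratic in the velocity and its derivative linear, so their ratio is
    bounded uniformly in g. With x the square root of the Dirichlet energy, the claim is beta x <=
    kappa (beta x^2 / 2 + alpha). *)
Lemma dirichlet_over_kinetic g h :
  `|beta * dirichlet g h / kinetic g| <= kappa * `|h|.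
Proof.
rewrite normrM [`|_^-1|]ger0_norm// ler_pdivrMr ?kinetic_gt0//.
rewrite normrM gtr0_norm// mulrAC.
set x := Num.sqrt (dirichlet g g).
have x2 : x ^+ 2 = dirichlet g g by rewrite sqr_sqrtr// dirichlet_ge0.
apply: (@le_trans _ _ (beta * x * `|h|)).
  rewrite -mulrA ler_wpM2l ?(ltW beta0)// (le_trans (dirichlet_le g h))//.
  by rewrite ler_wpM2l ?sqrtr_ge0// dirichlet_sqrt_le.
rewrite ler_wpM2r// /kinetic /kappa -x2.
(* This value of kappa completes the square: what exceeds beta x is a sum of nonnegative terms. *)
have -> : (1 + beta / (2 * alpha)) * (beta / 2 * x ^+ 2 + alpha) =
    beta * x + alpha + beta / 2 * (x - 1) ^+ 2 + (beta / 2) ^+ 2 / alpha * x ^+ 2.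
  by field; rewrite gt_eqF.
have h1 : 0 <= beta / 2 * (x - 1) ^+ 2 by rewrite mulr_ge0 ?sqr_ge0// divr_ge0// ltW.
have h2 : 0 <= (beta / 2) ^+ 2 / alpha * x ^+ 2.
  by rewrite mulr_ge0 ?sqr_ge0// divr_ge0 ?sqr_ge0// ltW.
by move: h1 h2 (ltW alpha0); lra.
Qed.

Let G := (2 * M + M * kappa) / alpha.

Lemma quotient_gradient_bound_ge0 : 0 <= G.
Proof. by rewrite divr_ge0 ?addr_ge0 ?mulr_ge0// ltW. Qed.

Lemma Dquotient_le g h : `|Dquotient g h| <= G * `|h|.
Proof.
rewrite /Dquotient /G (le_trans (ler_normD _ _))// mulrDl mulrDl lerD//.
  rewrite normrM normrN mulrAC -mulrA [_ * alpha^-1]mulrC mulrCA [leRHS]mulrC.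
  rewrite [`|_^-1|]ger0_norm//; apply: ler_pM => //.
have -> : W g * (beta * dirichlet g h) / kinetic g ^+ 2 =
    W g * (beta * dirichlet g h / kinetic g) * (kinetic g)^-1.
  by field; rewrite gt_eqF// kinetic_gt0.
rewrite normrM [`|_^-1|]ger0_norm// normrM.
rewrite (_ : M * kappa / alpha * `|h| = M * (kappa * `|h|) / alpha); last by ring.
by rewrite !ler_pM ?mulr_ge0// dirichlet_over_kinetic.
Qed.

Lemma Dquotient_dual g : exists l : dual H1, forall h, l h = Dquotient g h.
Proof.
have [||l [lE _]] := @dual_of_bounded R H1 (Dquotient g) G quotient_gradient_bound_ge0.
- move=> a h k; rewrite /Dquotient DW_linear dirichletDr dirichletZr.
  by rewrite -[RHS]/(a * Dquotient g h + Dquotient g k) /Dquotient; field;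
    rewrite gt_eqF// kinetic_gt0.
- exact: Dquotient_le.
by exists l => h; rewrite -lE.
Qed.

Let L := K / alpha + 2 * M * kappa / alpha + 3 * (M * beta / alpha ^+ 2) +
  M * kappa ^+ 2 / alpha + M * kappa * beta / alpha ^+ 2.

Let abs_mul_le (x y X Y : R) : `|x| <= X -> `|y| <= Y -> `|x * y| <= X * Y.
Proof. by move=> xX yY; rewrite normrM ler_pM. Qed.

(** The remainder is exactly a sum of six products in which a and [b * p] are of first order in h, r
    and s of second order, and W, p, q bounded. Two of them are cubic; |h| <= 1 absorbs the extra
    factor. *)
Lemma quotient_taylor g h : `|h| <= 1 ->
  `|quotient (g + h) - quotient g - Dquotient g h| <= L * `|h| ^+ 2.
Proof.
move=> h1; set n := `|h| in h1 *.
have n0 : 0 <= n by exact: normr_ge0.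
set p := (kinetic g)^-1; set q := (kinetic (g + h))^-1.
set b := beta * dirichlet g h; set s := beta / 2 * dirichlet h h.
set a := DW g h; set r := W (g + h) - W g - a.
have kE : kinetic (g + h) = kinetic g + b + s.
  rewrite /kinetic dirichletDl !dirichletDr (dirichletC h g) /b /s.
  by field.
have kN0 : kinetic g != 0 by rewrite gt_eqF ?kinetic_gt0.
have kN1 : kinetic g + b + s != 0 by rewrite -kE gt_eqF ?kinetic_gt0.
have E : quotient (g + h) - quotient g - Dquotient g h =
    - (r * q) + a * (b * p) * q + a * s * (p * q) + W g * s * (p * q)
    - W g * ((b * p) * (b * p)) * q - W g * (b * p) * s * (p * q).
  rewrite /quotient /Dquotient -/a -/b (_ : W (g + h) = W g + a + r); last by rewrite /r; ring.
  rewrite /p /q kE; move: kN0 kN1; clear kE.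
  move: (kinetic g) (W g) (a) (b) (r) (s) => P w a' b' r' s' P0 P1.
  by field; rewrite P0 P1.
have pA : `|p| <= alpha^-1 by rewrite ger0_norm ?invk_ge0 ?invk_le.
have qA : `|q| <= alpha^-1 by rewrite ger0_norm ?invk_ge0 ?invk_le.
have rB : `|r| <= K * n ^+ 2 by exact: W_taylor.
have aB : `|a| <= 2 * M * n by exact: DW_le.
have bB : `|b * p| <= kappa * n by exact: dirichlet_over_kinetic.
have sB : `|s| <= beta * n ^+ 2.
  rewrite ger0_norm; last by rewrite mulr_ge0 ?dirichlet_ge0// divr_ge0// ltW.
  rewrite ler_pM ?dirichlet_ge0 ?dirichlet_le_norm//; first by rewrite divr_ge0// ltW.
  by move: beta0; lra.
have nn : n ^+ 3 <= n ^+ 2 by rewrite exprS ler_piMl// sqr_ge0.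
have pq := abs_mul_le pA qA.
rewrite E.
have t1 := abs_mul_le rB qA.
have t2 := abs_mul_le (abs_mul_le aB bB) qA.
have t3 := abs_mul_le (abs_mul_le aB sB) pq.
have t4 := abs_mul_le (abs_mul_le (W_le g) sB) pq.
have t5 := abs_mul_le (abs_mul_le (W_le g) (abs_mul_le bB bB)) qA.
have t6 := abs_mul_le (abs_mul_le (abs_mul_le (W_le g) bB) sB) pq.
have A0 : 0 <= alpha^-1 by rewrite invr_ge0 ltW.
have m0 : 0 <= M * beta / alpha ^+ 2.
  by rewrite divr_ge0 ?sqr_ge0// mulr_ge0// ltW.
have mk0 : 0 <= M * kappa * beta / alpha ^+ 2.
  by rewrite divr_ge0 ?sqr_ge0// mulr_ge0 ?(ltW beta0)// mulr_ge0.
have c3 : 2 * M * n * (beta * n ^+ 2) * (alpha^-1 * alpha^-1) <=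
    2 * (M * beta / alpha ^+ 2) * n ^+ 2.
  rewrite (_ : _ * _ = 2 * (M * beta / alpha ^+ 2) * n ^+ 3); last by field; rewrite gt_eqF.
  by rewrite ler_wpM2l// mulr_ge0.
have c6 : M * (kappa * n) * (beta * n ^+ 2) * (alpha^-1 * alpha^-1) <=
    (M * kappa * beta / alpha ^+ 2) * n ^+ 2.
  rewrite (_ : _ * _ = (M * kappa * beta / alpha ^+ 2) * n ^+ 3); last by field; rewrite gt_eqF.
  by rewrite ler_wpM2l.
have tri (x1 x2 x3 x4 x5 x6 y1 y2 y3 y4 y5 y6 : R) : `|x1| <= y1 -> `|x2| <= y2 ->
    `|x3| <= y3 -> `|x4| <= y4 -> `|x5| <= y5 -> `|x6| <= y6 ->
    `|- x1 + x2 + x3 + x4 - x5 - x6| <= y1 + y2 + y3 + y4 + y5 + y6.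
  move=> *; do 2 (rewrite (le_trans (ler_normB _ _))// lerD//).
  by do 3 (rewrite (le_trans (ler_normD _ _))// lerD//); rewrite normrN.
apply: (le_trans (tri _ _ _ _ _ _ _ _ _ _ _ _ t1 t2 (le_trans t3 c3) t4 t5 (le_trans t6 c6))).
rewrite le_eqVlt; apply/orP; left; apply/eqP; rewrite /L.
by field; rewrite gt_eqF.
Qed.

End QuotientFunctional.

(** * Decrease along the line searches *)

Section LineSearch.
Variables (R : realType) (d : nat).
Local Notation H1 := (H1 R d).
Variables (F : H1 -> R) (DF : H1 -> H1 -> R) (L G B : R).
Hypothesis L0 : 0 <= L.
Hypothesis G0 : 0 <= G.
Hypothesis taylor : forall g h, `|h| <= 1 ->
  `|F (g + h) - F g - DF g h| <= L * `|h| ^+ 2.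
Hypothesis DF_le : forall g h, `|DF g h| <= G * `|h|.
Hypothesis F_ge : forall g, - B <= F g.

Let G1 : 0 < G + 1. Proof. by rewrite ltr_wpDl. Qed.
Let L1 : 0 < L + 1. Proof. by rewrite ltr_wpDl. Qed.

Lemma H1ip_norm (D : H1) : H1ip D D = `|D| ^+ 2.
Proof. by rewrite sqr_sqrtr// H1ip_ge0. Qed.

(** A gradient satisfies |D| <= G, so r (G + 1) <= 1 keeps the increment in the unit ball, where the
    Taylor bound holds. *)
Lemma descent_step g D r : (forall h, DF g h = H1ip D h) -> 0 <= r -> r * (G + 1) <= 1 ->
  F (g - r *: D) <= F g - r * `|D| ^+ 2 + L * r ^+ 2 * `|D| ^+ 2.
Proof.
move=> gD r0 rG.
have DG : `|D| <= G.
  have := DF_le g D; rewrite gD H1ip_norm ger0_norm ?sqr_ge0// expr2.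
  have [->|D0] := eqVneq `|D| 0; first by [].
  by rewrite ler_pM2r// lt_neqAle eq_sym D0 normr_ge0.
have h1 : `|- (r *: D)| <= 1.
  rewrite normrN normrZ ger0_norm// (le_trans _ rG)// ler_wpM2l//.
  by rewrite (le_trans DG)// lerDl.
have := taylor g h1; rewrite gD -scaleNr normrZ normrN (ger0_norm r0) H1ipC H1ipZl H1ip_norm.
rewrite exprMn mulNr opprK [L * (_ * _)]mulrA ler_norml => /andP[_].
by move: (F (g + _)) (F g) (r * _) (L * _ * _) => a b x y; lra.
Qed.

(** The lower Goldstein inequality excludes short steps: if D is nonzero and delta < r0, comparison
    with [descent_step] gives s <= L delta, against delta < s / (L + 1). Steps of length at least r0
    decrease F by s r0 |D|^2 or more. *)
Lemma armijo_goldstein_decrease gamma D delta :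
  (forall n h, DF (gamma n) h = H1ip (D n) h) ->
  armijo_goldstein F gamma D delta ->
  exists2 c, 0 < c & forall n,
    F (gamma n - delta n *: D n) <= F (gamma n) - c * `|D n| ^+ 2.
Proof.
move=> gD [s [/andP[s0 s1] AG]].
pose r0 := Num.min (G + 1)^-1 (s / (L + 1)).
have r00 : 0 < r0 by rewrite lt_min invr_gt0 G1 divr_gt0.
exists (s * r0) => [|n]; first exact: mulr_gt0.
have [d0 lo hi] := AG n.
have [D0|D0] := eqVneq `|D n| 0.
  by move: hi; rewrite D0 expr0n/= !mulr0.
have Dp : 0 < `|D n| ^+ 2 by rewrite exprn_gt0// lt_neqAle eq_sym D0 normr_ge0.
have [dr|dr] := leP r0 (delta n).
  by rewrite (le_trans hi)// lerD2l lerN2 ler_wpM2r ?sqr_ge0// ler_wpM2l// ltW.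
move: dr; rewrite lt_min => /andP[dG dL]; exfalso.
have dG1 : delta n * (G + 1) <= 1 by rewrite -ler_pdivlMr// div1r ltW.
have := le_trans lo (descent_step (gD n) (ltW d0) dG1).
move: dL; rewrite ltr_pdivlMr// => dL.
have : s * (delta n * `|D n| ^+ 2) <= L * delta n * (delta n * `|D n| ^+ 2) ->
    s <= L * delta n by rewrite ler_pM2r// mulr_gt0.
move: dL d0; move: (`|D n| ^+ 2) (delta n) => x y dL y0.
by move=> impl hh; have : s <= L * y by [apply: impl; lra]; lra.
Qed.

(** If delta were below tau r0 and not the initial trial, the preceding trial delta / tau would be
    below r0, hence admissible by [descent_step], against maximality. *)
Lemma backtracking_armijo_decrease gamma D delta :
  (forall n h, DF (gamma n) h = H1ip (D n) h) ->
  backtracking_armijo F gamma D delta ->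
  exists2 c, 0 < c & forall n,
    F (gamma n - delta n *: D n) <= F (gamma n) - c * `|D n| ^+ 2.
Proof.
move=> gD [d0 [tau [s [d00 /andP[tau0 tau1] /andP[s0 s1] BA]]]].
pose r0 := Num.min (G + 1)^-1 ((1 - s) / (L + 1)).
have r00 : 0 < r0 by rewrite lt_min invr_gt0 G1 divr_gt0// subr_gt0.
pose c := Num.min d0 (tau * r0).
have c0 : 0 < c by rewrite lt_min d00 mulr_gt0.
exists (s * c) => [|n]; first exact: mulr_gt0.
have [[[k dk] hi] dmax] := BA n.
suff cd : c <= delta n.
  by rewrite (le_trans hi)// lerD2l lerN2 ler_wpM2r ?sqr_ge0// ler_wpM2l// ltW.
rewrite ge_min; case: k dk => [|k] dk; first by rewrite dk expr0 mulr1 lexx.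
apply/orP; right; rewrite leNgt; apply/negP => dn.
pose r := d0 * tau ^+ k.
have rp : 0 < r by rewrite mulr_gt0// exprn_gt0.
have dr : delta n = tau * r by rewrite dk /r exprS mulrCA.
move: dn; rewrite dr ltr_pM2l// => rr0.
have : ~ r <= delta n by apply/negP; rewrite -ltNge dr gtr_pMl.
apply; apply: dmax; split; first by exists k.
move: rr0; rewrite lt_min => /andP[rG rL].
have rG1 : r * (G + 1) <= 1 by rewrite -ler_pdivlMr// div1r ltW.
apply: (le_trans (descent_step (gD n) (ltW rp) rG1)).
rewrite ltr_pdivlMr// in rL.
have rL' : L * r <= 1 - s by move: rL rp; lra.
have := ler_wpM2r (mulr_ge0 (ltW rp) (sqr_ge0 `|D n|)) rL'.
by move: (`|D n| ^+ 2) (r) => x y; lra.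
Qed.

(** The values decrease and are bounded below, so they converge, and c |D|^2 is at most one
    decrement. *)
Lemma descent_vanishing_gradient (gamma D : nat -> H1) c : 0 < c ->
  (forall n, F (gamma n.+1) <= F (gamma n) - c * `|D n| ^+ 2) ->
  [/\ forall n, F (gamma n) <= F (gamma 0%N), cvgn (F \o gamma) &
      forall e, 0 < e -> exists N, forall n, (N <= n)%N -> `|D n| <= e].
Proof.
move=> c0 dec.
have ni : {homo F \o gamma : m n / (m <= n)%N >-> n <= m}.
  apply/nonincreasing_seqP => n /=; rewrite (le_trans (dec n))//.
  by rewrite gerBl mulr_ge0 ?sqr_ge0// ltW.
have cv : cvgn (F \o gamma).
  by apply: nonincreasing_is_cvgn => //; exists (- B) => _ [n _ <-]; exact: F_ge.
split=> [n||e e0]; [exact: (ni 0%N n)|exact: cv|].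
have ce0 : 0 < c * e ^+ 2 / 2 by rewrite divr_gt0// mulr_gt0// exprn_gt0.
have /cvgrPdist_le/(_ _ ce0)[N _ NP] := cv.
exists N => n Nn.
have := NP n Nn; have := NP n.+1 (leqW Nn) => /=; have := dec n.
move: (F (gamma n)) (F (gamma n.+1)) (limn _) => a b l ab.
rewrite !ler_norml => /andP[? ?] /andP[? ?].
have : c * `|D n| ^+ 2 <= c * e ^+ 2 by lra.
by rewrite ler_pM2l// ler_pXn2r// ?nnegrE ?(ltW e0).
Qed.

End LineSearch.

(** * Test curves for the Dirichlet form *)

Section TestCurves.
Variables (R : realType) (d : nat).
Local Notation mu := (@lebesgue_measure R).
Local Notation I01 := (`[0, 1]%classic : set R).
Local Notation H1 := (H1 R d).
Local Notation V := 'rV[R]_d.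

Let mI : measurable (I01 : set (measurableTypeR R)).
Proof. exact: measurable_itv. Qed.

Lemma L2_indic_scale (A : set R) (a : R) : measurable (A : set (measurableTypeR R)) ->
  L2 (fun t => \1_A t * a).
Proof.
move=> mA; have m1 : measurable_fun I01 (fun t : R => \1_A t * a).
  by apply: measurable_funM; [exact: measurable_indic|exact: measurable_cst].
apply: L2_of_sqnorm => //.
have la : L2 (fun=> a : R) by apply: L2_within_continuous => x; exact: cst_continuous.
have /integrableP[ma2] := la.2; apply: le_lt_trans; apply: ge0_le_integral => //.
- by move=> t _; rewrite lee_fin sqr_ge0.
- by apply/measurable_EFinP; exact: measurable_funX.
- move=> t _; rewrite /= lee_fin ger0_norm ?sqr_ge0// indicE.
  by case: (_ \in _); rewrite ?mul1r ?mul0r ?expr0n ?sqr_ge0.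
Qed.

(** The velocity is v on ]a, b] and 0 elsewhere, so pairing with it integrates the velocity of g to
    an increment. *)
Lemma ramp_curve (a b : R) (v : V) : 0 <= a -> a <= b -> b <= 1 ->
  exists r : H1, [/\ forall t, 0 <= t -> t <= a -> r t = 0,
    forall t, b <= t -> t <= 1 -> r t = (b - a) *: v &
    forall g : H1, dirichlet g r = dotv (g b - g a) v].
Proof.
move=> a0 ab b1.
pose B : set R := `]a, b]%classic.
have mB : measurable (B : set (measurableTypeR R)) by exact: measurable_itv.
pose g (s : R) : V := \1_B s *: v.
have lg i : L2 (fun t => g t 0 i).
  rewrite (_ : (fun _ => _) = fun t => \1_B t * v 0 i); first exact: L2_indic_scale.
  by apply/funext => t; rewrite mxE.
have [r [r0 rg]] := @H1_of_velocity R d 0 g lg.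
have inc0 (s t : R) : 0 <= s -> s <= t -> t <= 1 ->
    (forall x, s < x <= t -> ~ B x) -> r t = r s.
  move=> s0 st t1 nB; apply/rowP => i; apply/eqP; rewrite -subr_eq0.
  rewrite (velocity_increment rg s0 st t1) (@eq_Rintegral _ _ _ mu _ (fun=> 0)).
    by rewrite /Rintegral integral0.
  by move=> x; rewrite inE/= in_itv/= => /nB xB; rewrite mxE indicE memNset// mul0r.
have ra t : 0 <= t -> t <= a -> r t = 0.
  move=> t0 ta; rewrite (inc0 0 t)//; first by rewrite (le_trans ta)// (le_trans ab).
  move=> x /andP[_ xt]; rewrite /B/= in_itv/= => /andP[ax _].
  by move: (le_lt_trans (le_trans xt ta) ax); rewrite ltxx.
have mBba : fine (mu B) = b - a.
  rewrite /B lebesgue_measure_itv/= lte_fin; case: ltP => //= ba.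
  by apply/esym/eqP; rewrite subr_eq0 eq_le ab ba.
have rb : r b = (b - a) *: v.
  rewrite -[r b]subr0 -(ra a a0 (lexx a)); apply/rowP => i.
  rewrite !mxE (velocity_increment rg a0 ab b1) mulrC -mBba -Rintegral_cst//.
  by apply: eq_Rintegral => x xB; rewrite mxE indicE xB mul1r.
exists r; split => // [t bt t1|h].
  rewrite -rb; apply: (inc0 b t) => //; first exact: le_trans a0 ab.
  move=> x /andP[bx _]; rewrite /B/= in_itv/= => /andP[_ xb].
  by move: (lt_le_trans bx xb); rewrite ltxx.
rewrite (dirichlet_velocity (velocityP h) rg) L2ip_sum; [|exact: velocity_vL2|exact: lg].
apply: eq_bigr => i _.
have -> : (h b - h a) 0 i = h b 0 i - h a 0 i by rewrite !mxE.
rewrite (velocity_increment (velocityP h) a0 ab b1).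
have lh := @velocity_vL2 _ _ h i.
rewrite -RintegralZr//; last first.
  apply: integrableS (L2_integrable lh) => //.
  move=> x /=; rewrite !in_itv/= => /andP[ax xb].
  by rewrite (le_trans a0 (ltW ax)) (le_trans xb).
have -> : (`]a, b]%classic : set R) = I01 `&` B.
  apply/seteqP; split => [x|x []//]; rewrite /B/= !in_itv/= => /andP[ax xb].
  by rewrite ax xb (le_trans a0 (ltW ax)) (le_trans xb).
rewrite Rintegral_mkcondr; apply: eq_Rintegral => x _.
rewrite mxE patchE indicE; case: (x \in B); first by rewrite mul1r.
by rewrite mul0r mulr0.
Qed.

Lemma constant_curve (v : V) : exists c : H1,
  (forall t, t \in `[0, 1] -> c t = v) /\ forall g : H1, dirichlet g c = 0.
Proof.
have l0 (i : 'I_d) : L2 (fun t => (fun=> 0 : V) t 0 i).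
  rewrite (_ : (fun _ => _) = fun t => \1_(set0 : set R) t * 0); first exact: L2_indic_scale.
  by apply/funext => t; rewrite mxE mulr0.
have [c [c0 cg]] := @H1_of_velocity R d v (fun=> 0) l0.
exists c; split => [t|g].
  rewrite in_itv/= => /andP[t0 t1]; rewrite -c0; apply/rowP => i; apply/eqP.
  rewrite -subr_eq0 (velocity_increment cg (lexx 0) t0 t1).
  rewrite (@eq_Rintegral _ _ _ mu _ (fun=> 0)); last by move=> x _; rewrite mxE.
  by rewrite /Rintegral integral0.
rewrite (dirichlet_velocity (velocityP g) cg).
rewrite /L2ip (@eq_Rintegral _ _ _ mu _ (fun=> 0)); last first.
  by move=> x _; rewrite dotvC dotv0l.
by rewrite /Rintegral integral0.
Qed.

(** The velocity is v before the peak and -v after it, cut off at the ends of [0, 1]. The pairing is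
    then a second difference of g, one-sided when s is an end point. *)
Lemma tent_curve (s e : R) (v : V) : s \in `[0, 1] -> 0 < e ->
  exists q : H1, (forall t, t \in `[0, 1] -> e <= `|t - s| -> q t = 0) /\
  forall g : H1, dirichlet g q =
    dotv (g s - g (Num.max 0 (s - e))) v - dotv (g (Num.min 1 (s + e)) - g s) v.
Proof.
rewrite in_itv/= => /andP[s0 s1] e0.
set a := Num.max 0 (s - e); set b := Num.min 1 (s + e).
have a0 : 0 <= a by rewrite le_max lexx.
have as_ : a <= s by rewrite ge_max s0 gerBl ltW.
have sb : s <= b by rewrite le_min s1 lerDl ltW.
have b1 : b <= 1 by rewrite ge_min lexx.
have [r [r1 r2 rd]] := ramp_curve v a0 as_ s1.
have [q [q1 q2 qd]] := ramp_curve v s0 sb b1.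
(* When the rising side is cut at 0, this constant supplies the missing height: the peak is [e *: v]
   and the falling side reaches 0 at s + e. The pairing does not see it. *)
have [c [ct cd]] := constant_curve ((e - (s - a)) *: v).
exists (c + r - q); split => [t t01 ts|g].
  have := t01; rewrite in_itv/= => /andP[t0 t1].
  transitivity (c t + r t - q t); [by []|rewrite ct//].
  have [st|st] := leP s t.
    have tb : b <= t.
      by rewrite ge_min; apply/orP; right; move: ts; rewrite ger0_norm ?subr_ge0//; lra.
    have bE : b = s + e.
      rewrite /b; apply/min_idPr; rewrite (le_trans _ t1)//.
      by move: ts; rewrite ger0_norm ?subr_ge0//; lra.
    rewrite r2// q2// -scalerDl -scalerBl bE.
    by rewrite (_ : _ - _ = 0) ?scale0r//; ring.
  have tse : t <= s - e by move: ts; rewrite ltr0_norm ?subr_lt0//; lra.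
  have aE : a = s - e by apply/max_idPr; rewrite (le_trans t0).
  rewrite r1//; last by rewrite aE.
  rewrite q1 ?(ltW st)// aE (_ : e - _ = 0); last by ring.
  by rewrite scale0r !addr0 subr0.
by rewrite -scaleN1r !dirichletDr dirichletZr cd rd qd add0r mulN1r.
Qed.

End TestCurves.

(** * Separation from a convex set, and confinement *)

Section Separation.
Variables (R : realType) (d : nat) (E : set 'rV[R]_d).
Local Notation V := 'rV[R]_d.

Lemma convex_set_segment : convex_set E -> forall (x y : V) (s : R), E x -> E y ->
  0 <= s -> s <= 1 -> E (x + s *: (y - x)).
Proof.
move=> cvE x y s Ex Ey s0 s1.
have := cvE y x (Itv01 s0 s1) (mem_set Ey) (mem_set Ex); rewrite inE.
suff -> : x + s *: (y - x) = s *: y + (1 - s) *: x by [].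
by rewrite scalerBr scalerBl scale1r addrCA.
Qed.

Lemma continuous_enormB (y : V) : continuous (fun x : V => enorm (x - y)).
Proof.
move=> x; apply/(@cvgrPdist_le R R V (nbhs x) (nbhs_filter x)) => e e0.
have nb := @enorm_ball R d x _ e0.
apply: filterS nb => z zx; rewrite ler_norml; apply/andP; split.
  have -> : z - y = (z - x) + (x - y) by rewrite addrA subrK.
  by have := enormD (z - x) (x - y); lra.
have -> : x - y = (x - z) + (z - y) by rewrite addrA subrK.
by have := enormD (x - z) (z - y); rewrite (enormB x z); lra.
Qed.

(** The normal is y - x0, with x0 the Euclidean projection of y on E. A point of E beyond the
    hyperplane through x0 would allow a move inside E that comes closer to y. *)
Lemma separation y : compact E -> convex_set E -> E !=set0 -> ~ E y ->
  exists (v : V) (c : R), (forall x, E x -> dotv x v <= c) /\ c < dotv y v.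
Proof.
move=> cE cvE E0 Ey.
have [|x0 Ex0 xmin] := @compact_EVT_min V R (fun x : V => enorm (x - y)) E E0 cE.
  exact: continuous_subspaceT (@continuous_enormB y).
rewrite inE in Ex0; exists (y - x0), (dotv x0 (y - x0)); split; last first.
  rewrite -subr_gt0 -dotvBl -enorm_sqr exprn_gt0//.
  rewrite lt_neqAle enorm_ge0 andbT eq_sym; apply/eqP => /enorm_eq0 /eqP.
  by rewrite subr_eq0 => /eqP yx; apply: Ey; rewrite yx.
move=> x Ex; set v := y - x0.
suff : dotv (x - x0) v <= 0.
  by rewrite dotvBl subr_le0.
rewrite leNgt; apply/negP => p0.
set p := dotv (x - x0) v in p0; set n := dotv (x - x0) (x - x0).
have n0 : 0 <= n by exact: dotv_ge0.
(* A step short enough that s n < p: the squared distance to y changes by s (s n - 2 p) < 0. *)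
pose s := Num.min 1 (p / (n + 1)).
have s0 : 0 < s by rewrite lt_min ltr01 divr_gt0// ltr_wpDl.
have s1 : s <= 1 by rewrite ge_min lexx.
have Es := convex_set_segment cvE Ex0 Ex (ltW s0) s1.
have := xmin _ (mem_set Es) => h.
have {}h : enorm (x0 - y) ^+ 2 <= enorm (x0 + s *: (x - x0) - y) ^+ 2.
  by rewrite lerXn2r ?nnegrE ?enorm_ge0.
have E1 : x0 + s *: (x - x0) - y = s *: (x - x0) + (-1) *: v.
  by apply/rowP => k; rewrite /v !mxE; ring.
have E2 : enorm (x0 - y) ^+ 2 = dotv v v by rewrite enormB enorm_sqr.
have E3 (a b : V) : dotv (s *: a + (-1) *: b) (s *: a + (-1) *: b) =
    s ^+ 2 * dotv a a - 2 * s * dotv a b + dotv b b.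
  rewrite dotvDl !dotvZl [dotv a _]dotvC [dotv b (_ + _)]dotvC !dotvDl !dotvZl.
  by rewrite (dotvC b a); ring.
move: h; rewrite E1 E2 enorm_sqr E3 -/p -/n => h.
have sn : s * n < p.
  apply: (@lt_le_trans _ _ (s * (n + 1))); first by rewrite ltr_pM2l// ltrDl.
  by rewrite -ler_pdivlMr ?ltr_wpDl// ge_min lexx orbT.
have : s * (s * n - 2 * p) >= 0 by move: h; lra.
by rewrite pmulr_rge0//; lra.
Qed.

End Separation.

Section Confinement.
Variables (R : realType) (d : nat) (E : set 'rV[R]_d).
Local Notation V := 'rV[R]_d.
Hypothesis cE : compact E.
Hypothesis cvE : convex_set E.
Variable g : H1 R d.
Hypothesis g_stat : forall h : H1 R d,
  (forall t, t \in `[0, 1] -> h t = 0 \/ ~ E (g t)) -> dirichlet g h = 0.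
Hypothesis g_visit : exists2 t, t \in `[0, 1] & E (g t).

(** Extends the curve by its end values to the whole line, where the set of maximal times can be
    open and closed without special treatment of 0 and 1. *)
Let clamp (t : R) : R := Num.max 0 (Num.min 1 t).

Let clamp01 t : clamp t \in `[0, 1].
Proof.
by rewrite in_itv/= /clamp le_max lexx/= ge_max ler01 ge_min lexx.
Qed.

Let clampK t : t \in `[0, 1] -> clamp t = t.
Proof.
rewrite in_itv/= => /andP[t0 t1]; rewrite /clamp (min_idPr t1).
exact/max_idPr.
Qed.

Let clampE t : [\/ t <= 0 /\ clamp t = 0, t \in `[0, 1] /\ clamp t = t | 1 <= t /\ clamp t = 1].
Proof.
have [t0|t0] := leP t 0.
  by apply: Or31; split=> //; apply/max_idPl; rewrite ge_min t0 orbT.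
have [t1|t1] := leP t 1.
  have t01 : t \in `[0, 1] by rewrite in_itv/= t1 ltW.
  by apply: Or32; split=> //; exact: clampK.
apply: Or33; split; first exact: ltW.
by rewrite /clamp (min_idPl (ltW t1)); exact/max_idPr.
Qed.

Let clamp_lip s t : `|clamp s - clamp t| <= `|s - t|.
Proof.
have := ler_norm (s - t); have := ler_norm (- (s - t)); rewrite normrN.
have [a [sE sa]] : exists a, clamp s = a /\
    [\/ s <= 0 /\ a = 0, 0 <= s <= 1 /\ a = s | 1 <= s /\ a = 1].
  by exists (clamp s); split=> //; exact: clampE.
have [b [tE tb]] : exists b, clamp t = b /\
    [\/ t <= 0 /\ b = 0, 0 <= t <= 1 /\ b = t | 1 <= t /\ b = 1].
  by exists (clamp t); split=> //; exact: clampE.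
rewrite sE tE ler_norml => h1 h2; apply/andP.
by case: sa => -[s01 ->]; case: tb => -[t01 ->];
  try (case/andP: s01 => s0 s1); try (case/andP: t01 => t0 t1); split; lra.
Qed.

(* The component of [g] in a direction separating [E] from a point of the curve
   is maximal at some time; testing with small tents around the set of maximal
   times shows that this set is open, hence everything. *)
Lemma stationary_confined t : t \in `[0, 1] -> E (g t).
Proof.
move=> t1_01; apply: contrapT => Et1; rename t into t1.
have [t2 t2_01 Et2] := g_visit.
have [v [c [Ec cv]]] := separation cE cvE (ex_intro _ _ Et2) Et1.
pose p t := dotv (g (clamp t)) v.
have pE t : t \in `[0, 1] -> p t = dotv (g t) v by move=> /clampK; rewrite /p => ->.
have pclamp t : p (clamp t) = p t by rewrite /p clampK.
have pcont t e : 0 < e -> exists2 r : R, 0 < r & forall u, `|u - t| < r -> `|p u - p t| < e.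
  move=> e0; set B := dirichlet g g.
  have B0 : 0 <= B by exact: dirichlet_ge0.
  have v1 : 0 < enorm v + 1 by rewrite ltr_wpDl ?enorm_ge0.
  have ev : 0 < e / (enorm v + 1) by rewrite divr_gt0.
  exists ((e / (enorm v + 1)) ^+ 2 / (B + 1)).
    by rewrite divr_gt0 ?exprn_gt0 ?ltr_wpDl.
  move=> u ut.
  have -> : p u - p t = dotv (g (clamp u) - g (clamp t)) v.
    by rewrite /p dotvBl.
  rewrite (le_lt_trans (dotv_le _ _))//.
  have gg : enorm (g (clamp u) - g (clamp t)) <= e / (enorm v + 1).
    rewrite -(@ler_pXn2r _ 2)// ?nnegrE ?enorm_ge0 ?(ltW ev)//.
    rewrite (le_trans (holder_curve_abs g (clamp01 u) (clamp01 t)))//.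
    apply: (@le_trans _ _ ((e / (enorm v + 1)) ^+ 2 / (B + 1) * (B + 1))).
      apply: ler_pM => //; last by rewrite lerDl.
      by rewrite (le_trans (clamp_lip u t))// ltW.
    by rewrite divfK// gt_eqF// ltr_wpDl.
  apply: (@le_lt_trans _ _ (e / (enorm v + 1) * enorm v)).
    by rewrite ler_wpM2r ?enorm_ge0.
  by rewrite mulrAC ltr_pdivrMr// ltr_pM2l// ltrDl.
have pcontinuous : continuous p.
  move=> t; apply/cvgrPdist_lt => e e0; have [r r0 rp] := pcont t e e0.
  apply/nbhs_ballP; exists r => // u /= tu.
  by rewrite distrC rp// distrC.
have [t0 t0_01 pmax01] := EVT_max ler01 (continuous_subspaceT pcontinuous).
have pmax t : p t <= p t0 by rewrite -pclamp; exact: pmax01.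
have cM : c < p t0 by apply: (lt_le_trans cv); rewrite -pE.
pose Z : set R := [set t | p t = p t0].
have Zopen t : Z t -> exists2 r : R, 0 < r & forall u, `|u - t| < r -> Z u.
  move=> Zt; set s := clamp t; have s01 : s \in `[0, 1] := clamp01 t.
  have ps : p s = p t0 by rewrite pclamp.
  have Mc : 0 < p t0 - c by rewrite subr_gt0.
  (* At distance less than r from s the component exceeds c, so the curve is off E there and tents
     supported there are admissible in [g_stat]. *)
  have [r r0 rp] := pcont s _ Mc; exists r => // u ut.
  rewrite /Z/= -pclamp; set z := clamp u; have z01 : z \in `[0, 1] := clamp01 u.
  have zs : `|z - s| < r by exact: le_lt_trans (clamp_lip u t) ut.
  have [->//|zNs] := eqVneq z s.
  have e0 : 0 < `|z - s| by rewrite normr_gt0 subr_eq0.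
  (* The half-width |z - s| makes z one of the end points a, b of the tent. The pairing gives p a +
     p b = 2 p s with p s maximal, so both values are maximal. *)
  have [q [q0 qd]] := tent_curve v s01 e0.
  have := qd g; rewrite g_stat; last first.
    move=> x x01; have [xs|xs] := leP `|z - s| `|x - s|; first by left; exact: q0.
    right=> Ex; have := rp x (lt_trans xs zs); rewrite ps (pE x x01) ltr_norml => /andP[+ _].
    by have := Ec _ Ex; lra.
  set a := Num.max 0 _; set b := Num.min 1 _ => ab.
  have a01 : a \in `[0, 1].
    rewrite in_itv/= le_max lexx/= ge_max ler01/=.
    by move: s01; rewrite in_itv/= => /andP[_ s1]; rewrite (le_trans _ s1)// gerBl.
  have b01 : b \in `[0, 1].
    rewrite in_itv/= ge_min lexx/= andbT le_min ler01/=.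
    by move: s01; rewrite in_itv/= => /andP[s0 _]; rewrite addr_ge0.
  have sum0 : 0 = (p s - p a) - (p b - p s).
    by rewrite ab !pE// !dotvBl.
  have pa := pmax a; have pb := pmax b.
  have [paM pbM] : p a = p t0 /\ p b = p t0 by split; lra.
  have [sz|sz] := leP s z.
    rewrite -pbM; congr p; rewrite /b ger0_norm ?subr_ge0// addrC subrK.
    by apply/esym/min_idPr; move: z01; rewrite in_itv/= => /andP[].
  rewrite -paM; congr p; rewrite /a ltr0_norm ?subr_lt0// opprB opprB addrC subrK.
  by apply/esym/max_idPr; move: z01; rewrite in_itv/= => /andP[].
have ZT : Z = setT.
  have := (@connected_intervalP R setT).2; apply.
  - by move=> x y _ _ z _.
  - by exists t0.
  - exists Z; last by rewrite setTI.
    rewrite openE => t /Zopen[r r0 rZ]; apply/nbhs_ballP; exists r => // u /= tu.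
    by apply: rZ; rewrite distrC.
  - exists Z; last by rewrite setTI.
    apply: (@closed_comp _ _ p [set x | x = p t0]); last exact: closed_eq.
    by move=> t _; exact: pcontinuous.
have : Z t2 by rewrite ZT.
by rewrite /Z/= (pE t2 t2_01) => pt2; have := Ec _ Et2; lra.
Qed.

End Confinement.

(** * Descent sequences and their limits *)

Lemma extraction_ge (phi : nat -> nat) : {homo phi : m n / (m < n)%N} ->
  forall n, (n <= phi n)%N.
Proof.
move=> phi_incr; elim=> // n IH; apply: leq_ltn_trans IH _; exact: phi_incr.
Qed.

Section PotentialDescent.
Variables (R : realType) (d : nat) (Omega E : set 'rV[R]_d).
Local Notation V := 'rV[R]_d.
Local Notation S := (closure Omega).
Local Notation leb := (@completed_lebesgue_measure R).
Local Notation H1 := (H1 R d).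
Local Notation L01 := (`[0, 1]%classic : set (lebesgueR R)).
Variables (w : R -> C11 S) (m : R -> R) (K alpha beta : R).
Hypothesis oO : open Omega.
Hypothesis cE : compact E.
Hypothesis EO : E `<=` Omega.
Hypothesis wE : forall t, supp (w t) `<=` E.
Hypothesis gE : forall t, supp (grad (w t)) `<=` E.
Hypothesis wm : forall t x, `|w t x| <= m t.
Hypothesis gm : forall t x, enorm (grad (w t) x) <= m t.
Hypothesis gK : forall t x y,
  enorm (grad (w t) x - grad (w t) y) <= K * m t * enorm (x - y).
Hypothesis mint : leb.-integrable L01 (EFin \o m).
Hypothesis wmeas : forall x, measurable_fun L01 (fun t => w t x).
Hypothesis K0 : 0 <= K.
Hypothesis alpha0 : 0 < alpha.
Hypothesis beta0 : 0 < beta.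

Hypothesis cvE : convex_set E.

Local Notation M := (total_mass m).
Local Notation W := (potential w).
Local Notation DW := (force_work w).
Local Notation P := (kinetic alpha beta).
Local Notation F := (quotient W alpha beta).
Local Notation DF := (Dquotient W DW alpha beta).

Let M0 : 0 <= M. Proof. exact: total_mass_ge0 wm. Qed.

Lemma work_le_norm g h : `|DW g h| <= 2 * M * `|h|.
Proof.
have := force_work_le oO cE EO wE gE gm gK mint wmeas g (fun t _ => enorm_curve_le h t).
by rewrite mulrAC.
Qed.

Lemma potential_taylor_norm g h : `|W (g + h) - W g - DW g h| <= 4 * K * M * `|h| ^+ 2.
Proof.
have := potential_taylor oO cE EO wE gE wm gm gK mint wmeas g K0 (fun t _ => enorm_curve_le h t).
by rewrite (_ : K * _ * M = 4 * K * M * `|h| ^+ 2)//; ring.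
Qed.

Let W_le g : `|W g| <= M.
Proof. exact: (potential_le oO cE EO wE gE wm mint wmeas). Qed.

Let DW_lin g a h k : DW g (a *: h + k) = a * DW g h + DW g k.
Proof. exact: (force_work_linear oO cE EO wE gE gm gK mint wmeas). Qed.

Lemma quotient_ge g : - (M / alpha) <= F g.
Proof.
have P0 := kinetic_gt0 alpha0 beta0 g; rewrite /quotient mulNr lerN2.
have WM : W g <= M by exact: le_trans (ler_norm _) (W_le g).
rewrite (le_trans (ler_wpM2r _ WM))// ?invr_ge0 ?(ltW P0)//.
by rewrite ler_wpM2l// lef_pV2 ?posrE// kinetic_ge.
Qed.

(** F g <= -c means c P <= W, while W <= M and P >= alpha. A curve missing E has W = 0, which the
    lower bound on W excludes. *)
Lemma negative_sublevel g c : 0 < c -> F g <= - c ->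
  [/\ c * alpha <= W g, P g <= M / c & exists2 t, t \in `[0, 1] & E (g t)].
Proof.
move=> c0 Fc; have P0 := kinetic_gt0 alpha0 beta0 g.
have WP : c * P g <= W g.
  by move: Fc; rewrite /quotient mulNr lerN2 ler_pdivlMr.
have WM : W g <= M by exact: le_trans (ler_norm _) (W_le g).
have Wc : c * alpha <= W g.
  by rewrite (le_trans _ WP)// ler_wpM2l ?(ltW c0)// kinetic_ge.
split => //; first by rewrite ler_pdivlMr// mulrC (le_trans WP).
apply: contrapT => nE; have W0 : W g = 0.
  by apply: (potential_out wE gE) => t t01 gt; apply: nE; exists t.
by move: Wc; rewrite W0 leNgt mulr_gt0.
Qed.

(* The gradient equation solved for the Dirichlet form: when the gradients tend
   to [0], what is left on the right depends on [g] only through [F g] and a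
   force that is continuous for uniform convergence of the curves. *)
Lemma dirichlet_of_gradient g (D h : H1) : 0 < W g ->
  DF g h = H1ip D h ->
  dirichlet g h = - (P g / F g / beta * H1ip D h) - (F g)^-1 / beta * DW g h.
Proof.
move=> Wp <-; have P0 := kinetic_gt0 alpha0 beta0 g.
have [PN WN bN] : [/\ P g != 0, W g != 0 & beta != 0] by rewrite !gt_eqF.
rewrite /Dquotient /quotient; field.
by rewrite PN WN bN.
Qed.

Let difference_le (p q a b u v X Y Z T : R) : `|p| <= X -> `|q| <= Y ->
  `|(a - b) * u| <= Z -> `|b * (u - v)| <= T ->
  - p - a / beta * u - (- q - b / beta * v) <= X + Y + (Z + T) / beta.
Proof.
move=> pX qY aZ bT; have bi : 0 <= beta^-1 by rewrite invr_ge0 ltW.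
rewrite (_ : _ - _ = (q - p) - ((a - b) * u + b * (u - v)) / beta); last by ring.
rewrite (le_trans (ler_norm _))// (le_trans (ler_normB _ _))// lerD//.
  by rewrite (le_trans (ler_normB _ _))// addrC lerD.
rewrite normrM [`|beta^-1|]ger0_norm// ler_wpM2r//.
by rewrite (le_trans (ler_normD _ _))// lerD.
Qed.

(** With x a common bound for both gradients, for the gap in F and for the uniform distance of the
    two curves, the whole estimate is linear in x. *)
Let budget_le (a B N c f D1 D2 x : R) : 0 <= a -> 0 <= B -> 0 <= N -> 0 < c ->
  f <= x -> D1 <= x -> D2 <= x ->
  x + (a * (D1 + D2) * (2 * B) +
    (f / c ^+ 2 * (4 * N * B) + K * x * (4 * B) * N / c) / beta) <=
  (1 + a * 2 * (2 * B) + (4 * N * B / c ^+ 2 + K * (4 * B) * N / c) / beta) * x.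
Proof.
move=> a0 B0 N0 c0 fx D1x D2x; rewrite -subr_ge0.
rewrite (_ : _ - _ = a * (2 * B) * ((x - D1) + (x - D2)) +
    (4 * N * B) / c ^+ 2 * (x - f) / beta); last by ring.
have dx : 0 <= (x - D1) + (x - D2) by rewrite addr_ge0// subr_ge0.
rewrite addr_ge0//; first by rewrite !mulr_ge0.
rewrite !mulr_ge0 ?subr_ge0// invr_ge0 ?sqr_ge0//; exact: ltW.
Qed.

Lemma descent_cluster_point (gamma D : nat -> H1) c : 0 < c ->
  (forall n, F (gamma n) <= - c) -> cvgn (F \o gamma) ->
  (forall n h, DF (gamma n) h = H1ip (D n) h) ->
  (forall e, 0 < e -> exists N, forall n, (N <= n)%N -> `|D n| <= e) ->
  exists g, accumulation_point gamma g.
Proof.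
move=> c0 Fc cF gD D_0.
have sub n := negative_sublevel c0 (Fc n).
have Wp n : 0 < W (gamma n).
  by have [Wc _ _] := sub n; apply: lt_le_trans Wc; rewrite mulr_gt0.
have Fn0 n : F (gamma n) < 0 by apply: le_lt_trans (Fc n) _; rewrite oppr_lt0.
have FNc n : `|(F (gamma n))^-1| <= c^-1.
  rewrite normfV lef_pV2 ?posrE ?normr_gt0 ?lt_eqF//.
  by rewrite ltr0_norm// lerNr.
have Pn n : P (gamma n) <= M / c by have [] := sub n.
have [rE rE0 ErE] := compact_within_bounded cE
  (continuous_subspaceT (@continuous_enormB R d 0)).
pose V0 := 2 * (M / c) / beta.
have dir_le n : dirichlet (gamma n) (gamma n) <= V0.
  rewrite /V0 ler_pdivlMr//; have := Pn n; rewrite /kinetic.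
  by have := alpha0; lra.
have V00 : 0 <= V0 by exact: le_trans (dirichlet_ge0 _) (dir_le 0%N).
(* [rE] bounds the point where the curve meets E, and the square root bounds its variation over
   [0, 1]. *)
pose s0 := rE + Num.sqrt V0.
have s00 : 0 <= s0 by rewrite addr_ge0// sqrtr_ge0.
have sup_le n t : t \in `[0, 1] -> enorm (gamma n t) <= s0.
  move=> t01; have [_ _ [t' t'01 Et']] := sub n.
  rewrite -[gamma n t](subrK (gamma n t')) addrC (le_trans (enormD _ _))// lerD//.
    by have := ErE _ Et'; rewrite subr0 ger0_norm ?enorm_ge0.
  rewrite -[leLHS]ger0_norm ?enorm_ge0// -sqrtr_sqr; apply: ler_wsqrtr.
  rewrite (le_trans (holder_curve_abs _ t01 t'01))//.
  apply: le_trans (dir_le n); rewrite ler_piMl ?dirichlet_ge0//.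
  move: t01 t'01; rewrite !in_itv/= => /andP[? ?] /andP[? ?].
  by rewrite ler_norml; apply/andP; split; lra.
pose B := Num.sqrt (s0 ^+ 2 + V0).
have B0 : 0 <= B by exact: sqrtr_ge0.
have gB n : `|gamma n| <= B.
  rewrite -[leLHS]ger0_norm// -sqrtr_sqr; apply: ler_wsqrtr.
  by rewrite (le_trans (H1_norm_le_sup (sup_le n)))// lerD2l.
have [phi [phi_incr phi_unif]] := H1_bounded_uniformly_cauchy gB.
have phi_ge := extraction_ge phi_incr.
pose c1 := M / c / c / beta.
have c10 : 0 <= c1 by rewrite !divr_ge0// ltW.
have dir_diff n k (h : H1) a : `|h| <= 2 * B ->
    (forall t, t \in `[0, 1] -> enorm (gamma n t - gamma k t) <= a) ->
    dirichlet (gamma n) h - dirichlet (gamma k) h <=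
    c1 * (`|D n| + `|D k|) * (2 * B) +
    (`|F (gamma n) - F (gamma k)| / c ^+ 2 * (4 * M * B) +
     K * a * (4 * B) * M / c) / beta.
  move=> hB na; rewrite !(dirichlet_of_gradient (Wp _) (gD _ h)).
  have DB j : `|P (gamma j) / F (gamma j) / beta * H1ip (D j) h| <= c1 * `|D j| * (2 * B).
    rewrite -[leRHS]mulrA normrM ler_pM//.
      rewrite !normrM [`|beta^-1|]ger0_norm ?invr_ge0 ?(ltW beta0)//.
      rewrite ler_wpM2r ?invr_ge0 ?(ltW beta0)// ler_pM//.
      by rewrite ger0_norm// ltW// kinetic_gt0.
    by rewrite (le_trans (H1ip_le _ _))// ler_wpM2l.
  set Fi := fun j => (F (gamma j))^-1.
  have Fdiff : `|Fi n - Fi k| <= `|F (gamma n) - F (gamma k)| / c ^+ 2.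
    have -> : Fi n - Fi k = - (F (gamma n) - F (gamma k)) * (Fi n * Fi k).
      have := ltr0_neq0 (Fn0 n); have := ltr0_neq0 (Fn0 k).
      by rewrite /Fi; move: (F _) (F _) => a1 a2 ? ?; field; apply/andP.
    rewrite normrM normrN ler_wpM2l// -exprVn expr2 normrM.
    by apply: ler_pM; rewrite ?normr_ge0//; exact: FNc.
  have c41 : `|(Fi n - Fi k) * DW (gamma n) h| <=
      `|F (gamma n) - F (gamma k)| / c ^+ 2 * (4 * M * B).
    rewrite normrM; apply: ler_pM => //.
 apply: le_trans (work_le_norm _ _) _.
    rewrite (_ : 4 * M * B = 2 * M * (2 * B)); last by ring.
    by rewrite ler_wpM2l// mulr_ge0.
  have c42 : `|Fi k * (DW (gamma n) h - DW (gamma k) h)| <= K * a * (4 * B) * M / c.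
    rewrite normrM mulrC; apply: ler_pM; rewrite ?normr_ge0//; last exact: FNc.
    apply: (force_work_lipschitz oO cE EO wE gE wm gm gK mint wmeas K0 na) => t _.
    by rewrite (le_trans (enorm_curve_le h t))//; move: hB; lra.
  rewrite (mulrDr c1) (mulrDl (c1 * `|D n|)); exact: difference_le (DB n) (DB k) c41 c42.
pose C := 1 + c1 * 2 * (2 * B) + (4 * M * B / c ^+ 2 + K * (4 * B) * M / c) / beta.
have C0 : 0 < C.
  rewrite /C -addrA ltr_pwDl// addr_ge0//; first by do 2 (apply: mulr_ge0 => //); exact: mulr_ge0.
  by rewrite divr_ge0 ?(ltW beta0)// addr_ge0// divr_ge0 ?sqr_ge0 ?(ltW c0)// !mulr_ge0.
have cauchy e : 0 < e -> exists N, forall i j, (N <= i)%N -> (N <= j)%N ->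
    `|gamma (phi i) - gamma (phi j)| <= e.
  (* C x <= e^2 closes the estimate, and x <= 1 lets the L^2 part x^2 be counted as x. *)
  move=> e0; pose x := Num.min 1 (e ^+ 2 / C).
  have x0 : 0 < x by rewrite lt_min ltr01 divr_gt0// exprn_gt0.
  have x1 : x <= 1 by rewrite ge_min lexx.
  have xC : C * x <= e ^+ 2 by rewrite mulrC -ler_pdivlMr// ge_min lexx orbT.
  have [N1 HD] := D_0 x x0.
  have [N2 HN] := phi_unif x x0.
  have x20 : 0 < x / 2 by rewrite divr_gt0.
  have /cvgrPdist_le/(_ _ x20)[N3 _ HF] := cF.
  exists (maxn N1 (maxn N2 N3)) => i j; rewrite !geq_max.
  move=> /andP[i1 /andP[i2 i3]] /andP[j1 /andP[j2 j3]].
  set h := gamma (phi i) - gamma (phi j).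
  have hB : `|h| <= 2 * B by rewrite (le_trans (ler_normB _ _))// mulrDl mul1r lerD.
  have ha := HN i j i2 j2.
  have F1 : `|F (gamma (phi i)) - F (gamma (phi j))| <= x.
    have := HF _ (leq_trans i3 (phi_ge i)); have := HF _ (leq_trans j3 (phi_ge j)).
    rewrite /=; move: (limn _) (F _) (F _) => l a b.
    by rewrite !ler_norml => /andP[? ?] /andP[? ?]; apply/andP; split; lra.
  have Di := HD _ (leq_trans i1 (phi_ge i)); have Dj := HD _ (leq_trans j1 (phi_ge j)).
  have dd := dir_diff (phi i) (phi j) h x hB ha.
  (* Testing with the difference of the two iterates itself turns [dir_diff] into a bound for its
     Dirichlet energy. *)
  have hdir : dirichlet h h = dirichlet (gamma (phi i)) h - dirichlet (gamma (phi j)) h.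
    by rewrite {1}/h dirichletDl -scaleN1r dirichletZl mulN1r.
  rewrite -(@ler_pXn2r _ 2)// ?nnegrE ?(ltW e0)//.
  apply: le_trans xC.
  have hx := @H1_norm_le_sup R d h x ha; apply: (le_trans hx).
  rewrite hdir; apply: le_trans (lerD (_ : x ^+ 2 <= x) dd) _.
    by rewrite expr2 ler_piMl// ltW.
  exact: (budget_le c10 B0 M0 c0 F1 Di Dj).
have [g gg] := H1_complete cauchy.
by exists g, phi; split.
Qed.

Lemma quotient_taylor_bound : exists2 L, 0 <= L & forall g h, `|h| <= 1 ->
  `|F (g + h) - F g - DF g h| <= L * `|h| ^+ 2.
Proof.
have taylor := @quotient_taylor R d W DW M _ alpha beta alpha0 beta0 M0
  W_le work_le_norm potential_taylor_norm.
eexists; last first.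
  by move=> g h h1; apply: le_trans (taylor g h h1) (ler_wpM2r (sqr_ge0 _) (ler_norm _)).
exact: normr_ge0.
Qed.

Lemma quotient_continuously_differentiable : exists DFd : H1 -> dual H1,
  [/\ forall g, is_diff g (F : H1 -> R^o) (DFd g), continuous DFd &
      forall g h, DFd g h = DF g h].
Proof.
have [L L0 taylor] := quotient_taylor_bound.
have /choice[DFd DFdE] : forall g, exists l : dual H1, forall h, l h = DF g h.
  by move=> g; exact: (Dquotient_dual alpha0 beta0 M0 W_le work_le_norm DW_lin).
have taylor' : forall g h, `|h| <= 1 ->
    `|F (g + h) - F g - DFd g h| <= L * `|h| ^+ 2.
  by move=> g h h1; rewrite DFdE; exact: taylor.
exists DFd; split=> //; first by move=> g; exact: uniform_taylor_is_diff L0 taylor' g.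
exact: uniform_taylor_continuous L0 taylor'.
Qed.

Lemma differential_quotient g h : 'd (F : H1 -> R^o) g h = DF g h.
Proof.
have [DFd [dF _ DFdE]] := quotient_continuously_differentiable.
by rewrite -DFdE; have -> : 'd (F : H1 -> R^o) g = DFd g :> (H1 -> R^o) by exact: diff_val.
Qed.

Lemma descent_sequence_vanishing gamma : descent_sequence (F : H1 -> R^o) gamma ->
  exists D, [/\ forall n h, DF (gamma n) h = H1ip (D n) h,
    forall n, F (gamma n) <= F (gamma 0%N), F (gamma 0%N) < 0, cvgn (F \o gamma) &
    forall e, 0 < e -> exists N, forall n, (N <= n)%N -> `|D n| <= e].
Proof.
move=> [D [delta [F0 riesz step rule]]].
have gD n h : DF (gamma n) h = H1ip (D n) h.
  by rewrite -differential_quotient; exact: riesz.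
have [L L0 taylor] := quotient_taylor_bound.
have G0 := quotient_gradient_bound_ge0 alpha0 beta0 M0.
have DF_le := Dquotient_le alpha0 beta0 W_le work_le_norm.
have [c c0 dec] : exists2 c, 0 < c & forall n,
    F (gamma n - delta n *: D n) <= F (gamma n) - c * `|D n| ^+ 2.
  case: rule => rule.
    exact: (armijo_goldstein_decrease L0 G0 taylor DF_le gD rule).
  exact: (backtracking_armijo_decrease L0 G0 taylor DF_le gD rule).
have dec' n : F (gamma n.+1) <= F (gamma n) - c * `|D n| ^+ 2 by rewrite step.
have [F_le F_cvg D_0] := descent_vanishing_gradient quotient_ge c0 dec'.
by exists D.
Qed.

Lemma descent_sequence_cluster_point gamma : descent_sequence (F : H1 -> R^o) gamma ->
  exists g, accumulation_point gamma g.
Proof.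
move=> /descent_sequence_vanishing[D [gD F_le F0 F_cvg D_0]].
have c0 : 0 < - F (gamma 0%N) by rewrite oppr_gt0.
by apply: descent_cluster_point c0 _ F_cvg gD D_0 => n; rewrite opprK.
Qed.

Lemma descent_sequence_limit gamma g : descent_sequence (F : H1 -> R^o) gamma ->
  accumulation_point gamma g ->
  [/\ F g < 0, forall h, DF g h = 0 & forall t, t \in `[0, 1] -> E (g t)].
Proof.
move=> /descent_sequence_vanishing[D [gD F_le F0 F_cvg D_0]] [phi [phi_incr phi_g]].
have [DFd [dF cDF DFdE]] := quotient_continuously_differentiable.
have phi_ge := extraction_ge phi_incr.
have Fg : F g < 0.
  apply: le_lt_trans F0.
  have cF : {for g, continuous (F : H1 -> R^o)}.
    by apply: differentiable_continuous; have [] := dF g.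
  have FF : F (gamma (phi n)) @[n --> \oo] --> F g := cvg_comp _ _ phi_g cF.
  rewrite -(cvg_lim (@Rhausdorff R) FF); apply: limr_le; first by apply/cvg_ex; exists (F g).
  by apply: nearW => n; exact: F_le.
have DFg h : DF g h = 0.
  apply/eqP; rewrite -normr_le0; apply/ler_addgt0Pr => e e0; rewrite add0r.
  have h0 : 0 < `|h| + 1 by rewrite ltr_wpDl.
  have e1 : 0 < e / 2 / (`|h| + 1) by rewrite !divr_gt0.
  have [N DN] := D_0 _ e1.
  have DD : DFd (gamma (phi n)) @[n --> \oo] --> DFd g := cvg_comp _ _ phi_g (cDF g).
  have /cvgrPdist_le/(_ _ e1)[N' _ DN'] := DD.
  pose n := maxn N N'.
  have d1 : `|DF (gamma (phi n)) h| <= e / 2.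
    rewrite gD (le_trans (H1ip_le _ _))//.
    apply: (@le_trans _ _ (e / 2 / (`|h| + 1) * (`|h| + 1))); last by rewrite divfK// gt_eqF.
    by rewrite ler_pM ?lerDl// DN// (leq_trans (leq_maxl N N') (phi_ge _)).
  have d2 : `|DF g h - DF (gamma (phi n)) h| <= e / 2.
    rewrite -!DFdE -[_ - _]/((DFd g - DFd (gamma (phi n))) h).
    rewrite (le_trans (dual_normP _ _))//.
    apply: (@le_trans _ _ (e / 2 / (`|h| + 1) * (`|h| + 1))); last by rewrite divfK// gt_eqF.
    apply: ler_pM; rewrite ?lerDl//; first exact: (normr_ge0 (DFd g - DFd (gamma (phi n)))).
    by apply: DN'; exact: leq_maxr.
  rewrite -[DF g h](subrK (DF (gamma (phi n)) h)) (le_trans (ler_normD _ _))//.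
  by rewrite [leRHS]splitr lerD.
(* The limit lies on its own sublevel, with c = - F g; this yields W g > 0 and a time at which g is
   in E. *)
have NFg : 0 < - F g by rewrite oppr_gt0.
have NNFg : F g <= - - F g by rewrite opprK.
have [Wc _ visit] := negative_sublevel NFg NNFg.
split=> //.
have Wg : 0 < W g by apply: lt_le_trans Wc; rewrite mulr_gt0// oppr_gt0.
suff g_stat : forall h : H1, (forall t, t \in `[0, 1] -> h t = 0 \/ ~ E (g t)) -> dirichlet g h = 0.
  by move=> t t01; exact: (stationary_confined cE cvE g_stat visit t01).
move=> h hO.
(* For such h the force term drops out, and W g, beta and the kinetic energy are nonzero factors of
   what remains. *)
have := DFg h; rewrite /Dquotient (force_work_out wE gE hO) oppr0 mul0r add0r.
move=> /eqP; rewrite !mulf_eq0 invr_eq0 expf_eq0/=.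
by rewrite (gt_eqF Wg) (gt_eqF beta0) (gt_eqF (kinetic_gt0 alpha0 beta0 g)) orbF => /eqP.
Qed.

End PotentialDescent.

Theorem theoremA6 (R : realType) (d : nat) (d_ge1 : (1 <= d)%N)
    (Omega : set 'rV[R]_d) (Omega_open : open Omega)
    (Omega_bounded : bounded_set Omega)
    (H : R -> hilbert R) (D : completeNormedModType R)
    (i : forall t, D -> H t) (hypH : hypothesis_H i)
    (Kstar : forall t, dual (C11 (closure Omega)) -> H t)
    (K : forall t, H t -> C11 (closure Omega))
    (E : set 'rV[R]_d) (hypF : hypothesis_F i Kstar K E)
    (rho : R -> borel_measure (closure Omega))
    (rho_Cw : narrowly_continuous rho)
    (f : forall t, H t) (f_L2 : L2_H i f)
    (alpha beta : R) (alpha_gt0 : 0 < alpha) (beta_gt0 : 0 < beta) :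
  let F : H1 R d -> R := curve_functional Kstar K alpha beta rho f in
  (exists DF : H1 R d -> dual (H1 R d),
    (forall gamma, is_diff gamma F (DF gamma)) /\ continuous DF) /\
  forall gamma : nat -> H1 R d, descent_sequence F gamma ->
    (exists g, accumulation_point gamma g) /\
    forall g, accumulation_point gamma g ->
      [/\ F g < 0,
          forall h, 'd F g h = 0 &
          forall t, t \in `[0, 1] -> E (g t)].

Proof.
move=> F; have [_ [_ _ _ [clE cvE [cE EO] _]]] := hypF.
rewrite (_ : closure E = E) in cE EO; last exact/esym/closure_id.
have [w [m [suppE [wm gm gS] mint wmeas wN]]] :=
  potential_data Omega_bounded hypH hypF rho_Cw f_L2.
have wE t : supp (w t) `<=` E by case: (suppE t).
have gE t : supp (grad (w t)) `<=` E by case: (suppE t).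
have [r [r0 margin]] := compact_margin Omega_open cE EO.
have K0 : 0 <= 1 + 2 / r by rewrite addr_ge0// divr_ge0// ltW.
have gK t x y : enorm (grad (w t) x - grad (w t) y) <=
    (1 + 2 / r) * m t * enorm (x - y).
  exact: (C11_grad_lipschitz EO (@wE t) (@gE t) (gm t) (gS t) r0 margin).
(* An identity on all of H^1, so differentials, descent sequences and limits transfer by
   rewriting. *)
have FE : F = quotient (potential w) alpha beta.
  apply/funext => g; apply: (curve_functionalE alpha beta wN).
  exact: (potential_measurable Omega_open cE EO wE gE wmeas).
rewrite FE; split.
  have [DF [dF cDF _]] := quotient_continuously_differentiable Omega_open cE EO
    wE gE wm gm gK mint wmeas K0 alpha_gt0 beta_gt0.
  by exists DF.
move=> gamma gamma_descent; split.
  exact: (descent_sequence_cluster_point Omega_open cE EO wE gE wm gm gK mint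
    wmeas K0 alpha_gt0 beta_gt0 gamma_descent).
move=> g gamma_g; have [Fg DFg gE'] := descent_sequence_limit Omega_open cE EO
  wE gE wm gm gK mint wmeas K0 alpha_gt0 beta_gt0 cvE gamma_descent gamma_g.
split=> // h; rewrite -(DFg h).
exact: (differential_quotient Omega_open cE EO wE gE wm gm gK mint wmeas K0
  alpha_gt0 beta_gt0).
Qed.
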